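(* For any $s\in(1,\tfrac32]$, there exists an initial datum $u_0\in L^\infty(\mathbb R)\cap\dot H^1(\mathbb R)\cap\dot H^s(\mathbb R)$ for which the corresponding unique global dissipative solution $u$ of the Hunter--Saxton equation $$\partial_t u+u\,\partial_x u=\frac12\int_{-\infty}^x\big(\partial_x u(t,y)\big)^2\,\mathrm dy,\qquad u(0,x)=u_0(x),$$ satisfies $$\sup_{0<t<T}\|u(t,\cdot)\|_{\dot H^s(\mathbb R)}=\infty\qquad\text{for every }T>0.$$ In particular, $u\notin C([0,T];\dot H^s(\mathbb R))$ for every $T>0$.
   Context: Sobolev seminorms. $L^\infty(\mathbb R)\cap\dot H^1(\mathbb R)$ is the set of bounded functions $u$ on $\mathbb R$ with weak derivative in $L^2(\mathbb R)$ (taken with their continuous, locally absolutely continuous representative), and $\|u\|_{\dot H^1}=\|u'\|_{L^2}$. Homogeneous Sobolev seminorms are defined through the Fourier transform; for $u\in L^\infty\cap\dot H^1$ and $1<s<2$, $\|u\|_{\dot H^s}=\|u'\|_{\dot H^{s-1}}\in[0,\infty]$ with $\|f\|_{\dot H^r}=\||\xi|^r\widehat f\|_{L^2}$, and for $0<r<1$ equivalently (up to constants) $\|f\|_{\dot H^r}^2\simeq\iint_{\mathbb R^2}\frac{|f(x)-f(y)|^2}{|x-y|^{1+2r}}\,\mathrm dx\,\mathrm dy$. Dissipative solution. For $u_0\in L^\infty(\mathbb R)\cap\dot H^1(\mathbb R)$, set $I_0=\mathbb R$ and, for $t>0$, $I_t=\{\xi\in\mathbb R: u_0'(\xi)\text{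 exists and }u_0'(\xi)>-2/t\}$. For $t\ge 0$ and $\xi\in\mathbb R$ the dissipative characteristic is $$X(t,\xi)=\xi+t\,u_0(\xi)+\frac12\int_0^t(t-\tau)\int_{I_\tau\cap(-\infty,\xi)}u_0'(\zeta)^2\,\mathrm d\zeta\,\mathrm d\tau,$$ and the unique global dissipative solution $u$ with initial datum $u_0$ is the function on $[0,\infty)\times\mathbb R$ represented by $$u(t,X(t,\xi))=u_0(\xi)+\frac12\int_0^t\int_{I_\tau\cap(-\infty,\xi)}u_0'(\zeta)^2\,\mathrm d\zeta\,\mathrm d\tau.$$ It is a known fact (Bressan--Constantin, Dafermos) that this defines $u$ globally and unambiguously: for each $t\geq 0$, $X(t,\cdot)$ is continuous, nondecreasing and onto $\mathbb R$. *)

(* Defs.v *)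
From HB Require Import structures.
From mathcomp Require Import all_boot all_order all_algebra.
From mathcomp Require Import complex.
From mathcomp Require Import all_classical all_reals all_analysis.

Set Implicit Arguments.
Unset Strict Implicit.
Unset Printing Implicit Defensive.

Import Order.TTheory GRing.Theory Num.Theory.
Import numFieldNormedType.Exports.

Local Open Scope classical_set_scope.
Local Open Scope ring_scope.

Definition L2norm {R : realType} (f : R -> R) : \bar R :=
  ('N[@lebesgue_measure R]_2%:E [EFin \o f])%E.

Definition square_integrable {R : realType} (f : R -> R) : Prop :=
  f \in Lfun (@lebesgue_measure R) 2%:E.

(* Test functions are C^1 with compact support; for locally integrable
   functions this gives the same weak derivatives as C^infty test functions. *)
Definition test_function {R : realType} (phi : R -> R) : Prop :=
  [/\ forall x : R, derivable phi x 1, continuous (derive1 phi) &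
      compact (closure [set x | phi x != 0])].

Definition weak_derivative {R : realType} (u g : R -> R) : Prop :=
  [/\ locally_integrable setT u, locally_integrable setT g &
      forall phi, test_function phi ->
        \int[lebesgue_measure]_x (u x * derive1 phi x) =
        - \int[lebesgue_measure]_x (g x * phi x)].

(* Elements are represented by their (unique) continuous representative,
   which is automatically locally absolutely continuous. *)
Definition Linfty_Hdot1 {R : realType} (u : R -> R) : Prop :=
  [/\ bounded_fun u, continuous u &
      exists2 g, weak_derivative u g & square_integrable g].

(* A square integrable weak derivative of u is unique up to null sets; the
   value 0 when there is none is a convention never used on Linfty_Hdot1. *)
Definition wderiv {R : realType} (u : R -> R) : R -> R :=
  xget (fun=> 0) [set g | weak_derivative u g /\ square_integrable g].

(* Integral of f x * exp (- i x xi) over [-n, n]; the 2 pi normalization only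
   changes the seminorms below by a constant factor. *)
Definition truncated_fourier {R : realType} (f : R -> R) (n : nat) (xi : R) :
    R[i] :=
  Complex
    (\int[lebesgue_measure]_(x in `[- n%:R, n%:R]) (f x * cos (x * xi)))
    (- \int[lebesgue_measure]_(x in `[- n%:R, n%:R]) (f x * sin (x * xi))).

(* Fourier transform on L^2 (Plancherel): fhat is the limit in L^2, as n tends
   to infinity, of the truncated Fourier integrals of f. *)
Definition is_fourier {R : realType} (f : R -> R) (fhat : R -> R[i]) : Prop :=
  [/\ measurable_fun setT (fun xi => complex.Re (fhat xi)),
      measurable_fun setT (fun xi => complex.Im (fhat xi)) &
      L2norm (fun xi => ComplexField.Normc.normc
                          (truncated_fourier f n xi - fhat xi))
        @[n --> \oo] --> 0%E].

(* Unique up to null sets, and existing for every square integrable f. *)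
Definition fourier {R : realType} (f : R -> R) : R -> R[i] :=
  xget (fun=> 0) [set fhat | is_fourier f fhat].

Definition Hdot_seminorm_L2 {R : realType} (r : R) (f : R -> R) : \bar R :=
  L2norm (fun xi => `|xi| `^ r * ComplexField.Normc.normc (fourier f xi)).

(* For 1 < s < 2 and u in Linfty_Hdot1. *)
Definition Hdot_seminorm {R : realType} (s : R) (u : R -> R) : \bar R :=
  Hdot_seminorm_L2 (s - 1) (wderiv u).

(* The set I_t; derivatives here are pointwise. *)
Definition surviving_set {R : realType} (u0 : R -> R) (t : R) : set R :=
  if t == 0 then setT
  else [set xi | derivable u0 xi 1 /\ - 2 / t < derive1 u0 xi].

Definition left_energy {R : realType} (u0 : R -> R) (t xi : R) : R :=
  \int[lebesgue_measure]_(zeta in surviving_set u0 t `&` `]-oo, xi[)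
    (derive1 u0 zeta) ^+ 2.

Definition characteristic {R : realType} (u0 : R -> R) (t xi : R) : R :=
  xi + t * u0 xi
  + 2^-1 * \int[lebesgue_measure]_(tau in `[0, t])
             ((t - tau) * left_energy u0 tau xi).

(* The global dissipative solution of the Hunter-Saxton equation with initial
   datum u0. The values of u at negative times are irrelevant. *)
Definition dissipative_solution {R : realType} (u0 : R -> R) (u : R -> R -> R) :
    Prop :=
  forall t xi : R, 0 <= t ->
    u t (characteristic u0 t xi) =
    u0 xi + 2^-1 * \int[lebesgue_measure]_(tau in `[0, t])
                     left_energy u0 tau xi.

(* u belongs to C([0, T]; Hdot^s), for the seminorm topology. *)
Definition continuous_in_Hdot {R : realType} (s T : R) (u : R -> R -> R) :
    Prop :=
  (forall t : R, t \in `[0, T] -> (Hdot_seminorm s (u t) < +oo)%E) /\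
  (forall t0 : R, t0 \in `[0, T] ->
     Hdot_seminorm s (u t \- u t0) @[t --> within `[0, T] (nbhs t0)] --> 0%E).

(* Main.v *)
Require Import Defs.
From HB Require Import structures.
From mathcomp Require Import all_boot all_order all_algebra.
From mathcomp Require Import complex.
From mathcomp Require Import all_classical all_reals all_analysis.
From mathcomp Require Import measurable_realfun.
From mathcomp Require Import ring lra.

(** The datum is [u0 = - prim V], where [V >= 0] has compact support and a
logarithmic singularity at the origin: it is the sum over k of bumps of width
4^-k and height 1 / (k + 1). Two facts about these coefficients carry the
proof. Their sum diverges: V is equal on the interval from 4^-n / 2 to 4^-n to
the partial sum [height n], which tends to infinity ([profile_plateau],
[height_unbounded]). The sum of their squares converges, and together with the
geometric spacing of the scales this bounds the H^(1/2) seminorm of V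
([profile_fourier_int]), so that u0 lies in H^s for every 1 < s <= 3/2.

For a nonincreasing datum the dissipative solution is explicit. The slope - V
x carried by the label x becomes - V x / p with p = max 0 (1 - t V x / 2), and
lengths around that label are multiplied by p^2 ([characteristicE],
[prim_slope], [solution_prim]). A plateau of height h and width w is therefore
mapped at time t to one of height h / e and width e^2 w, with e = 1 - t h / 2.
As t increases to 2 / h its L^2 norm stays equal to h sqrt w while its width
shrinks to zero ([slope_plateau]).

Such a concentration is incompatible with a bounded seminorm of any positive
order r = s - 1. Since the slope has one sign, its centred Fourier integral,
integrated against the Fejer weight over the frequencies below 1 / (e^2 w), is
at least a constant times h / e in absolute value. Frequencies below a cut-off
a contribute at most a times the L^1 norm, which is at most that of V
([slope_int_le]); those above contribute at most a^(- r) / (e sqrt w) times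
(N^2 + 1) / 2, where N is the seminorm ([concentration_bound]). With a large
and then e small, this is impossible for bounded N. Hence the seminorm of [u
t] tends to infinity as t increases to 2 / h ([slope_fourier_blowup]). The
times 2 / [height n] tend to 0, so the supremum over any interval ]0, T[ is
infinite. Continuity on [0, T] fails at any time 2 / [height n] < T: there it
would give a finite seminorm, and by the triangle inequality a bound just
before that time.

The seminorm is defined through choices of a weak derivative and of a Fourier
transform. Both are removed by [Hdot_seminormE]: weak derivatives are unique
almost everywhere ([weak_derivative_unique]), and the slopes have bounded
support, so their truncated Fourier integrals are eventually constant
([fourier_compact]). *)

Set Implicit Arguments.
Unset Strict Implicit.
Unset Printing Implicit Defensive.

Import Order.TTheory GRing.Theory Num.Theory.
Import numFieldNormedType.Exports.

Local Open Scope classical_set_scope.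
Local Open Scope ring_scope.

(** * Integration on the line *)

Section integration.
Context {R : realType}.
Notation mu := (@lebesgue_measure R).
Implicit Types (f g a b : R -> R) (D : set R).

Lemma ae_imply (P Q : R -> Prop) : (forall x, P x -> Q x) ->
  {ae mu, forall x, P x} -> {ae mu, forall x, Q x}.
Proof.
by move=> PQ; apply: filterS => //; exact: (ae_filter_ringOfSetsType mu).
Qed.

Lemma ae_and (P Q : R -> Prop) : {ae mu, forall x, P x} ->
  {ae mu, forall x, Q x} -> {ae mu, forall x, P x /\ Q x}.
Proof. by move=> hP hQ; apply: (@filterI _ _ (ae_filter_ringOfSetsType mu)). Qed.

Lemma ae_neq (c : R) : {ae mu, forall x, x != c}.
Proof.
exists [set c]; split; [exact: measurable_set1|exact: lebesgue_measure_set1|].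
by move=> x /= /negP; rewrite negbK => /eqP.
Qed.

Definition L1 f := mu.-integrable setT (EFin \o f).

Lemma L1_measurable f : L1 f -> measurable_fun setT f.
Proof. by move=> /integrableP[/measurable_EFinP]. Qed.

Lemma L1_le f g : measurable_fun setT f -> (forall x, `|f x| <= g x) ->
  L1 g -> L1 f.
Proof.
move=> mf fg; apply: le_integrable => //; first exact/measurable_EFinP.
by move=> x _ /=; rewrite lee_fin (le_trans (fg x))// ler_norm.
Qed.

Lemma L1D f g : L1 f -> L1 g -> L1 (fun x => f x + g x).
Proof. by move=> lf lg; exact: (integrableD measurableT lf lg). Qed.

Lemma L1B f g : L1 f -> L1 g -> L1 (fun x => f x - g x).
Proof. by move=> lf lg; exact: (integrableB measurableT lf lg). Qed.

Lemma L1N f : L1 f -> L1 (fun x => - f x).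
Proof. by move=> lf; exact: (integrableN lf). Qed.

Lemma L1Z (c : R) f : L1 f -> L1 (fun x => c * f x).
Proof. by move=> lf; exact: (integrableZl measurableT c lf). Qed.

Lemma L1_abs f : L1 f -> L1 (fun x => `|f x|).
Proof. by move=> lf; exact: (integrable_norm lf). Qed.

Lemma L1_mul_bounded f g (M : R) : L1 f -> measurable_fun setT g ->
  (forall x, `|g x| <= M) -> L1 (fun x => f x * g x).
Proof.
move=> lf mg gM; apply: (@L1_le _ (fun x => M * `|f x|)).
- by apply: measurable_funM => //; exact: L1_measurable.
- by move=> x; rewrite normrM mulrC ler_wpM2r.
- exact/L1Z/L1_abs.
Qed.

Lemma L1_restrict f D : measurable D -> mu.-integrable D (EFin \o f) ->
  L1 (fun x => f x * \1_D x).
Proof.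
move=> mD; have := @integrable_mkcond _ _ R mu D (EFin \o f) mD.
rewrite restrict_EFin => h /h.
rewrite (_ : f \_ D = fun x => f x * \1_D x)//.
by apply/funext => x; rewrite patchE indicE; case: ifPn; rewrite ?mulr1 ?mulr0.
Qed.

Lemma L1_indic f D : measurable D -> L1 f -> L1 (fun x => f x * \1_D x).
Proof. by move=> mD lf; apply: L1_restrict => //; exact: integrableS lf. Qed.

Lemma Rint_restrict f D :
  \int[mu]_(x in D) f x = \int[mu]_x (f x * \1_D x).
Proof.
rewrite Rintegral_mkcond; congr Rintegral.
by apply/funext => x; rewrite patchE indicE; case: ifPn; rewrite ?mulr1 ?mulr0.
Qed.

Lemma L1_on f D : measurable D -> L1 f -> mu.-integrable D (EFin \o f).
Proof. by move=> mD; apply: integrableS. Qed.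

Lemma Rint_EFin f D : measurable D -> mu.-integrable D (EFin \o f) ->
  (\int[mu]_(x in D) f x)%:E = (\int[mu]_(x in D) (f x)%:E)%E.
Proof. by move=> mD lf; rewrite /Rintegral fineK//; exact: integrable_fin_num. Qed.

Lemma Rint_ae_eq f g D : measurable D -> measurable_fun D f ->
  measurable_fun D g -> {ae mu, forall x, D x -> f x = g x} ->
  \int[mu]_(x in D) f x = \int[mu]_(x in D) g x.
Proof.
move=> mD mf mg fg; congr fine; apply: ae_eq_integral => //.
- exact/measurable_EFinP.
- exact/measurable_EFinP.
- by apply: (ae_imply _ fg) => x /= {}fg Dx; rewrite fg.
Qed.

Lemma Rint_le_abs f : L1 f -> `|\int[mu]_x f x| <= \int[mu]_x `|f x|.
Proof. by move=> lf; exact: le_normr_Rintegral. Qed.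

Lemma measurable_EFin f : measurable_fun setT f -> measurable_fun setT (EFin \o f).
Proof. by move=> mf; apply/measurable_EFinP. Qed.

Lemma Rint_dct (f_ : nat -> R -> R) f g :
  (forall n, measurable_fun setT (f_ n)) -> measurable_fun setT f ->
  {ae mu, forall x, f_ n x @[n --> \oo] --> f x} -> L1 g ->
  (forall n x, `|f_ n x| <= g x) ->
  L1 f /\ (\int[mu]_x f_ n x) @[n --> \oo] --> \int[mu]_x f x.
Proof.
move=> mf_ mf f_f lg fg.
have lf_ n : L1 (f_ n) by exact: L1_le lg.
have := @dominated_convergence _ _ R mu setT measurableT
  (fun n x => (f_ n x)%:E) (fun x => (f x)%:E) (fun x => (g x)%:E).
case.
- by move=> n; exact: measurable_EFin.
- exact: measurable_EFin.
- by apply: ae_imply f_f => x h _; apply: cvg_EFin => //; exact: nearW.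
- by [].
- by apply: aeW => x n _; rewrite /= lee_fin.
move=> /= lf _ hc; split => //; rewrite /Rintegral; apply: fine_cvg.
rewrite fineK; last exact: integrable_fin_num lf.
exact: hc.
Qed.

Lemma Rint_indic_itv (a b : R) (b0 b1 : bool) : a <= b ->
  \int[mu]_x \1_[set` Interval (BSide b0 a) (BSide b1 b)] x = b - a.
Proof.
move=> ab; transitivity (\int[mu]_(x in [set` Interval (BSide b0 a) (BSide b1 b)]) (1:R)).
  by rewrite [RHS]Rint_restrict; apply: eq_Rintegral => x _; rewrite mul1r.
have mI := @lebesgue_measure_itv R (Interval (BSide b0 a) (BSide b1 b)).
rewrite Rintegral_cst; last exact: measurable_itv.
rewrite mul1r; transitivity (fine (if a < b then (b - a)%:E else 0%E)); last first.
  by have [//|ba] := ltP a b; rewrite (@le_anti _ _ a b) ?subrr ?ab.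
by congr fine; rewrite [LHS]mI/= lte_fin.
Qed.

Lemma L1_indic_itv (a b : R) (b0 b1 : bool) :
  L1 (fun x => \1_[set` Interval (BSide b0 a) (BSide b1 b)] x).
Proof. exact: (@integrable_indic_itv R a b b0 b1). Qed.

Lemma L1_ge0 f : measurable_fun setT f -> (forall x, 0 <= f x) ->
  (\int[mu]_x (f x)%:E < +oo)%E -> L1 f.
Proof.
move=> mf f0 h; apply/integrableP; split; first exact: measurable_EFin.
by under eq_integral do rewrite /= ger0_norm//.
Qed.

(** Domination by a product of two integrable functions of one variable gives
integrability on the plane, and it is what the kernels below satisfy: each is a
bounded function times one integrable factor per variable. *)
Section fubini.
Variables (F : R * R -> R) (a b : R -> R).
Hypothesis mF : measurable_fun setT F.
Hypothesis la : L1 a.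
Hypothesis lb : L1 b.
Hypothesis Fab : forall x y, `|F (x, y)| <= a x * b y.

Let lFx x : L1 (fun y => F (x, y)).
Proof.
apply: (@L1_le _ (fun y => a x * b y)) => //; last exact: L1Z.
exact: measurableT_comp.
Qed.

Let lFy y : L1 (fun x => F (x, y)).
Proof.
apply: (@L1_le _ (fun x => b y * a x)) => //; last exact: L1Z.
  exact: measurableT_comp.
by move=> x; rewrite mulrC.
Qed.

Let iF : (mu \x mu)%E.-integrable setT (EFin \o F).
Proof.
apply/integrable12ltyP; first exact/measurable_EFinP.
apply: (@le_lt_trans _ _ (\int[mu]_x `|(a x * \int[mu]_y b y)%:E|)%E); last first.
  have : L1 (fun x => a x * \int[mu]_y b y).
    by under eq_fun do rewrite mulrC; exact: L1Z.
  by case/integrableP.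
apply: ge0_le_integral => //.
- by move=> x _; exact: integral_ge0.
- apply: (measurable_fun_fubini_tonelli_F (m2 := mu) (fun z => `|(EFin \o F) z|%E)) => //.
  by apply: measurableT_comp => //; exact/measurable_EFinP.
- apply/measurable_EFinP; apply: measurableT_comp => //.
  by apply: measurable_funM => //; exact: L1_measurable.
- move=> x _; rewrite -RintegralZl// (@le_trans _ _ (\int[mu]_y (a x * b y)%:E)%E)//.
    apply: ge0_le_integral => //.
    + by have /L1_abs/L1_measurable/measurable_EFinP := lFx x.
    + by apply/measurable_EFinP/measurable_funM => //; exact: L1_measurable.
    + by move=> y _ /=; rewrite lee_fin.
  by rewrite -Rint_EFin//; [rewrite lee_fin ler_norm|exact: L1Z].
Qed.

Lemma L1_fubini1 : L1 (fun x => \int[mu]_y F (x, y)).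
Proof.
have := integrable_fubini_F iF; rewrite /fubini_F/=.
by apply: eq_integrable => // x _ /=; rewrite Rint_EFin//; exact: lFx.
Qed.

Lemma Rint_fubini :
  \int[mu]_x (\int[mu]_y F (x, y)) = \int[mu]_y (\int[mu]_x F (x, y)).
Proof.
rewrite /Rintegral; congr fine.
transitivity (\int[mu]_x \int[mu]_y (F (x, y))%:E)%E.
  by apply: eq_integral => x _; rewrite -Rint_EFin//; exact: lFx.
rewrite (Fubini iF); apply: eq_integral => y _.
by rewrite -Rint_EFin//; exact: lFy.
Qed.

End fubini.

Lemma measurable_abs f : measurable_fun setT f -> measurable_fun setT (fun x => `|f x|).
Proof. by move=> mf; apply: measurableT_comp. Qed.

Lemma L1_ae f g : L1 f -> measurable_fun setT g ->
  {ae mu, forall x, f x = g x} -> L1 g.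
Proof.
move=> lf mg fg; apply/integrableP; split; first exact: measurable_EFin.
have /integrableP[mf] := lf; congr (_ < _)%E.
apply: ae_eq_integral => //.
- by have /measurable_EFin := measurable_abs (L1_measurable lf).
- by have /measurable_EFin := measurable_abs mg.
- by apply: ae_imply fg => x /= -> _.
Qed.

Lemma L1_itv f (a b : R) : continuous f -> mu.-integrable `[a, b] (EFin \o f).
Proof.
move=> cf; apply: continuous_compact_integrable; first exact: segment_compact.
exact: continuous_subspaceT.
Qed.

Lemma measurable_except (f g : R -> R) (c : R) : measurable_fun setT g ->
  (forall x, x != c -> f x = g x) -> measurable_fun setT f.
Proof.
move=> mg fg; rewrite (_ : f = fun x => g x + (f c - g c) * \1_`[c, c] x).
  by apply: measurable_funD => //; apply: measurable_funM.
apply/funext => x; rewrite indicE mem_setE in_itv/= -eq_le eq_sym.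
by have [->|/fg ->] := eqVneq x c; rewrite ?mulr1 ?mulr0; ring.
Qed.

Lemma Rint_except (f g : R -> R) (c : R) : measurable_fun setT g ->
  (forall x, x != c -> f x = g x) -> \int[mu]_x f x = \int[mu]_x g x.
Proof.
move=> mg fg; apply: Rint_ae_eq => //; first exact: measurable_except fg.
by apply: ae_imply (ae_neq c) => x xc _; exact: fg.
Qed.

Lemma L1_sum (F : nat -> R -> R) n : (forall k, L1 (F k)) ->
  L1 (fun x => \sum_(k < n) F k x).
Proof.
move=> lF; elim: n => [|n IH].
  rewrite (_ : (fun x => _) = cst 0); first exact: integrable0.
  by apply/funext => x; rewrite big_ord0.
under eq_fun do rewrite big_ord_recr.
exact: L1D.
Qed.

Lemma Rint_sum (F : nat -> R -> R) n : (forall k, L1 (F k)) ->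
  \int[mu]_x (\sum_(k < n) F k x) = \sum_(k < n) \int[mu]_x F k x.
Proof.
move=> lF; elim: n => [|n IH].
  rewrite big_ord0 -[RHS](mul0r (fine (mu setT))) -Rintegral_cst//.
  by apply: eq_Rintegral => x _; rewrite big_ord0.
rewrite big_ord_recr/= -IH -[RHS](RintegralD _ (L1_sum n lF) (lF n))//.
by apply: eq_Rintegral => x _; rewrite big_ord_recr.
Qed.

Lemma fatou_bound (f_ : nat -> R -> R) (f : R -> R) (C : R) :
  (forall n, measurable_fun setT (f_ n)) -> (forall n x, 0 <= f_ n x) ->
  (forall x, f_ n x @[n --> \oo] --> f x) ->
  (forall n, (\int[mu]_x (f_ n x)%:E <= C%:E)%E) ->
  (\int[mu]_x (f x)%:E <= C%:E)%E.
Proof.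
move=> mf f0 ff fC.
have fat := @fatou _ _ R mu setT measurableT (fun n x => (f_ n x)%:E)
  (fun n => measurable_EFin (mf n)) (fun n x _ => f0 n x).
apply: (@le_trans _ _ (\int[mu]_x limn_einf (fun n => (f_ n x)%:E))%E).
  rewrite le_eqVlt; apply/orP; left; apply/eqP; apply: eq_integral => x _.
  have cE : EFin (f_ n x) @[n --> \oo] --> (f x)%:E.
    by apply: cvg_EFin; [exact: nearW|exact: ff].
  rewrite is_cvg_limn_einfE; last by apply/cvg_ex; exists (f x)%:E.
  by apply/esym/cvg_lim.
apply: (le_trans fat); rewrite limn_einf_lim; apply: lime_le.
  exact: is_cvg_einfs.
apply: nearW => n; apply: le_trans (fC n); apply: ereal_inf_lbound.
by exists n => //=.
Qed.
End integration.

(** * Primitives and weak derivatives *)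

Section primitives.
Context {R : realType}.
Notation mu := (@lebesgue_measure R).
Implicit Types (f g : R -> R).

Lemma Rint_FTC2 (f F : R -> R) (x y : R) : x <= y ->
  (forall z : R, is_derive z 1 F (f z)) -> continuous f ->
  \int[mu]_(z in `[x, y]) f z = F y - F x.
Proof.
rewrite le_eqVlt => /predU1P[<- _ _|xy dF cf].
  by rewrite set_itv1 Rintegral_set1 subrr.
have cF z : {for z, continuous F}.
  apply: differentiable_continuous; apply/derivable1_diffP.
  by have [] := dF z.
rewrite /Rintegral (continuous_FTC2 (F := F))//.
- exact: continuous_subspaceT.
- split => [z _||]; first by have [] := dF z.
  + exact/cvg_at_right_filter/cF.
  + exact/cvg_at_left_filter/cF.
- by move=> z _; rewrite derive1E; have [] := dF z.
Qed.

Lemma Rint_lty_restrict f (y N : R) : (forall x, N < x -> f x = 0) ->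
  \int[mu]_x (f x * \1_`[y, +oo[ x) = \int[mu]_(x in `[y, N]) f x.
Proof.
move=> f0; rewrite [RHS]Rint_restrict; apply: eq_Rintegral => x _.
rewrite !indicE !mem_setE !in_itv/= andbT.
by have [yx|] := leP y x; have [xN|/f0 ->] := leP x N; rewrite ?mul0r.
Qed.

Definition prim f (x : R) := \int[mu]_(y in `]-oo, x]) f y.

Lemma primE f x : prim f x = \int[mu]_y (f y * \1_`]-oo, x] y).
Proof. exact: Rint_restrict. Qed.

Lemma primB f (x y : R) : L1 f -> x <= y ->
  prim f y - prim f x = \int[mu]_(z in `]x, y]) f z.
Proof.
move=> lf xy; rewrite /prim Rintegral_itvB//.
by apply: L1_on => //; exact: measurable_itv.
Qed.

Lemma primBoo f (x y : R) : L1 f -> x <= y ->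
  prim f y - prim f x = \int[mu]_(z in `[x, y]) f z.
Proof.
move=> lf xy; rewrite primB// Rintegral_itv_obnd_cbnd//.
by apply: L1_on => //; exact: measurable_itv.
Qed.

Lemma primZ (c : R) (f : R -> R) x : L1 f -> prim (fun y => c * f y) x = c * prim f x.
Proof. by move=> lf; rewrite /prim RintegralZl//; apply: L1_on => //; exact: measurable_itv. Qed.

Lemma primB_fun (f g : R -> R) x : L1 f -> L1 g -> prim (fun y => f y - g y) x = prim f x - prim g x.
Proof.
by move=> lf lg; rewrite /prim RintegralB//; apply: L1_on => //; exact: measurable_itv.
Qed.

Lemma prim_abs f x : L1 f -> `|prim f x| <= \int[mu]_y `|f y|.
Proof.
move=> lf; rewrite primE.
have l1 : L1 (fun y => f y * \1_`]-oo, x] y) by exact: L1_indic (measurable_itv _) lf.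
apply: (le_trans (Rint_le_abs l1)); apply: le_Rintegral => //.
- exact: L1_abs l1.
- exact: L1_abs lf.
- move=> y _; rewrite normrM ler_piMr//.
  by rewrite indicE; case: (_ \in _); rewrite ?normr1 ?normr0.
Qed.

Lemma prim_continuous f : L1 f -> continuous (prim f).
Proof.
move=> lf x.
have lfI : mu.-integrable `[x - 1, x + 1] (EFin \o f).
  by apply: L1_on => //; exact: measurable_itv.
have xx : x - 1 <= x + 1 by lra.
have := parameterized_integral_continuous xx lfI.
move=> /within_continuous_continuous => /(_ x) cxI.
have cx : {for x, continuous (parameterized_integral mu (x - 1) ^~ f)}.
  by apply: cxI; [lra|rewrite in_itv/=; lra].
have h : \forall y \near x, prim f y = prim f (x - 1) + parameterized_integral mu (x - 1) y f.
  near=> y; rewrite /parameterized_integral -primBoo; [ring|by []|].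
  apply: ltW; near: y; apply: lt_nbhsr; lra.
rewrite /continuous_at (nbhs_singleton h).
have h2 : (prim f (x - 1) + parameterized_integral mu (x - 1) y f) @[y --> x]
    --> prim f (x - 1) + parameterized_integral mu (x - 1) x f.
  by apply: cvgD; [exact: cvg_cst|exact: cx].
apply: (cvg_trans _ h2).
by apply: near_eq_cvg; apply: filterS h => y ->.
Unshelve. all: by end_near. Qed.

Section test_functions.
Variable phi : R -> R.
Hypothesis tphi : test_function phi.

Lemma test_derive (x : R) : is_derive x 1 phi (derive1 phi x).
Proof. by have [d _ _] := tphi; rewrite derive1E; exact: DeriveDef. Qed.

Lemma test_continuous : continuous phi.
Proof.
move=> x; apply: differentiable_continuous; apply/derivable1_diffP.
by have [] := test_derive x.
Qed.

Lemma test_support : exists2 M : R, 0 < M &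
  forall x, M < `|x| -> phi x = 0 /\ derive1 phi x = 0.
Proof.
have [_ _ /compact_bounded [M [Mr hM]]] := tphi.
pose K := `|M| + 1.
have K0 : 0 < K by rewrite /K; have := normr_ge0 M; lra.
have MK : M < K by rewrite /K; have := ler_norm M; lra.
have phi0 x : K < `|x| -> phi x = 0.
  move=> Kx; apply/eqP/negPn/negP => px.
  by have /= := hM _ MK x (@subset_closure _ _ x px); rewrite leNgt Kx.
exists K => // x Kx; split; first exact: phi0.
rewrite derive1E (near_eq_derive (g := cst 0))//; first exact: derive_cst.
near=> z; apply: phi0; near: z.
have : (fun z : R => `|z|) @ x --> `|x| by exact: norm_continuous.
by move=> /(cvgr_gt `|x|) /(_ K Kx).
Unshelve. all: by end_near. Qed.

End test_functions.

Lemma compact_support_bounded f (M : R) : continuous f ->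
  (forall x, M < `|x| -> f x = 0) -> exists2 B : R, 0 <= B & forall x, `|f x| <= B.
Proof.
move=> cf f0.
have : compact (f @` `[-M, M]).
  apply: continuous_compact; last exact: segment_compact.
  exact: continuous_subspaceT.
move=> /compact_bounded [B [Br hB]]; exists (`|B| + 1) => [|x].
  by have := normr_ge0 B; lra.
have BB : B < `|B| + 1 by have := ler_norm B; lra.
have [Mx|xM] := ltP M `|x|; first by rewrite f0// normr0; have := normr_ge0 B; lra.
by apply: (hB _ BB); exists x => //=; rewrite in_itv/= -ler_norml.
Qed.

Lemma loc_L1 f (M : R) : locally_integrable setT f -> L1 (fun x => f x * \1_`[-M, M] x).
Proof.
move=> [mf _ lf]; apply: L1_restrict; first exact: measurable_itv.
apply/integrableP; split; first by apply/measurable_EFinP; exact: measurable_funTS.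
by apply: lf => //; exact: segment_compact.
Qed.

Lemma L1_loc f : L1 f -> locally_integrable setT f.
Proof. by apply: open_integrable_locally => //; exact: openT. Qed.

Lemma loc_L1_mul f g (M : R) : locally_integrable setT f -> continuous g ->
  (forall x, M < `|x| -> g x = 0) -> L1 (fun x => f x * g x).
Proof.
move=> lf cg g0; have [B _ gB] := compact_support_bounded cg g0.
rewrite (_ : (fun _ => _) = fun x => (f x * \1_`[-M, M] x) * g x).
  apply: L1_mul_bounded gB; first exact: loc_L1.
  exact: continuous_measurable_fun.
apply/funext => x; rewrite indicE mem_setE in_itv/= -ler_norml.
by have [|/g0 ->] := leP `|x| M; rewrite ?mulr1 ?mulr0.
Qed.

Lemma L1_continuous_support f (M : R) : continuous f ->
  (forall x, M < `|x| -> f x = 0) -> L1 f.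
Proof.
move=> cf f0; rewrite (_ : f = fun x => 1 * f x); last first.
  by apply/funext => x; rewrite mul1r.
apply: (@loc_L1_mul (cst 1) f M) => //.
split; [by []|exact: openT|move=> K _ cK].
have : measurable K by exact: compact_measurable.
move=> mK; rewrite (eq_integral (cst 1%E)); last by move=> x _; rewrite normr1.
by rewrite integral_cst//= mul1e; exact: compact_finite_measure.
Qed.

Lemma continuous_loc f : continuous f -> locally_integrable setT f.
Proof.
move=> cf; split; [exact: continuous_measurable_fun|exact: openT|].
move=> K _ cK; suff : mu.-integrable K (EFin \o f) by case/integrableP.
by apply: continuous_compact_integrable => //; exact: continuous_subspaceT.
Qed.

Lemma test_derive_tail phi (M y : R) : test_function phi ->
  (forall x, M < `|x| -> phi x = 0 /\ derive1 phi x = 0) ->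
  \int[mu]_x (derive1 phi x * \1_`[y, +oo[ x) = - phi y.
Proof.
move=> tphi hM; pose N := `|M| + `|y| + 1.
have [? ?] : `|M| + `|y| < N /\ 0 <= `|M| by rewrite /N ltrDl.
have ? := ler_norm M; have ? := ler_norm y; have ? := normr_ge0 y.
rewrite (@Rint_lty_restrict _ _ N); last first.
  by move=> x Nx; apply: (hM _ _).2; have := ler_norm x; lra.
have yN : y <= N by lra.
have [_ cphi' _] := tphi.
rewrite (Rint_FTC2 yN (test_derive tphi) cphi').
by rewrite (hM N _).1 ?sub0r//; have := ler_norm N; lra.
Qed.

Lemma test_derive_int phi : test_function phi -> \int[mu]_x derive1 phi x = 0.
Proof.
move=> tphi; have [M M0 hM] := test_support tphi.
have := test_derive_tail (- (M + 1)) tphi hM.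
rewrite (hM (- (M + 1)) _).1 ?oppr0; last first.
  by rewrite normrN; have := ler_norm (M + 1); lra.
move=> <-; apply: eq_Rintegral => x _; rewrite indicE mem_setE in_itv/= andbT.
have [?|xM] := leP (- (M + 1)) x; first by rewrite mulr1.
rewrite mulr0; apply: (hM _ _).2.
by rewrite -normrN; have := ler_norm (- x); lra.
Qed.

(** By Fubini, the pairing of [prim g] with phi' is the pairing of g with the
tail integrals of phi', which are - phi by [test_derive_tail]; the constant c
drops out because phi' has zero integral. *)
Lemma prim_weak_derivative u g (c : R) : L1 g ->
  (forall x, u x = c + prim g x) -> weak_derivative u g.
Proof.
move=> lg ug.
have -> : u = fun x => c + prim g x by exact/funext.
have cprim := prim_continuous lg.
split; [|exact: L1_loc|move=> phi tphi].
  by apply: continuous_loc => x; apply: cvgD; [exact: cvg_cst|exact: cprim].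
have [M M0 hM] := test_support tphi.
have cphi' : continuous (derive1 phi) by case: tphi.
have phi0 x : M < `|x| -> phi x = 0 by move=> /hM[].
have phi'0 x : M < `|x| -> derive1 phi x = 0 by move=> /hM[].
have lphi' : L1 (derive1 phi) := L1_continuous_support cphi' phi'0.
have lprim : L1 (fun x => prim g x * derive1 phi x).
  by apply: loc_L1_mul phi'0 => //; exact: continuous_loc.
transitivity (\int[mu]_x (c * derive1 phi x + prim g x * derive1 phi x)).
  by apply: eq_Rintegral => x _; rewrite mulrDl.
rewrite RintegralD//; last exact: L1Z.
rewrite RintegralZl// test_derive_int// mulr0 add0r.
pose F (z : R * R) := derive1 phi z.1 * (g z.2 * \1_`[(0:R), +oo[ (z.1 - z.2)).
transitivity (\int[mu]_x (\int[mu]_y F (x, y))).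
  apply: eq_Rintegral => x _; rewrite primE -RintegralZr//; last first.
    exact: L1_indic.
  apply: eq_Rintegral => y _; rewrite /F/= !indicE !mem_setE !in_itv/= andbT.
  by rewrite subr_ge0 mulrC.
rewrite (@Rint_fubini _ _ (fun x => `|derive1 phi x|) (fun y => `|g y|)).
- rewrite -[RHS]mulN1r -RintegralZl//; last first.
    by apply: loc_L1_mul phi0; [exact: L1_loc|exact: test_continuous].
  apply: eq_Rintegral => y _.
  transitivity (\int[mu]_x (g y * (derive1 phi x * \1_`[y, +oo[ x))).
    apply: eq_Rintegral => x _; rewrite /F/= !indicE !mem_setE !in_itv/= !andbT.
    by rewrite subr_ge0; ring.
  rewrite RintegralZl//; last exact: L1_indic.
  by rewrite (test_derive_tail _ tphi hM); ring.
- apply: measurable_funM.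
    by apply: measurableT_comp => //; exact: L1_measurable.
  apply: measurable_funM.
    by apply: measurableT_comp => //; exact: L1_measurable.
  apply: measurableT_comp => //.
  by apply: measurable_funB.
- exact: L1_abs.
- exact: L1_abs.
- move=> x y; rewrite /F/= !normrM ler_wpM2l// ler_piMr//.
  by rewrite indicE; case: (_ \in _); rewrite ?normr1 ?normr0.
Qed.
End primitives.

(** * Uniqueness of weak derivatives *)

Section uniqueness.
Context {R : realType}.
Notation mu := (@lebesgue_measure R).
Implicit Types (f g d : R -> R).

(** The square makes the positive part continuously differentiable at 0, as is
required of a test function built from it. *)
Definition sqpos (y : R) : R := (Num.max 0 y) ^+ 2.

Lemma is_derive_sqpos (y : R) : is_derive y 1 sqpos (2 * Num.max 0 y).
Proof.
have [y0|y0|->] := ltgtP y 0.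
- rewrite mulr0; apply: (@near_eq_is_derive _ _ _ (cst 0)).
  near=> z; rewrite /sqpos (max_idPl _) ?expr0n//.
  by apply: ltW; near: z; exact: lt_nbhsl.
- apply: (@near_eq_is_derive _ R R (fun x : R => x ^+ 2)).
    near=> z; rewrite /sqpos (max_idPr _)//.
    by apply: ltW; near: z; exact: lt_nbhsr.
  by apply: is_derive_eq; rewrite /GRing.scale/=; ring.
- rewrite mulr0.
  have h0 : h^-1 *: ((sqpos \o shift (0 : R)) (h *: (1 : R)) - sqpos 0) @[h --> 0^'] --> (0 : R).
    apply/cvgr0Pnorm_le => e e0; near=> h.
    rewrite /sqpos/= maxxx expr0n subr0 addr0 /GRing.scale/= mulr1.
    have h1 : h != 0 by near: h; exact: nbhs_dnbhs_neq.
    have he : `|h| <= e by near: h; apply: dnbhs0_le.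
    have [hlt|hgt] := leP h 0; first by rewrite expr0n mulr0 normr0 ltW.
    by rewrite expr2 mulrA mulVf// mul1r.
  apply: DeriveDef; first exact: cvgP h0.
  exact: (cvg_lim _ h0).
Unshelve. all: by end_near. Qed.

(** For 0 < w <= 1 the numbers 1 - (1 - w)^n increase to 1, and they vanish
when w = 0. Here w is a C^1 function of x that is positive exactly on ]a, b[;
the factor 4 / (b - a)^2 keeps it at most 1. So these test functions converge
to the indicator of ]a, b[. *)
Definition bump (a b : R) (n : nat) (x : R) : R :=
  1 - (1 - sqpos ((x - a) * (b - x) * (4 / (b - a) ^+ 2))) ^+ n.+1.

Lemma bump_out (a b : R) n x : a < b -> x <= a \/ b <= x -> bump a b n x = 0.
Proof.
move=> ab xab; rewrite /bump /sqpos (max_idPl _).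
  by rewrite expr0n/= subr0 expr1n subrr.
apply: mulr_le0_ge0; last by rewrite divr_ge0// sqr_ge0.
by case: xab => ?; [apply: mulr_le0_ge0|apply: mulr_ge0_le0]; lra.
Qed.

Lemma bump_in (a b x : R) : a < b -> a < x < b ->
  0 < sqpos ((x - a) * (b - x) * (4 / (b - a) ^+ 2)) <= 1.
Proof.
move=> ab /andP[ax xb].
have ba2 : 0 < (b - a) ^+ 2 by rewrite exprn_gt0//; lra.
have q0 : 0 < (x - a) * (b - x) * (4 / (b - a) ^+ 2).
  by rewrite mulr_gt0 ?divr_gt0//; rewrite mulr_gt0//; lra.
rewrite /sqpos (max_idPr (ltW q0)) exprn_gt0//=.
rewrite expr_le1//; last exact: ltW.
set m := _ * _; suff : m * (b - a) ^+ 2 <= 1 * (b - a) ^+ 2 by rewrite ler_pM2r.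
rewrite /m -[X in X <= _]mulrA mulfVK ?gt_eqF// mul1r.
by have := sqr_ge0 (x - a - (b - x)); nra.
Qed.

Lemma bump_bound (a b x : R) n : a < b -> 0 <= bump a b n x <= \1_`[a, b] x.
Proof.
move=> ab; rewrite indicE mem_setE in_itv/=.
have [xa|ax] := leP x a.
  by rewrite (bump_out _ ab); [rewrite lexx ler0n|left].
have [bx|xb] := leP b x.
  by rewrite (bump_out _ ab); [rewrite lexx ler0n|right].
rewrite (ltW ax) (ltW xb)/=.
have axb : a < x < b by rewrite ax xb.
have /andP[w0 w1] := bump_in ab axb.
rewrite /bump subr_ge0 lerBlDr lerDl exprn_ge0 ?andbT ?exprn_ile1//; lra.
Qed.

Lemma bump_cvg (a b x : R) : a < b ->
  bump a b n x @[n --> \oo] --> (\1_`]a, b[ x : R).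
Proof.
move=> ab; rewrite indicE mem_setE in_itv/=.
have [xa|ax] := leP x a.
  rewrite (_ : (fun _ => _) = cst 0); first exact: cvg_cst.
  by apply/funext => n; rewrite (bump_out _ ab)//; left.
have [bx|xb] := leP b x.
  rewrite (_ : (fun _ => _) = cst 0); first exact: cvg_cst.
  by apply/funext => n; rewrite (bump_out _ ab)//; right.
have axb : a < x < b by rewrite ax xb.
have /andP[w0 w1] := bump_in ab axb.
rewrite /= -[X in _ --> X]subr0; apply: cvgB; first exact: cvg_cst.
set w := sqpos _ in w0 w1 *.
rewrite (@cvg_shiftS _ (fun n => (1 - w) ^+ n)); apply: cvg_expr.
by rewrite ltr_norml; lra.
Qed.

Lemma bump_test (a b : R) n : a < b -> test_function (bump a b n).
Proof.
move=> ab.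
pose c := 4 / (b - a) ^+ 2.
pose q (x : R) := (x - a) * (b - x) * c.
have dq (x : R) : is_derive x 1 q ((a + b - 2 * x) * c).
  by rewrite /q; apply: is_derive_eq; rewrite /GRing.scale/=; ring.
pose b' (x : R) := n.+1%:R * (1 - sqpos (q x)) ^+ n * (2 * Num.max 0 (q x) * ((a + b - 2 * x) * c)).
have dp (y : R) : is_derive y 1 (fun y => 1 - (1 - y) ^+ n.+1) (n.+1%:R * (1 - y) ^+ n).
  rewrite (_ : (fun y => _) = (cst 1 - (fun y : R => 1 - y) ^+ n.+1)); last first.
    by apply/funext => z; rewrite !fctE.
  have d1 : is_derive y 1 (fun y : R => 1 - y) (-1).
    by apply: is_derive_eq; rewrite /=; ring.
  have := is_deriveB (is_derive_cst (1 : R) y 1) (is_deriveX n.+1 d1).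
  by rewrite /GRing.scale/= mulrN1 sub0r opprK.
have db (x : R) : is_derive x 1 (bump a b n) (b' x).
  have h := is_derive1_comp (is_derive_sqpos (q x)) (dq x).
  exact: is_derive1_comp (dp _) h.
have cq : continuous q.
  by move=> x; apply: differentiable_continuous; apply/derivable1_diffP; have [] := dq x.
have cs : continuous sqpos.
  by move=> x; apply: differentiable_continuous; apply/derivable1_diffP; have [] := is_derive_sqpos x.
have b'E : derive1 (bump a b n) = b'.
  by apply/funext => x; rewrite derive1E; have [_ ->] := db x.
split=> [x||].
- by have [] := db x.
- rewrite b'E /b' => x.
  apply: cvgM.
    apply: cvgM; first exact: cvg_cst.
    apply: (@continuous_comp _ _ _ (fun x => 1 - sqpos (q x)) (fun y => y ^+ n)); last exact: exprn_continuous.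
    apply: cvgB; first exact: cvg_cst.
    by apply: continuous_comp; [exact: cq|exact: cs].
  apply: cvgM.
    apply: cvgM; first exact: cvg_cst.
    by apply: (continuous_max (f := cst 0) (g := q)); [exact: cvg_cst|exact: cq].
  apply: cvgM; last exact: cvg_cst.
  apply: cvgB; first exact: cvg_cst.
  by apply: cvgM; [exact: cvg_cst|exact: cvg_id].
- apply: (@subclosed_compact _ _ `[a, b]).
  + exact: closed_closure.
  + exact: segment_compact.
  + rewrite closureE => x; apply; split; first exact: interval_closed.
    move=> z /= bz; rewrite in_itv/=; apply: contraT => /negP h.
    by move: bz; rewrite (bump_out _ ab) ?eqxx//; move: h; case: leP; case: leP => //; lra.
Qed.

Lemma test_orthogonal_int d (a b : R) : locally_integrable setT d ->
  (forall phi, test_function phi -> \int[mu]_x (d x * phi x) = 0) ->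
  a < b -> \int[mu]_(x in `]a, b[) d x = 0.
Proof.
move=> ld d0 ab.
have [md _ _] := ld.
pose M := `|a| + `|b|.
have Mab x : M < `|x| -> ~~ (a <= x <= b).
  apply: contraTN => /andP[ax xb]; rewrite -leNgt ler_norml /M.
  have := ler_norm a; have := ler_norm b; have := ler_norm (- a); have := ler_norm (- b).
  by rewrite !normrN; have := normr_ge0 a; have := normr_ge0 b; lra.
have l1 : L1 (fun x => d x * \1_`[a, b] x).
  rewrite (_ : (fun _ => _) = fun x => d x * \1_`[-M, M] x * \1_`[a, b] x).
    by apply: L1_indic => //; exact: loc_L1.
  apply/funext => x; rewrite !indicE !mem_setE !in_itv/= -ler_norml.
  by have [_|/Mab/negPf ->] := leP `|x| M; rewrite ?mulr1 ?mulr0.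
have mb n : measurable_fun setT (bump a b n).
  by apply: continuous_measurable_fun; apply: test_continuous; exact: bump_test.
have lb n : L1 (fun x => d x * bump a b n x).
  apply: (L1_le _ _ (L1_abs l1)); first exact: measurable_funM.
  move=> x; rewrite !normrM ler_wpM2l//.
  have /andP[b0 b1] := bump_bound x n ab.
  by rewrite (ger0_norm b0) (le_trans b1)// ler_norm.
have [] := @Rint_dct R (fun n x => d x * bump a b n x)
  (fun x => d x * \1_`]a, b[ x) (fun x => `|d x * \1_`[a, b] x|).
- by move=> n; exact: measurable_funM.
- exact: measurable_funM.
- by apply: aeW => x; apply: cvgM; [exact: cvg_cst|exact: bump_cvg].
- exact: L1_abs l1.
- move=> n x; rewrite !normrM ler_wpM2l//.
  have /andP[b0 b1] := bump_bound x n ab.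
  by rewrite (ger0_norm b0) (le_trans b1)// ler_norm.
move=> li hc; rewrite Rint_restrict.
have h0 : (fun n => \int[mu]_x (d x * bump a b n x)) = cst 0.
  by apply/funext => n; rewrite d0//; exact: bump_test.
rewrite h0 in hc; apply: esym; apply: (cvg_unique _ _ hc) => //.
exact: cvg_cst.
Qed.

(** The primitive of d is constant, because d has zero integral on every
interval; by Lebesgue differentiation d vanishes almost everywhere. The
truncation to [-n, n] makes the locally integrable d integrable. *)
Lemma test_orthogonal_ae0 d : locally_integrable setT d ->
  (forall phi, test_function phi -> \int[mu]_x (d x * phi x) = 0) ->
  {ae mu, forall x, d x = 0}.
Proof.
move=> ld d0.
suff h n : {ae mu, forall x, d x * \1_`[(- n%:R : R), n%:R] x = 0}.
  have := ae_foralln h; apply: ae_imply => x hx.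
  have := hx (Num.truncn `|x|).+1; rewrite indicE mem_setE in_itv/= -ler_norml.
  by rewrite ltW ?mulr1// truncnS_gt.
pose dn := (fun x => d x * \1_`[(- n%:R : R), n%:R] x).
suff : {ae mu, forall x, dn x = 0} by [].
have ldn : L1 dn := loc_L1 n%:R ld.
have prim0 x y : x <= y -> prim dn y - prim dn x = 0.
  move=> xy; rewrite primB// Rint_restrict.
  have [md _ _] := ld.
  pose a := Num.max x (- n%:R); pose b := Num.min y n%:R.
  transitivity (\int[mu]_z (d z * \1_`]a, b[ z)).
    apply: Rint_ae_eq => //.
    - by do 2 apply: measurable_funM => //.
    - exact: measurable_funM.
    have := ae_and (ae_neq x) (ae_and (ae_neq a) (ae_neq b)).
    apply: ae_imply => z [zx [za zb]] _.
    rewrite /dn !indicE !mem_setE !in_itv/= -mulrA -natrM mulnb; congr (_ * (nat_of_bool _)%:R).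
    rewrite [a < z]lt_neqAle eq_sym za [z < b]lt_neqAle zb ge_max le_min/=.
    rewrite [x < z]lt_neqAle eq_sym zx/=.
    by case: (x <= z); case: (z <= y); rewrite ?andbF ?andbT.
  have [ab|ba] := ltP a b.
    by rewrite -Rint_restrict; exact: test_orthogonal_int.
  rewrite (_ : (fun z => _) = cst 0); first by rewrite Rintegral_cst// mul0r.
  apply/funext => z; rewrite indicE mem_setE in_itv/=.
  rewrite (_ : (a < z < b) = false) ?mulr0//; apply/negbTE/negP => /andP[az zb].
  by have := lt_le_trans (lt_trans az zb) ba; rewrite ltxx.
have pc x : prim dn x = prim dn 0.
  have [x0|/ltW x0] := leP x 0; first by have := prim0 _ _ x0; lra.
  by have := prim0 _ _ x0; lra.
have := @FTC1Ny R dn; case.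
- by move=> y; apply: L1_on => //; exact: measurable_itv.
- exact: L1_loc.
move=> N [mN N0 hN]; exists N; split => // x hx; apply: hN => /= -[_ h].
apply: hx => /=; rewrite -h.
rewrite (_ : (fun y => _) = cst (prim dn 0)); last by apply/funext => y; exact: pc.
by rewrite derive1_cst.
Qed.

Lemma weak_derivative_unique u f g : weak_derivative u f ->
  weak_derivative u g -> {ae mu, forall x, f x = g x}.
Proof.
move=> [lu lf hf] [_ lg hg].
suff : {ae mu, forall x, f x - g x = 0}.
  by apply: ae_imply => x /eqP; rewrite subr_eq0 => /eqP.
apply: test_orthogonal_ae0; first exact: locally_integrableB.
move=> phi tphi; have [M _ hM] := test_support tphi.
have phi0 x : M < `|x| -> phi x = 0 by move=> /hM[].
have cphi := test_continuous tphi.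
under eq_Rintegral do rewrite mulrBl.
rewrite RintegralB//; last 2 first.
- exact: loc_L1_mul phi0.
- exact: loc_L1_mul phi0.
by have := hf _ tphi; rewrite (hg _ tphi) => h; lra.
Qed.
End uniqueness.

(** * Fourier integrals and the homogeneous seminorm *)

Section fourier.
Context {R : realType}.
Notation mu := (@lebesgue_measure R).
Implicit Types (f g : R -> R).

Lemma L2normE f : L2norm f = ((\int[mu]_x ((f x) ^+ 2)%:E) `^ 2^-1)%E.
Proof.
rewrite /L2norm unlock; congr (_ `^ _)%E; apply: eq_integral => x _ /=.
by rewrite powR_mulrn// real_normK// num_real.
Qed.

Lemma sq_ge0 f x : (0 <= (f x ^+ 2)%:E)%E.
Proof. by rewrite lee_fin sqr_ge0. Qed.

Lemma L2norm_sq f : (L2norm f `^ 2 = \int[mu]_x ((f x) ^+ 2)%:E)%E.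
Proof.
rewrite L2normE -poweRrM mulVf// poweRe1//.
by apply: integral_ge0 => x _; exact: sq_ge0.
Qed.

Lemma L2norm_ge0 f : (0 <= L2norm f)%E.
Proof. exact: Lnorm_ge0. Qed.

Lemma L2norm_lty f : (L2norm f < +oo)%E <-> (\int[mu]_x ((f x) ^+ 2)%:E < +oo)%E.
Proof.
split=> h; first by rewrite -L2norm_sq poweR_lty.
by rewrite L2normE poweR_lty.
Qed.

Lemma square_integrableP f : measurable_fun setT f ->
  (\int[mu]_x ((f x) ^+ 2)%:E < +oo)%E -> square_integrable f.
Proof.
move=> mf h; rewrite /square_integrable; apply/andP; split; rewrite inE//=.
by apply/L2norm_lty.
Qed.

Lemma ae_L2norm_eq f g : measurable_fun setT f -> measurable_fun setT g ->
  {ae mu, forall x, f x = g x} -> L2norm f = L2norm g.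
Proof.
move=> mf mg fg; rewrite !L2normE; congr (_ `^ _)%E.
apply: ae_eq_integral => //.
- by have /measurable_EFin := measurable_funX 2 mf.
- by have /measurable_EFin := measurable_funX 2 mg.
- by apply: ae_imply fg => x -> _.
Qed.

Lemma L2norm_eq0 f : measurable_fun setT f -> L2norm f = 0%E ->
  {ae mu, forall x, f x = 0}.
Proof.
move=> mf f0; have := @Lnorm_eq0_eq0 _ _ R mu (EFin \o f) 2%:E _ _ f0.
case=> //; first exact: measurable_EFin.
move=> N [mN N0 hN]; exists N; split => // x hx; apply: hN => /= h.
by apply: hx; have := h I; case.
Qed.

Definition cosT f (xi : R) := \int[mu]_x (f x * cos (x * xi)).
Definition sinT f (xi : R) := \int[mu]_x (f x * sin (x * xi)).

Lemma abs_cos_le1 (x : R) : `|cos x| <= 1.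
Proof. by rewrite ler_norml cos_geN1 cos_le1. Qed.

Lemma abs_sin_le1 (x : R) : `|sin x| <= 1.
Proof. by rewrite ler_norml sin_geN1 sin_le1. Qed.

Lemma measurable_cos_mul (xi : R) : measurable_fun setT (fun x : R => cos (x * xi)).
Proof.
have c : continuous (fun x : R => cos (x * xi)).
  move=> x; apply: (@continuous_comp R R R (fun x : R => x * xi) cos).
    by apply: cvgM; [exact: cvg_id|exact: cvg_cst].
  exact: continuous_cos.
exact: continuous_measurable_fun c.
Qed.

Lemma measurable_sin_mul (xi : R) : measurable_fun setT (fun x : R => sin (x * xi)).
Proof.
have c : continuous (fun x : R => sin (x * xi)).
  move=> x; apply: (@continuous_comp R R R (fun x : R => x * xi) sin).
    by apply: cvgM; [exact: cvg_id|exact: cvg_cst].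
  exact: continuous_sin.
exact: continuous_measurable_fun c.
Qed.

Lemma L1_cos f xi : L1 f -> L1 (fun x => f x * cos (x * xi)).
Proof.
move=> lf; apply: (@L1_mul_bounded _ _ _ 1) => //; first exact: measurable_cos_mul.
by move=> x; exact: abs_cos_le1.
Qed.

Lemma L1_sin f xi : L1 f -> L1 (fun x => f x * sin (x * xi)).
Proof.
move=> lf; apply: (@L1_mul_bounded _ _ _ 1) => //; first exact: measurable_sin_mul.
by move=> x; exact: abs_sin_le1.
Qed.

Lemma cosT_continuous f : L1 f -> continuous (cosT f).
Proof.
move=> lf xi; apply: (@continuity_under_integral _ _ _ mu
  (fun xi x => f x * cos (x * xi)) setT measurableT (xi - 1) (xi + 1) _ _ (fun x => `|f x|)).
- by move=> x _; exact: L1_cos.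
- apply: aeW => y _ x _; apply: cvgM; first exact: cvg_cst.
  apply: (@continuous_comp _ _ _ (fun x => y * x) cos); last exact: continuous_cos.
  by apply: cvgM; [exact: cvg_cst|exact: cvg_id].
- exact: L1_abs.
- move=> x _; apply: aeW => y _.
  by rewrite normrM ler_piMr// abs_cos_le1.
- by rewrite inE/= in_itv/=; lra.
Qed.

Lemma sinT_continuous f : L1 f -> continuous (sinT f).
Proof.
move=> lf xi; apply: (@continuity_under_integral _ _ _ mu
  (fun xi x => f x * sin (x * xi)) setT measurableT (xi - 1) (xi + 1) _ _ (fun x => `|f x|)).
- by move=> x _; exact: L1_sin.
- apply: aeW => y _ x _; apply: cvgM; first exact: cvg_cst.
  apply: (@continuous_comp _ _ _ (fun x => y * x) sin); last exact: continuous_sin.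
  by apply: cvgM; [exact: cvg_cst|exact: cvg_id].
- exact: L1_abs.
- move=> x _; apply: aeW => y _.
  by rewrite normrM ler_piMr// abs_sin_le1.
- by rewrite inE/= in_itv/=; lra.
Qed.

Lemma cosT_ae f g xi : L1 f -> L1 g -> {ae mu, forall x, f x = g x} ->
  cosT f xi = cosT g xi.
Proof.
move=> lf lg fg; apply: Rint_ae_eq => //.
- exact: L1_measurable (L1_cos _ lf).
- exact: L1_measurable (L1_cos _ lg).
- by apply: ae_imply fg => x -> _.
Qed.

Lemma sinT_ae f g xi : L1 f -> L1 g -> {ae mu, forall x, f x = g x} ->
  sinT f xi = sinT g xi.
Proof.
move=> lf lg fg; apply: Rint_ae_eq => //.
- exact: L1_measurable (L1_sin _ lf).
- exact: L1_measurable (L1_sin _ lg).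
- by apply: ae_imply fg => x -> _.
Qed.

Definition vanishes_outside (n : nat) f :=
  {ae mu, forall x, n%:R < `|x| -> f x = 0}.

Lemma truncated_fourierE f n m xi : L1 f -> vanishes_outside n f -> (n <= m)%N ->
  truncated_fourier f m xi = Complex (cosT f xi) (- sinT f xi).
Proof.
move=> lf f0 nm; rewrite /truncated_fourier; congr (Complex _ (- _)).
- rewrite Rint_restrict; apply: Rint_ae_eq => //.
  + apply: L1_measurable; apply: L1_indic => //; exact: L1_cos.
  + exact: L1_measurable (L1_cos _ lf).
  apply: ae_imply f0 => x f0 _; rewrite indicE mem_setE in_itv/= -ler_norml.
  have [_|mx] := leP `|x| m%:R; first by rewrite mulr1.
  by rewrite f0 ?mul0r// (le_lt_trans _ mx)// ler_nat.
- rewrite Rint_restrict; apply: Rint_ae_eq => //.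
  + apply: L1_measurable; apply: L1_indic => //; exact: L1_sin.
  + exact: L1_measurable (L1_sin _ lf).
  apply: ae_imply f0 => x f0 _; rewrite indicE mem_setE in_itv/= -ler_norml.
  have [_|mx] := leP `|x| m%:R; first by rewrite mulr1.
  by rewrite f0 ?mul0r// (le_lt_trans _ mx)// ler_nat.
Qed.

Lemma normc_sqrt (z : R[i]) : ComplexField.Normc.normc z =
  Num.sqrt (complex.Re z ^+ 2 + complex.Im z ^+ 2).
Proof. by case: z. Qed.

Lemma measurable_normc (F : R -> R[i]) :
  measurable_fun setT (fun xi => complex.Re (F xi)) ->
  measurable_fun setT (fun xi => complex.Im (F xi)) ->
  measurable_fun setT (fun xi => ComplexField.Normc.normc (F xi)).
Proof.
move=> mRe mIm; under eq_fun do rewrite normc_sqrt.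
have ms : measurable_fun setT (@Num.sqrt R).
  by apply: continuous_measurable_fun => x; exact: sqrt_continuous.
apply: (measurableT_comp ms).
by apply: measurable_funD; exact: measurable_funX.
Qed.

(** The Fourier integrals truncated at m are all equal to the full one once m
>= n, so their L^2 limit is immediate, and two L^2 limits agree almost
everywhere. *)
Lemma fourier_compact f n : L1 f -> vanishes_outside n f ->
  let F xi := Complex (cosT f xi) (- sinT f xi) in
  [/\ measurable_fun setT (fun xi => complex.Re (fourier f xi)),
      measurable_fun setT (fun xi => complex.Im (fourier f xi)) &
   {ae mu, forall xi, fourier f xi = F xi}].
Proof.
move=> lf f0 F.
have mA : measurable_fun setT (cosT f).
  exact: continuous_measurable_fun (cosT_continuous lf).
have mB : measurable_fun setT (fun xi => - sinT f xi).
  apply: measurableT_comp => //.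
  exact: continuous_measurable_fun (sinT_continuous lf).
have L20 : L2norm (fun _ : R => 0) = 0%E by exact: Lnorm0.
have isF : is_fourier f F.
  split => //; apply: cvg_near_cst.
  near=> m; rewrite -[RHS]L20.
  congr L2norm; apply/funext => xi; rewrite (@truncated_fourierE _ n)//.
    by rewrite subrr /Normc.normc /= expr0n/= addr0 sqrtr0.
  by near: m; exact: nbhs_infty_ge.
have [mRe mIm hF] : is_fourier f (fourier f).
  exact: (@xgetPex _ (fun=> 0) [set fhat | is_fourier f fhat] (ex_intro _ F isF)).
split => //.
have : L2norm (fun xi => ComplexField.Normc.normc (F xi - fourier f xi)) = 0%E.
  apply: (cvg_unique _ _ hF) => //.
  apply: cvg_near_cst.
  near=> m; congr L2norm; apply/funext => xi; rewrite (@truncated_fourierE _ n)//.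
  by near: m; exact: nbhs_infty_ge.
move=> /L2norm_eq0; case.
  apply: measurable_normc => /=.
    rewrite (_ : (fun x => _) = fun x => cosT f x - complex.Re (fourier f x)).
      exact: measurable_funB.
    by apply/funext => x; rewrite raddfB.
  rewrite (_ : (fun x => _) = fun x => - sinT f x - complex.Im (fourier f x)).
    exact: measurable_funB.
  by apply/funext => x; rewrite raddfB.
move=> N [mN N0 hN]; exists N; split => // x hx; apply: hN => /= h.
apply: hx; apply/esym/eqP; rewrite -subr_eq0; apply/eqP.
exact: ComplexField.Normc.eq0_normc.
Unshelve. all: by end_near. Qed.

(** The function whose L^2 norm is the homogeneous seminorm of order r of f. *)
Definition weighted_fourier (r : R) f (xi : R) : R :=
  `|xi| `^ r * Num.sqrt (cosT f xi ^+ 2 + sinT f xi ^+ 2).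

Lemma weighted_fourier_sq r f xi :
  weighted_fourier r f xi ^+ 2 = (`|xi| `^ r) ^+ 2 * (cosT f xi ^+ 2 + sinT f xi ^+ 2).
Proof. by rewrite exprMn sqr_sqrtr// addr_ge0// sqr_ge0. Qed.

Lemma measurable_powR_abs r : measurable_fun setT (fun xi : R => `|xi| `^ r).
Proof. by apply: (measurableT_comp (measurable_powR r)); exact: measurable_abs (@measurable_id _ _ setT). Qed.

Lemma measurable_weighted_fourier r f : L1 f ->
  measurable_fun setT (weighted_fourier r f).
Proof.
move=> lf; apply: measurable_funM; first exact: measurable_powR_abs.
have := @measurable_normc (fun xi => Complex (cosT f xi) (sinT f xi)); apply => /=.
  exact: continuous_measurable_fun (cosT_continuous lf).
exact: continuous_measurable_fun (sinT_continuous lf).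
Qed.

Lemma Hdot_seminorm_L2E r f n : L1 f -> vanishes_outside n f ->
  Hdot_seminorm_L2 r f = L2norm (weighted_fourier r f).
Proof.
move=> lf f0; have [mRe mIm hF] := fourier_compact lf f0.
apply: ae_L2norm_eq.
- apply: measurable_funM; first exact: measurable_powR_abs.
  exact: measurable_normc.
- exact: measurable_weighted_fourier.
- apply: ae_imply hF => xi ->; rewrite /weighted_fourier.
  by rewrite normc_sqrt /= sqrrN.
Qed.

(** Uniqueness of the weak derivative and of the Fourier transform frees the
seminorm of its two choice operators. *)
Lemma Hdot_seminormE s u g n : weak_derivative u g -> L1 g ->
  square_integrable g -> vanishes_outside n g ->
  Hdot_seminorm s u = L2norm (weighted_fourier (s - 1) g).
Proof.
move=> ug lg g2 g0.
have [uw w2] : weak_derivative u (wderiv u) /\ square_integrable (wderiv u).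
  exact: (@xgetPex _ (fun=> 0) [set g | weak_derivative u g /\ square_integrable g]
    (ex_intro _ g (conj ug g2))).
have gw := weak_derivative_unique ug uw.
have lw : L1 (wderiv u) by apply: L1_ae lg _ gw; case: uw => _ [].
have w0 : vanishes_outside n (wderiv u).
  by apply: ae_imply (ae_and gw g0) => x [<-].
rewrite /Hdot_seminorm (Hdot_seminorm_L2E _ lw w0); congr L2norm.
by apply/funext => xi; rewrite /weighted_fourier (cosT_ae xi lw lg) ?(sinT_ae xi lw lg)//;
  apply: ae_imply gw => x ->.
Qed.

End fourier.

(** * A lower bound for concentrated functions of one sign *)

Section fejer.
Context {R : realType}.
Notation mu := (@lebesgue_measure R).
Implicit Types (f g : R -> R).

(** The Fejer kernel (up to normalization), as the cosine transform of a ramp. *)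
Definition fejer (c y : R) := \int[mu]_(x in `[0, c]) ((1 - x / c) * cos (x * y)).

Lemma continuous_cosM (y : R) : continuous (fun x : R => cos (x * y)).
Proof.
move=> x; apply: (@continuous_comp R R R (fun x : R => x * y) cos).
  by apply: cvgM; [exact: cvg_id|exact: cvg_cst].
exact: continuous_cos.
Qed.

Lemma fejerE (c y : R) : 0 < c -> y != 0 -> fejer c y = (1 - cos (c * y)) / (c * y ^+ 2).
Proof.
move=> c0 y0; have cN0 : c != 0 by rewrite gt_eqF.
pose F (x : R) := (1 - x / c) * sin (x * y) / y - cos (x * y) / (c * y ^+ 2).
have dF (x : R) : is_derive x 1 F ((1 - x / c) * cos (x * y)).
  have dy : is_derive x 1 (fun x : R => x * y) y.
    by apply: is_derive_eq; rewrite /GRing.scale/=; ring.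
  have ds := @is_derive1_comp R sin (fun x : R => x * y) x _ _ (is_derive_sin (x * y)) dy.
  have dc := @is_derive1_comp R cos (fun x : R => x * y) x _ _ (is_derive_cos (x * y)) dy.
  have dl : is_derive x 1 (fun x : R => 1 - x / c) (- c^-1).
    by apply: is_derive_eq; rewrite /GRing.scale/=; ring.
  rewrite /F; apply: is_derive_eq.
  rewrite /GRing.scale/=; field.
  by rewrite cN0 y0.
rewrite /fejer (Rint_FTC2 (ltW c0) dF).
  by rewrite /F !mul0r sin0 cos0 divff// subrr !mul0r; field; rewrite cN0 y0.
move=> x; apply: cvgM; last exact: continuous_cosM.
apply: cvgB; first exact: cvg_cst.
by apply: cvgM; [exact: cvg_id|exact: cvg_cst].
Qed.

Lemma continuous_ramp (c : R) : continuous (fun x : R => 1 - x / c).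
Proof.
move=> x; apply: cvgB; first exact: cvg_cst.
by apply: cvgM; [exact: cvg_id|exact: cvg_cst].
Qed.

Lemma fejer_integrable (c y : R) : mu.-integrable `[0, c] (EFin \o (fun x => (1 - x / c) * cos (x * y))).
Proof.
apply: L1_itv => x; apply: cvgM; last exact: continuous_cosM.
exact: continuous_ramp.
Qed.

Lemma ramp_ge0 (c x : R) : 0 < c -> 0 <= x <= c -> 0 <= 1 - x / c.
Proof. by move=> c0 /andP[_ xc]; rewrite subr_ge0 ler_pdivrMr ?mul1r. Qed.

(** Positivity of the kernel is what forbids cancellation: tested against a
function of one sign, it only accumulates mass. *)
Lemma fejer_ge0 (c y : R) : 0 < c -> 0 <= fejer c y.
Proof.
move=> c0; have [->|y0] := eqVneq y 0; last first.
  rewrite fejerE// divr_ge0 ?subr_ge0 ?cos_le1// mulr_ge0 ?sqr_ge0//; exact: ltW.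
apply: Rintegral_ge0 => x xc; rewrite mulr0 cos0 mulr1.
by apply: ramp_ge0 => //; move: xc; rewrite /= in_itv.
Qed.

Lemma ramp_int (c : R) : 0 < c -> \int[mu]_(x in `[0, c]) (1 - x / c) = c / 2.
Proof.
move=> c0; have cN0 : c != 0 by rewrite gt_eqF.
pose F (x : R) := x - x ^+ 2 / (2 * c).
have dF (x : R) : is_derive x 1 F (1 - x / c).
  rewrite /F; apply: is_derive_eq; rewrite /GRing.scale/=; field.
  by rewrite cN0.
rewrite (Rint_FTC2 (ltW c0) dF); last exact: continuous_ramp.
by rewrite /F; field.
Qed.

Lemma cos_ge_cos1 (z : R) : `|z| <= 1 -> cos 1 <= cos z.
Proof.
move=> z1; have p2 := @pi_ge2 R; have z0 := normr_ge0 z.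
by rewrite -(cos_norm z) leNgt ltr_cos ?in_itv/= -?leNgt//; lra.
Qed.

Lemma fejer_ge (c y : R) : 0 < c -> `|y| * c <= 1 -> cos 1 * (c / 2) <= fejer c y.
Proof.
move=> c0 yc; rewrite -ramp_int// -RintegralZl//; last exact/L1_itv/continuous_ramp.
apply: le_Rintegral => //.
- apply: L1_itv => x; apply: cvgM; [exact: cvg_cst|exact: continuous_ramp].
- exact: fejer_integrable.
move=> x; rewrite /= in_itv/= => xc; have /andP[x0 xc'] := xc.
rewrite mulrC ler_wpM2l ?ramp_ge0// cos_ge_cos1//.
by rewrite normrM (ger0_norm x0) mulrC (le_trans _ yc)// ler_wpM2l.
Qed.

(** The real part of the Fourier integral centred at x0, where the mass sits:
near x0 the integrand does not oscillate. *)
Definition cosT_at f (x0 xi : R) := \int[mu]_x (f x * cos ((x - x0) * xi)).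

(** The centred integral is a rotation of the pair (cosT, sinT) read in one
direction. *)
Lemma cosT_at_le f (x0 xi : R) : L1 f ->
  `|cosT_at f x0 xi| <= Num.sqrt (cosT f xi ^+ 2 + sinT f xi ^+ 2).
Proof.
move=> lf; have -> : cosT_at f x0 xi = cos (x0 * xi) * cosT f xi + sin (x0 * xi) * sinT f xi.
  rewrite /cosT /sinT -!RintegralZl//; [|exact: L1_sin|exact: L1_cos].
  rewrite -RintegralD//; [|exact: L1Z (L1_cos _ lf)|exact: L1Z (L1_sin _ lf)].
  by apply: eq_Rintegral => x _; rewrite mulrBl cosB; ring.
rewrite -sqrtr_sqr ler_wsqrtr//.
have := cos2Dsin2 (x0 * xi); set c := cos _; set s := sin _ => cs.
have := sqr_ge0 (c * sinT f xi - s * cosT f xi).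
set a := cosT f xi; set b := sinT f xi => h.
have -> : a ^+ 2 + b ^+ 2 = (c ^+ 2 + s ^+ 2) * (a ^+ 2 + b ^+ 2) by rewrite cs mul1r.
by rewrite -subr_ge0; apply: le_trans h _; rewrite le_eqVlt; apply/orP; left; apply/eqP; ring.
Qed.

Lemma cosT_at_L1 f (x0 xi : R) : L1 f -> `|cosT_at f x0 xi| <= \int[mu]_x `|f x|.
Proof.
move=> lf.
have l1 : L1 (fun x => f x * cos ((x - x0) * xi)).
  apply: (@L1_mul_bounded _ _ _ 1) => //; last by move=> x; exact: abs_cos_le1.
  have c : continuous (fun x : R => cos ((x - x0) * xi)).
    move=> x; apply: (@continuous_comp R R R (fun x : R => (x - x0) * xi) cos); last exact: continuous_cos.
    by apply: cvgM; [apply: cvgB; [exact: cvg_id|exact: cvg_cst]|exact: cvg_cst].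
  exact: continuous_measurable_fun c.
apply: (le_trans (Rint_le_abs l1)); apply: le_Rintegral => //.
- exact: L1_abs l1.
- exact: L1_abs.
- by move=> x _; rewrite normrM ler_piMr// abs_cos_le1.
Qed.

(** Fubini for the product of the ramp in xi with f; it also gives the
integrability of both sides. *)
Lemma fejer_parseval f (x0 c : R) : L1 f -> 0 < c ->
  L1 (fun xi => (1 - xi / c) * \1_`[0, c] xi * cosT_at f x0 xi) /\
  \int[mu]_xi ((1 - xi / c) * \1_`[0, c] xi * cosT_at f x0 xi) =
  \int[mu]_x (f x * fejer c (x - x0)) /\ L1 (fun x => f x * fejer c (x - x0)).
Proof.
move=> lf c0.
pose F (z : R * R) := ((1 - z.1 / c) * \1_`[(0:R), c] z.1) * (f z.2 * cos ((z.2 - x0) * z.1)).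
have l1 : L1 (fun x : R => \1_`[0, c] x).
  by have := @integrable_indic_itv R 0 c true false.
have mF : measurable_fun setT F.
  apply: measurable_funM.
    apply: measurable_funM; last exact: measurableT_comp.
    have h : measurable_fun setT (fun x : R => 1 - x / c).
      by apply: continuous_measurable_fun; exact: continuous_ramp.
    exact: (measurableT_comp h).
  apply: measurable_funM; first by apply: measurableT_comp => //; exact: L1_measurable.
  have mc : measurable_fun setT (@cos R) by apply: continuous_measurable_fun; exact: continuous_cos.
  apply: (measurableT_comp mc); apply: measurable_funM => //.
  exact: measurable_funB.
have bF x y : `|F (x, y)| <= \1_`[0, c] x * `|f y|.
  rewrite /F/= !normrM; apply: ler_pM => //.
    rewrite indicE mem_setE in_itv/=.
    have [xc|_] := boolP (0 <= x <= c); last by rewrite normr0 mulr0.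
    have /andP[xc0 _] := xc.
    rewrite normr1 mulr1 ger0_norm ?ramp_ge0//.
    by rewrite gerDl oppr_le0 divr_ge0// ltW.
  by rewrite ler_piMr// abs_cos_le1.
have FE xi : \int[mu]_y F (xi, y) = (1 - xi / c) * \1_`[0, c] xi * cosT_at f x0 xi.
  rewrite /F/= RintegralZl//.
  apply: (@L1_mul_bounded _ _ _ 1) => //; last by move=> x; exact: abs_cos_le1.
  have cc : continuous (fun x : R => cos ((x - x0) * xi)).
    move=> x; apply: (@continuous_comp R R R (fun x : R => (x - x0) * xi) cos); last exact: continuous_cos.
    by apply: cvgM; [apply: cvgB; [exact: cvg_id|exact: cvg_cst]|exact: cvg_cst].
  exact: continuous_measurable_fun cc.
have FE2 y : \int[mu]_x F (x, y) = f y * fejer c (y - x0).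
  rewrite /fejer [in RHS]Rint_restrict -RintegralZl//; last first.
    by apply: L1_restrict => //; exact: fejer_integrable.
  by apply: eq_Rintegral => x _; rewrite /F/= [(y - x0) * x]mulrC; ring.
have h1 := L1_fubini1 mF l1 (L1_abs lf) bF.
have h2 := Rint_fubini mF l1 (L1_abs lf) bF.
have mF' : measurable_fun setT (fun z : R * R => F (z.2, z.1)).
  by apply: (measurableT_comp mF); exact: measurable_swap.
have bF' x y : `|F ((x, y).2, (x, y).1)| <= `|f x| * \1_`[0, c] y by rewrite mulrC; exact: bF.
have h3 := L1_fubini1 mF' (L1_abs lf) l1 bF'.
split; first by apply: eq_integrable h1; [exact: measurableT|move=> x _ /=; rewrite FE].
split; last by apply: eq_integrable h3; [exact: measurableT|move=> x _ /=; rewrite FE2].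
under eq_Rintegral do rewrite -FE.
by rewrite h2; apply: eq_Rintegral => y _; exact: FE2.
Qed.

(** On the interval of length 1 / c around x0 the kernel is at least cos 1 * c
/ 2 by [fejer_ge], so the contribution H cos 1 / 2 does not depend on c; the
rest of the line contributes with the same sign. *)
Lemma fejer_mass f (x0 c H : R) : L1 f -> (forall x, f x <= 0) ->
  0 < c -> 0 <= H ->
  (forall x, `|x - x0| < (2 * c)^-1 -> f x <= - H) ->
  L1 (fun x => f x * fejer c (x - x0)) ->
  \int[mu]_x (f x * fejer c (x - x0)) <= - (H * cos 1 / 2).
Proof.
move=> lf f0 c0 H0 fH l2.
have c20 : 0 < (2 * c)^-1 by rewrite invr_gt0 mulr_gt0.
have mint : \int[mu]_x (- (H * (cos 1 * (c / 2))) *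
    \1_`](x0 - (2 * c)^-1), (x0 + (2 * c)^-1)[ x) = - (H * cos 1 / 2).
  rewrite RintegralZl; [|exact: measurableT|exact: L1_indic_itv].
  rewrite Rint_indic_itv; last by move: c20; clear; lra.
  by field; rewrite gt_eqF.
rewrite -mint; apply: le_Rintegral; [exact: measurableT|exact: l2| |].
  by apply: L1Z; exact: L1_indic_itv.
clear mint l2; move=> x _; rewrite indicE mem_setE in_itv/=.
have [xJ|_] := boolP (_ < _ < _); last first.
  by rewrite mulr0 mulr_le0_ge0//; exact: fejer_ge0.
have xx0 : `|x - x0| < (2 * c)^-1 by move: xJ; clear; rewrite ltr_distlC; lra.
have h1 := fH _ xx0.
have h2 : cos 1 * (c / 2) <= fejer c (x - x0).
  apply: fejer_ge => //; rewrite -ler_pdivlMr// mul1r.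
  apply: (le_trans (ltW xx0)); rewrite lef_pV2 ?posrE ?mulr_gt0//.
  by move: c0; clear; lra.
have h3 : 0 <= fejer c (x - x0) by exact: fejer_ge0.
move: h1 h2 h3 H0; clear; move: (cos 1 * (c / 2)) (fejer c (x - x0)) (f x) => m F y.
by rewrite mulr1; nra.
Qed.

Lemma fejer_weight_bound (c xi : R) : 0 < c ->
  0 <= (1 - xi / c) * \1_`[0, c] xi <= \1_`[0, c] xi.
Proof.
move=> c0; rewrite indicE mem_setE in_itv/=.
have [xc|_] := boolP (0 <= xi <= c); last by rewrite mulr0 lexx.
have /andP[xi0 _] := xc; rewrite !mulr1 ramp_ge0//=.
by rewrite gerDl oppr_le0 divr_ge0// ltW.
Qed.

(** Frequencies below a are bounded by the L^1 norm. Above a, the weight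
|xi|^r is at least a^r, which produces the small factor a^(- r); the parameter
d of Young's inequality will balance the two terms that come after it. *)
Lemma cosT_at_split f (x0 a d r xi : R) : L1 f -> 0 < a -> 0 < d -> 0 < r ->
  0 <= xi ->
  `|cosT_at f x0 xi| <= (\int[mu]_x `|f x|) * \1_`[0, a] xi +
    a `^ (- r) / 2 * (d * weighted_fourier r f xi ^+ 2 + d^-1).
Proof.
move=> lf a0 d0 r0 xi0.
have K0 : 0 < a `^ (- r) by exact: powR_gt0.
have Q0 : 0 <= a `^ (- r) / 2 * (d * weighted_fourier r f xi ^+ 2 + d^-1).
  apply: mulr_ge0; first by rewrite divr_ge0// ltW.
  by rewrite addr_ge0 ?invr_ge0 ?mulr_ge0 ?sqr_ge0// ltW.
have [xa|ax] := leP xi a.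
  rewrite indicE mem_setE in_itv/= xi0 xa mulr1.
  by apply: (le_trans (cosT_at_L1 _ _ lf)); rewrite lerDl.
rewrite indicE mem_setE in_itv/= [xi <= a]leNgt ax andbF mulr0 add0r.
apply: (le_trans (cosT_at_le _ _ lf)); rewrite /weighted_fourier (ger0_norm xi0).
have : 0 <= Num.sqrt (cosT f xi ^+ 2 + sinT f xi ^+ 2) by exact: sqrtr_ge0.
move: (Num.sqrt _) => S S0.
have ar : a `^ r <= xi `^ r.
  by apply: ge0_ler_powR; rewrite ?nnegrE//; exact: ltW.
have Kar : 1 <= a `^ (- r) * xi `^ r.
  by rewrite powRN mulrC ler_pdivlMr ?mul1r// powR_gt0.
move: (a `^ (- r)) (xi `^ r) K0 Kar => K y K0 Ky {Q0 ar}.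
apply: (@le_trans _ _ (K * (y * S))); first by rewrite mulrA ler_peMl.
(* Young's inequality 2 W <= d W^2 + 1 / d for W = y S *)
rewrite -mulrA ler_wpM2l//; first exact: ltW.
rewrite -subr_ge0 (_ : _ - _ = (d * (y * S) - 1) ^+ 2 / (2 * d)).
  by rewrite divr_ge0 ?sqr_ge0// mulr_ge0// ltW.
by field; rewrite gt_eqF.
Qed.

Lemma fejer_integrand_bound f (x0 a c d r xi : R) : L1 f ->
  0 < a -> 0 < c -> 0 < d -> 0 < r ->
  `|(1 - xi / c) * \1_`[0, c] xi * cosT_at f x0 xi| <=
  (\int[mu]_x `|f x|) * \1_`[0, a] xi +
    a `^ (- r) / 2 * (d * weighted_fourier r f xi ^+ 2 + d^-1 * \1_`[0, c] xi).
Proof.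
move=> lf a0 c0 d0 r0.
have /andP[w0 w1] := fejer_weight_bound xi c0.
rewrite normrM (ger0_norm w0).
have := @cosT_at_split f x0 a d r xi lf a0 d0 r0.
have C0 : 0 <= \int[mu]_x `|f x| by apply: Rintegral_ge0.
have A0 : 0 <= \1_`[0, a] xi :> R by rewrite indicE ler0n.
have K0 : 0 <= a `^ (- r) / 2 by rewrite divr_ge0// powR_ge0.
have W0 := sqr_ge0 (weighted_fourier r f xi).
have F0 := normr_ge0 (cosT_at f x0 xi).
move: (\int[mu]_x _) (\1_`[0, a] xi) (a `^ _ / 2) (_ ^+ 2) `|_| C0 A0 K0 W0 F0 w0 w1.
move=> C A K W F C0 A0 K0 W0 F0; rewrite indicE mem_setE in_itv/=.
have [/andP[xi0 _]|_] := boolP (0 <= xi <= c) => /=.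
  rewrite mulr1 => w0 w1 /(_ xi0) h; rewrite mulr1; apply: le_trans h.
  by rewrite ler_piMl.
rewrite !mulr0 mul0r addr0 => _ _ _.
by apply: addr_ge0; [exact: mulr_ge0|apply: mulr_ge0 => //; apply: mulr_ge0 => //; exact: ltW].
Qed.

(** With c tending to infinity, H / sqrt c bounded below and the L^1 norm
bounded, this fails for every N2: after division by sqrt c the first term on
the right tends to 0, and the second one is as small as desired when a is
large. It comes from integrating [fejer_integrand_bound] with d = sqrt c. *)
Lemma concentration_bound f (x0 c a r H N2 : R) : L1 f -> (forall x, f x <= 0) ->
  0 < c -> 0 < a -> 0 < r -> 0 <= H ->
  (forall x, `|x - x0| < (2 * c)^-1 -> f x <= - H) ->
  (\int[mu]_xi ((weighted_fourier r f xi) ^+ 2)%:E <= N2%:E)%E ->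
  H * cos 1 / 2 <= a * \int[mu]_x `|f x| + a `^ (- r) * Num.sqrt c * (N2 + 1) / 2.
Proof.
move=> lf f0 c0 a0 r0 H0 fH hN2.
set K := a `^ (- r); set d := Num.sqrt c.
have K0 : 0 <= K / 2 by rewrite divr_ge0// powR_ge0.
have d0 : 0 < d by rewrite sqrtr_gt0.
have [l1 [hF l2]] := fejer_parseval x0 lf c0.
have low := fejer_mass lf f0 c0 H0 fH l2.
set C := \int[mu]_x `|f x|.
have C0 : 0 <= C by apply: Rintegral_ge0.
pose W := weighted_fourier r f.
have lW : L1 (fun xi => W xi ^+ 2).
  apply: L1_ge0 => [|x|]; [|exact: sqr_ge0|by apply: (le_lt_trans hN2); rewrite ltry].
  exact: (measurable_funX 2 (measurable_weighted_fourier r lf)).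
have iW : \int[mu]_xi (W xi ^+ 2) <= N2 by rewrite -lee_fin Rint_EFin.
have up xi := fejer_integrand_bound x0 xi lf a0 c0 d0 r0.
rewrite -hF in low; move: (cos 1) low {fH H0 f0 hN2 hF l2} => k low.
have lA := L1Z C (L1_indic_itv 0 a true false).
have lB1 := L1Z d lW.
have lB2 := L1Z d^-1 (L1_indic_itv 0 c true false).
have lB3 := L1D lB1 lB2.
have lB4 := L1Z (K / 2) lB3.
have iB : \int[mu]_xi (C * \1_`[0, a] xi + K / 2 * (d * W xi ^+ 2 + d^-1 * \1_`[0, c] xi))
    <= a * C + K * d * (N2 + 1) / 2.
  rewrite (RintegralD measurableT lA lB4) (RintegralZl _ measurableT lB3).
  rewrite (RintegralD measurableT lB1 lB2) (RintegralZl _ measurableT lW).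
  rewrite !(RintegralZl _ measurableT (L1_indic_itv _ _ _ _)).
  rewrite !Rint_indic_itv; [|exact: ltW|exact: ltW].
  have -> : d^-1 * (c - 0) = d.
    by rewrite subr0 -[X in _ * X](sqr_sqrtr (ltW c0)) expr2 mulKf// gt_eqF.
  have -> : K * d * (N2 + 1) / 2 = K / 2 * (d * N2 + d) by field.
  by rewrite subr0 mulrC lerD2l ler_wpM2l// lerD2r ler_wpM2l// ltW.
have l3 := L1_abs l1.
have := le_trans (Rint_le_abs l1) (le_trans (le_Rintegral measurableT l3 (L1D lA lB4) (fun xi _ => up xi)) iB).
rewrite ler_norml => /andP[].
by move: low; lra.
Qed.

End fejer.

(** * Change of variables along a degenerate flow *)

Section change_of_variables.
Context {R : realType}.
Notation mu := (@lebesgue_measure R).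
Variables (w phi : R -> R).
Hypothesis mw : measurable_fun setT w.
Hypothesis w0 : forall x, 0 <= w x.
Hypothesis mphi : measurable_fun setT phi.
Hypothesis wphi : forall a b : R, a < b ->
  (\int[mu]_(x in phi @^-1` `]a, b]) (w x)%:E = (b - a)%:E)%E.

Let nu (A : set (measurableTypeR R)) : \bar R :=
  (\int[mu]_(x in phi @^-1` A) (w x)%:E)%E.

Let mphi_inv (A : set R) : measurable A -> measurable (phi @^-1` A).
Proof. by move=> mA; rewrite -[X in measurable X]setTI; exact: mphi. Qed.

Let nu0 : nu set0 = 0%E.
Proof. by rewrite /nu preimage_set0 integral_set0. Qed.

Let nu_ge0 A : (0 <= nu A)%E.
Proof. by apply: integral_ge0 => x _; rewrite lee_fin. Qed.

Let nu_sigma : semi_sigma_additive nu.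
Proof.
move=> F mF tF mUF; rewrite /nu preimage_bigcup ge0_integral_bigcup.
- by apply: is_cvg_ereal_nneg_natsum_cond => // n _ _; exact: nu_ge0.
- by move=> k; have h : measurable (F k : set R) := mF k; exact: (mphi_inv h).
- exact: measurable_funTS (measurable_EFin mw).
- by move=> x _; rewrite lee_fin.
- apply/trivIsetP => i j _ _ ij; rewrite -preimage_setI.
  by move/trivIsetP : tF => /(_ i j I I ij) ->; rewrite preimage_set0.
Qed.

Let nu_measure := HB.pack_for {measure set (measurableTypeR R) -> \bar R} nu
  (isMeasure.Build _ _ _ nu nu0 nu_ge0 nu_sigma).

(** The image under phi of the measure with density w is a measure that agrees
with Lebesgue measure on half-open intervals. *)
Lemma lebesgue_pushforward A : measurable A ->
  mu A = (\int[mu]_(x in phi @^-1` A) (w x)%:E)%E.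
Proof.
move=> mA; have := @lebesgue_measure_unique R nu_measure _ A mA; apply.
move=> _ [[a b] _ <-]; rewrite /= /nu.
have [ab|ba] := ltP a b.
  by rewrite wphi// lebesgue_measure_itv/= lte_fin ab.
by rewrite set_itv_ge ?bnd_simp -?leNgt// preimage_set0 integral_set0 measure0.
Qed.

Import HBNNSimple.

Lemma ge0_change_of_variables (F : R -> \bar R) : measurable_fun setT F ->
  (forall x, 0 <= F x)%E ->
  (\int[mu]_x F x = \int[mu]_x (F (phi x) * (w x)%:E))%E.
Proof.
move=> mF F0; pose f_ := nnsfun_approx measurableT mF.
have cf x : EFin (f_ n x) @[n --> \oo] --> F x.
  by apply: cvg_nnsfun_approx => //.
transitivity (limn (fun n => \int[mu]_x (f_ n x)%:E)%E).
  rewrite -monotone_convergence//.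
  - by apply: eq_integral => x _; apply/esym/cvg_lim => //; exact: cf.
  - by move=> n; apply: measurable_EFin.
  - by move=> n x _; rewrite lee_fin.
  - by move=> x _ m n mn; rewrite lee_fin; have /lefP/(_ x) := nd_nnsfun_approx measurableT mF mn.
transitivity (limn (fun n => \int[mu]_x ((f_ n (phi x))%:E * (w x)%:E))%E); last first.
  rewrite -monotone_convergence//.
  - apply: eq_integral => x _; apply/cvg_lim => //.
    by apply: cvgeZr => //; exact: cf.
  - move=> n; apply: (@measurable_EFin R (fun x => f_ n (phi x) * w x)).
    by apply: measurable_funM => //; exact: measurableT_comp.
  - by move=> n x _; rewrite -EFinM lee_fin mulr_ge0.
  - by move=> x _ m n mn; rewrite -!EFinM lee_fin ler_wpM2r//; have /lefP/(_ (phi x)) := nd_nnsfun_approx measurableT mF mn.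
congr (limn _); apply/funext => n; set f := f_ n.
transitivity (\sum_(k \in range f) k%:E * mu (f @^-1` [set k]))%E.
  transitivity (\int[mu]_x (\sum_(k \in range f) (k * \1_(f @^-1` [set k]) x)%:E))%E.
    by apply: eq_integral => x _; rewrite fsumEFin// -fimfunE.
  rewrite ge0_integral_fsum//.
  - apply: eq_fsbigr => k; rewrite inE => -[y _ fyk].
    have mk : measurable (f @^-1` [set k]) by [].
    under eq_integral do rewrite EFinM.
    have k0 : 0 <= k by rewrite -fyk.
    have := @integral_indic _ _ R mu setT measurableT _ mk.
    rewrite setIT => <-; rewrite ge0_integralZl_EFin//.
    exact: (@measurable_EFin R (\1_(f @^-1` [set k]))).
  - move=> k; apply: (@measurable_EFin R (fun x => k * \1_(f @^-1` [set k]) x)).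
    exact: measurable_funM.
  - by move=> k x _; rewrite EFinM nnfun_muleindic_ge0.
transitivity (\int[mu]_x (\sum_(k \in range f) ((k * \1_(f @^-1` [set k]) (phi x))%:E * (w x)%:E)))%E; last first.
  apply: eq_integral => x _; rewrite [in RHS]fimfunE -fsumEFin//.
  rewrite ge0_mule_fsuml// => k.
  by rewrite EFinM nnfun_muleindic_ge0.
have mind k : measurable_fun setT (fun x => \1_(f @^-1` [set k]) (phi x) : R).
  have m1 : measurable_fun setT (\1_(f @^-1` [set k]) : R -> R) by [].
  exact: (measurableT_comp m1).
rewrite ge0_integral_fsum//.
- apply: eq_fsbigr => k; rewrite inE => -[y _ fyk].
  have k0 : 0 <= k by rewrite -fyk.
  have mk : measurable (f @^-1` [set k]) by [].
  rewrite (lebesgue_pushforward mk) -ge0_integralZl//; first last.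
  + by move=> x _; rewrite lee_fin.
  + exact: measurable_funTS (measurable_EFin mw).
  + exact: mphi_inv.
  rewrite [LHS]integral_mkcond; apply: eq_integral => x _; rewrite patchE.
  have -> : (x \in phi @^-1` (f @^-1` [set k])) = (phi x \in f @^-1` [set k]).
    by apply/idP/idP; rewrite !inE.
  by rewrite indicE; case: ifPn => _; rewrite ?mulr1// mulr0 mul0e.
- move=> k; apply: (@measurable_EFin R (fun x => k * \1_(f @^-1` [set k]) (phi x) * w x)).
  by apply: measurable_funM => //; exact: measurable_funM.
- move=> k x _; apply: mule_ge0; last by rewrite lee_fin.
  by rewrite EFinM nnfun_muleindic_ge0.
Qed.

End change_of_variables.

(** * The dissipative solution of a nonincreasing datum *)

Section dissipative.
Context {R : realType}.
Notation mu := (@lebesgue_measure R).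
Variable V : R -> R.
Hypothesis V0 : forall x, 0 <= V x.
Hypothesis mV : measurable_fun setT V.
Hypothesis lV : L1 V.
Hypothesis lV2 : L1 (fun x => V x ^+ 2).
Hypothesis V_supp : forall x, 2 < `|x| -> V x = 0.
Hypothesis V_cont : forall x, x != 0 -> {for x, continuous V}.

(** Since V >= 0, every nonzero slope steepens and breaks in finite time. *)
Definition datum (x : R) := - prim V x.

(** The origin is excluded because V may be singular there. *)
Lemma datum_derive x : x != 0 -> derivable datum x 1 /\ derive1 datum x = - V x.
Proof.
move=> x0; have xx1 : x < x + 1 by rewrite ltrDl.
have lI : mu.-integrable [set` Interval -oo%O (BRight (x + 1))] (EFin \o V).
  by apply: L1_on => //; exact: measurable_itv.
have [d e] := @continuous_FTC1 R V -oo%O x (x + 1) xx1 lI (ltNyr _) (V_cont x0).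
split; first by apply: derivableN.
by rewrite derive1E deriveN// -derive1E e.
Qed.

(** The indicator of the surviving set, expressed through V: the slope - V x
is still above - 2 / t exactly when t V x < 2. *)
Definition alive (t x : R) : R := \1_`]-oo, 2[ (t * V x).

Lemma alive_ge0 t x : 0 <= alive t x. Proof. by rewrite /alive indicE ler0n. Qed.
Lemma alive_le1 t x : alive t x <= 1. Proof. by rewrite /alive indicE lern1 leq_b1. Qed.

Lemma measurable_alive t : measurable_fun setT (alive t).
Proof.
by apply: measurableT_comp => //; exact: measurable_funM.
Qed.

Lemma L1_alive f tau : L1 f -> L1 (fun y => f y * alive tau y).
Proof.
move=> lf; apply: (@L1_mul_bounded _ _ _ 1) => //; first exact: measurable_alive.
by move=> x; rewrite ger0_norm ?alive_ge0// alive_le1.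
Qed.

Lemma left_energyE tau xi : 0 <= tau ->
  left_energy datum tau xi = \int[mu]_y (V y ^+ 2 * (\1_`]-oo, xi] y * alive tau y)).
Proof.
move=> tau0; rewrite /left_energy Rint_restrict.
have m1 : measurable_fun setT (fun y => V y ^+ 2 * (\1_`]-oo, xi[ y * alive tau y)).
  apply: measurable_funM; first exact: measurable_funX.
  by apply: measurable_funM => //; exact: measurable_alive.
have m2 : measurable_fun setT (fun y => V y ^+ 2 * (\1_`]-oo, xi] y * alive tau y)).
  apply: measurable_funM; first exact: measurable_funX.
  by apply: measurable_funM => //; exact: measurable_alive.
rewrite (Rint_except (c := 0) m1); last first.
  move=> y y0; have [d e] := datum_derive y0.
  rewrite e sqrrN; congr (_ * _); rewrite indicI mulrC; congr (_ * _).
  rewrite /alive /surviving_set !indicE; congr (nat_of_bool _)%:R.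
  rewrite [in RHS]mem_setE [in RHS]in_itv/=.
  have [->|t0] := eqVneq tau 0; first by rewrite mul0r ltr0n in_setT.
  have tau_gt0 : 0 < tau by rewrite lt_def t0.
  have E : (- 2 / tau < - V y) = (tau * V y < 2).
    by rewrite mulNr ltrN2 ltr_pdivlMr// mulrC.
  by apply/idP/idP => [|h]; rewrite inE /= e E; [case|split].
apply: (Rint_except (c := xi)) => // y yxi; congr (_ * (_ * _)).
by rewrite !indicE !mem_setE !in_itv/= lt_neqAle yxi.
Qed.

(** Exchanging the time and label integrals turns the characteristic and the
value of the solution into primitives of functions of V alone. *)
Lemma energy_fubini (k : R -> R) (M t xi : R) : measurable_fun setT k ->
  (forall tau, 0 <= tau <= t -> `|k tau| <= M) ->
  \int[mu]_(tau in `[0, t]) (k tau * left_energy datum tau xi) =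
  prim (fun y => V y ^+ 2 * \int[mu]_(tau in `[0, t]) (k tau * alive tau y)) xi.
Proof.
move=> mk kM.
pose F (z : R * R) := (k z.1 * \1_`[(0:R), t] z.1) * (V z.2 ^+ 2 * (\1_`]-oo, xi] z.2 * alive z.1 z.2)).
have mF : measurable_fun setT F.
  apply: measurable_funM.
    by apply: measurable_funM; apply: measurableT_comp.
  apply: measurable_funM.
    by apply: measurable_funX; apply: measurableT_comp.
  apply: measurable_funM; first by apply: measurableT_comp.
  apply: measurableT_comp => //; apply: measurable_funM => //.
  exact: measurableT_comp.
have lI : L1 (fun x => M * \1_`[0, t] x) by apply: L1Z; exact: L1_indic_itv.
have bF x y : `|F (x, y)| <= M * \1_`[0, t] x * V y ^+ 2.
  rewrite /F/= !normrM; apply: ler_pM => //.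
    rewrite indicE mem_setE in_itv/=.
    by have [/kM|_] := boolP (0 <= x <= t); rewrite ?normr1 ?mulr1// normr0 !mulr0.
  rewrite (ger0_norm (V0 y)) -expr2 ler_piMr ?sqr_ge0// /alive.
  by rewrite !indicE; case: (_ \in _); case: (_ \in _); rewrite ?normr1 ?normr0 ?mulr1 ?mulr0.
transitivity (\int[mu]_tau (\int[mu]_y F (tau, y))).
  rewrite [LHS]Rint_restrict; apply: eq_Rintegral => tau _.
  have it : \1_`[0, t] tau = (0 <= tau <= t)%R%:R :> R.
    by rewrite indicE mem_setE in_itv.
  rewrite it; have [/andP[tau0 taut]|taut] := boolP (0 <= tau <= t).
    rewrite mulr1 left_energyE// -RintegralZl//; last first.
      under eq_fun do rewrite mulrA.
      by apply: L1_alive; exact: L1_indic.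
    by apply: eq_Rintegral => y _; rewrite /F/= it tau0 taut mulr1.
  rewrite mulr0 (_ : (fun y => _) = cst 0) ?Rintegral_cst ?mul0r//.
  by apply/funext => y; rewrite /F/= it (negPf taut) mulr0 mul0r.
rewrite (Rint_fubini mF lI lV2 bF) primE; apply: eq_Rintegral => y _.
rewrite -mulrA [(\int[mu]_(_ in _) _) * _]mulrC mulrA [in RHS]Rint_restrict -RintegralZl//; last first.
  apply: (L1_le _ _ lI).
    apply: measurable_funM => //; apply: measurable_funM => //.
    by apply: measurableT_comp => //; exact: measurable_funM.
  move=> tau; rewrite !normrM indicE mem_setE in_itv/=.
  have [/kM kt|_] := boolP (0 <= tau <= t); last by rewrite normr0 !mulr0.
  rewrite normr1 !mulr1 (le_trans _ kt)// ler_piMr//.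
  by rewrite ger0_norm ?alive_ge0// alive_le1.
by apply: eq_Rintegral => tau _; rewrite /F/=; ring.
Qed.

(** Square root of the Jacobian of the flow. It reaches 0 at the breaking time
2 / V x of the label x and stays there, which is the dissipative choice. *)
Definition compress (t x : R) : R := Num.max 0 (1 - t * V x / 2).

Lemma compress_ge0 t x : 0 <= compress t x.
Proof. by rewrite /compress le_max lexx. Qed.

Lemma compress_le1 t x : 0 <= t -> compress t x <= 1.
Proof.
by move=> t0; rewrite /compress ge_max ler01/= lerBlDr lerDl divr_ge0// mulr_ge0.
Qed.

Lemma measurable_compress t : measurable_fun setT (compress t).
Proof.
apply: measurable_maxr => //; apply: measurable_funB => //.
by apply: measurable_funM => //; exact: measurable_funM.
Qed.

(** A label survives until time t or its breaking time, whichever comes first. *)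
Lemma alive_window t x (f : R -> R) : 0 <= t ->
  let b := if t * V x < 2 then t else 2 / V x in
  measurable_fun setT f ->
  \int[mu]_(tau in `[0, t]) (f tau * alive tau x) = \int[mu]_(tau in `[0, b]) f tau.
Proof.
move=> t0 b mf.
have mal : measurable_fun setT (fun tau => alive tau x).
  by apply: measurableT_comp => //; exact: measurable_funM.
rewrite [LHS]Rint_restrict [RHS]Rint_restrict; apply: Rint_ae_eq => //.
- by apply: measurable_funM => //; exact: measurable_funM.
- exact: measurable_funM.
apply: ae_imply (ae_neq b) => tau taub _; rewrite -mulrA; congr (_ * _).
rewrite /alive !indicE !mem_setE !in_itv/= -natrM mulnb; congr (nat_of_bool _)%:R.
have vx := V0 x; move: taub; rewrite /b; case: ltP => [tv|tv] taub.
  case: (leP 0 tau) => //=; first last; first by rewrite andbF.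
  move=> tau0; case: (leP tau t) => [taut|]; rewrite ?andbF ?andbT//.
  by apply: le_lt_trans tv; rewrite ler_wpM2r.
have v0 : 0 < V x.
  by rewrite lt_def vx andbT; apply/eqP => v0; move: tv; rewrite v0 mulr0; lra.
rewrite -ltr_pdivlMr// lt_neqAle taub/=.
have -> : (0 <= tau <= 2 / V x) = (0 <= tau) && (tau <= 2 / V x) by [].
case: (leP tau (2 / V x)) => /= h; rewrite ?andbF ?andbT//.
by rewrite (_ : (tau <= t) = true) ?andbT//; apply: (le_trans h); rewrite ler_pdivrMr.
Qed.

Lemma window_int (b : R) : 0 <= b -> \int[mu]_(tau in `[0, b]) (1 : R) = b.
Proof.
move=> b0; rewrite Rint_restrict -[RHS]subr0 -(@Rint_indic_itv R 0 b true false b0).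
by apply: eq_Rintegral => x _; rewrite mul1r.
Qed.

Lemma window_int_ramp (t b : R) : 0 <= b ->
  \int[mu]_(tau in `[0, b]) (t - tau) = t * b - b ^+ 2 / 2.
Proof.
move=> b0; pose F (x : R) := t * x - x ^+ 2 / 2.
have dF (x : R) : is_derive x 1 F (t - x).
  by rewrite /F; apply: is_derive_eq; rewrite /GRing.scale/=; field.
rewrite (Rint_FTC2 b0 dF); first by rewrite /F; ring.
by move=> x; apply: cvgB; [exact: cvg_cst|exact: cvg_id].
Qed.

(** The defect of the Jacobian from 1. Before breaking, both sides are t V x -
(t V x)^2 / 4; after it the time integral stops at 2 / V x and both sides are
1. *)
Lemma compress_sq t x : 0 <= t ->
  1 - compress t x ^+ 2 = t * V x - 2^-1 * (V x ^+ 2 * \int[mu]_(tau in `[0, t]) ((t - tau) * alive tau x)).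
Proof.
move=> t0; rewrite alive_window//; last exact: measurable_funB.
have vx := V0 x; case: ltP => [tv|tv].
  rewrite window_int_ramp// /compress (max_idPr _); last by lra.
  by field.
have v0 : 0 < V x.
  by rewrite lt_def vx andbT; apply/eqP => v0; move: tv; rewrite v0 mulr0; lra.
rewrite window_int_ramp ?divr_ge0// /compress (max_idPl _); last by lra.
by field; rewrite gt_eqF.
Qed.

(** The same computation for the value carried by the label, whose density V
(1 - t V / 2) is frozen at 0 after breaking. *)
Lemma compress_mul t x : 0 <= t ->
  V x * compress t x = V x - 2^-1 * (V x ^+ 2 * \int[mu]_(tau in `[0, t]) (1 * alive tau x)).
Proof.
move=> t0; rewrite alive_window//.
have vx := V0 x; case: ltP => [tv|tv].
  rewrite window_int// /compress (max_idPr _); last by lra.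
  by field.
have v0 : 0 < V x.
  by rewrite lt_def vx andbT; apply/eqP => v0; move: tv; rewrite v0 mulr0; lra.
rewrite window_int ?divr_ge0// /compress (max_idPl _); last by lra.
by field; rewrite gt_eqF.
Qed.

Lemma L1_compress_deficit t : 0 <= t -> L1 (fun x => 1 - compress t x ^+ 2).
Proof.
move=> t0; apply: (@L1_le _ _ (fun x => \1_`[-2, 2] x)); last exact: L1_indic_itv.
  by apply: measurable_funB => //; apply: measurable_funX; exact: measurable_compress.
move=> x; have h0 := compress_ge0 t x; have h1 := compress_le1 x t0.
rewrite indicE mem_setE in_itv/= -ler_norml.
have [_|/V_supp Vx] := leP `|x| 2; last first.
  by rewrite /compress Vx mulr0 mul0r subr0 (max_idPr _)// expr1n subrr normr0.
rewrite ger0_norm ?subr_ge0 ?expr_le1// gerBl sqr_ge0//.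
Qed.

Lemma compress_deficit_int t : 0 <= t -> \int[mu]_x `|1 - compress t x ^+ 2| <= 4.
Proof.
move=> t0; rewrite (_ : 4 = 2 - (- 2)); last by ring.
rewrite -(@Rint_indic_itv R (-2) 2 true false); last by lra.
apply: le_Rintegral => //.
- exact: L1_abs (L1_compress_deficit t0).
- exact: L1_indic_itv.
move=> x _; have h0 := compress_ge0 t x; have h1 := compress_le1 x t0.
rewrite indicE mem_setE in_itv/= -ler_norml.
have [_|/V_supp Vx] := leP `|x| 2; last first.
  by rewrite /compress Vx mulr0 mul0r subr0 (max_idPr _)// expr1n subrr normr0.
by rewrite ger0_norm ?subr_ge0 ?expr_le1// gerBl sqr_ge0.
Qed.

Lemma L1_flux t : 0 <= t -> L1 (fun x => V x * compress t x).
Proof.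
move=> t0; apply: (@L1_mul_bounded _ _ _ 1) => //; first exact: measurable_compress.
by move=> x; rewrite ger0_norm ?compress_ge0// compress_le1.
Qed.

Definition flow (t xi : R) : R := xi - prim (fun x => 1 - compress t x ^+ 2) xi.

Lemma L1_sq_window t : 0 <= t ->
  L1 (fun x => V x ^+ 2 * \int[mu]_(tau in `[0, t]) ((t - tau) * alive tau x)).
Proof.
move=> t0; rewrite (_ : (fun x => _) = fun x => 2 * (t * V x - (1 - compress t x ^+ 2))).
  by apply/L1Z/L1B; [exact: L1Z|exact: L1_compress_deficit].
by apply/funext => x; rewrite compress_sq//; field.
Qed.

Lemma L1_mul_window t : 0 <= t ->
  L1 (fun x => V x ^+ 2 * \int[mu]_(tau in `[0, t]) (1 * alive tau x)).
Proof.
move=> t0; rewrite (_ : (fun x => _) = fun x => 2 * (V x - V x * compress t x)).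
  by apply/L1Z/L1B => //; exact: L1_flux.
by apply/funext => x; rewrite compress_mul//; field.
Qed.

Lemma characteristicE t xi : 0 <= t -> characteristic datum t xi = flow t xi.
Proof.
move=> t0; rewrite /characteristic /flow.
rewrite (@energy_fubini (fun tau => t - tau) t); last 2 first.
- exact: measurable_funB.
- by move=> tau /andP[h0 h1]; rewrite ger0_norm ?subr_ge0// gerBl.
under [in RHS]eq_fun do rewrite compress_sq//.
rewrite primB_fun; [|exact: L1Z|exact: L1Z (L1_sq_window t0)].
rewrite primZ// primZ; last exact: L1_sq_window.
by rewrite /datum; ring.
Qed.

Lemma solution_valueE t xi : 0 <= t ->
  datum xi + 2^-1 * \int[mu]_(tau in `[0, t]) left_energy datum tau xi =
  - prim (fun x => V x * compress t x) xi.
Proof.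
move=> t0.
transitivity (datum xi + 2^-1 * \int[mu]_(tau in `[0, t]) (1 * left_energy datum tau xi)).
  by congr (_ + _ * _); apply: eq_Rintegral => tau _; rewrite mul1r.
rewrite (@energy_fubini (fun=> 1) 1)//; last by move=> tau _; rewrite normr1.
under [in RHS]eq_fun do rewrite compress_mul//.
rewrite primB_fun//; last exact: L1Z (L1_mul_window t0).
rewrite primZ; last exact: L1_mul_window.
by rewrite /datum; ring.
Qed.

Section fixed_time.
Variable t : R.
Hypothesis t0 : 0 <= t.
Notation p := (compress t).

Lemma flow_sub a b : a <= b -> flow t b - flow t a = \int[mu]_(x in `[a, b]) p x ^+ 2.
Proof.
move=> ab; rewrite /flow.
have l1 := L1_compress_deficit t0.
have -> : b - prim (fun x => 1 - p x ^+ 2) b - (a - prim (fun x => 1 - p x ^+ 2) a) =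
  (b - a) - (prim (fun x => 1 - p x ^+ 2) b - prim (fun x => 1 - p x ^+ 2) a) by ring.
rewrite primBoo// -(@Rint_indic_itv R a b true false ab).
have -> : \int[mu]_x \1_`[a, b] x = \int[mu]_(x in `[a, b]) (1 : R).
  by rewrite [RHS]Rint_restrict; apply: eq_Rintegral => x _; rewrite mul1r.
rewrite -RintegralB//; last by apply: L1_on => //; exact: measurable_itv.
  by apply: eq_Rintegral => x _; ring.
by apply: (@L1_itv R (cst 1)) => x; exact: cvg_cst.
Qed.

Lemma flow_homo a b : a <= b -> flow t a <= flow t b.
Proof.
by move=> ab; rewrite -subr_ge0 flow_sub//; apply: Rintegral_ge0 => x _; exact: sqr_ge0.
Qed.

Lemma flow_lip a b : a <= b -> flow t b - flow t a <= b - a.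
Proof.
move=> ab; rewrite /flow.
have l1 := L1_compress_deficit t0.
suff : 0 <= prim (fun x => 1 - p x ^+ 2) b - prim (fun x => 1 - p x ^+ 2) a by lra.
rewrite primBoo//; apply: Rintegral_ge0 => x _.
by rewrite subr_ge0 expr_le1// ?compress_ge0// compress_le1.
Qed.

Lemma flow_dist a : `|flow t a - a| <= 4.
Proof.
rewrite /flow addrAC subrr sub0r normrN.
exact: le_trans (prim_abs _ (L1_compress_deficit t0)) (compress_deficit_int t0).
Qed.

Lemma flow_continuous : continuous (flow t).
Proof.
by move=> x; apply: cvgB; [exact: cvg_id|exact: prim_continuous (L1_compress_deficit t0) x].
Qed.

Lemma flow_surj x : exists xi, flow t xi = x.
Proof.
have h1 := flow_dist (x - 4); have h2 := flow_dist (x + 4).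
have ab : x - 4 <= x + 4 by lra.
have [||c _ cx] := @IVT R (flow t) _ _ x ab; last by exists c.
  exact: continuous_subspaceT flow_continuous.
have h3 := flow_homo ab.
rewrite (min_idPl h3) (max_idPr h3).
by move: h1 h2; rewrite !ler_norml => /andP[? ?] /andP[? ?]; apply/andP; split; lra.
Qed.

(** The flow may be flat, so its inverse is a choice; the largest label works
for every monotonicity argument. *)
Definition label (x : R) : R := sup [set xi | flow t xi <= x].

Lemma label_has_sup x : has_sup [set xi | flow t xi <= x].
Proof.
split; first by have [xi xiE] := flow_surj x; exists xi => /=; rewrite xiE.
exists (x + 4) => xi /= h; have := flow_dist xi.
by rewrite ler_norml => /andP[? _]; lra.
Qed.

Lemma flow_label_le x : flow t (label x) <= x.
Proof.
apply/ler_addgt0Pr => e e0.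
have [xi /= h1 h2] := sup_adherent e0 (label_has_sup x).
rewrite -/(label x) in h2.
have h3 : xi <= label x by apply: ub_le_sup => //; exact: (label_has_sup x).2.
have := flow_lip h3; lra.
Qed.

(** The Galois connection from which the properties of [label] follow. *)
Lemma flow_le_label xi x : (flow t xi <= x) = (xi <= label x).
Proof.
apply/idP/idP => h; first by apply: ub_le_sup => //; exact: (label_has_sup x).2.
exact: le_trans (flow_homo h) (flow_label_le x).
Qed.

Lemma labelK x : flow t (label x) = x.
Proof.
apply/eqP; rewrite eq_le flow_label_le/=.
have [xi xiE] := flow_surj x; rewrite -[in leLHS]xiE; apply: flow_homo.
by rewrite -flow_le_label xiE.
Qed.

Lemma label_homo : {homo label : x y / x <= y}.
Proof. by move=> x y xy; rewrite -flow_le_label labelK. Qed.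

Lemma measurable_label : measurable_fun setT label.
Proof. by apply: nondecreasing_measurable => // x y; exact: label_homo. Qed.

Lemma compress_cont xi : xi != 0 -> {for xi, continuous p}.
Proof.
move=> xi0; apply: (continuous_max (f := cst 0) (g := fun x => 1 - t * V x / 2)).
  exact: cvg_cst.
apply: cvgB; first exact: cvg_cst.
apply: cvgM; last exact: cvg_cst.
by apply: cvgM; [exact: cvg_cst|exact: V_cont].
Qed.

Lemma compress_sq_itv (a b : R) b0 b1 :
  mu.-integrable [set` Interval (BSide b0 a) (BSide b1 b)] (EFin \o (fun x => p x ^+ 2)).
Proof.
set D := [set` _]; have mD : measurable D by exact: measurable_itv.
have l1 : L1 (fun x => p x ^+ 2 * \1_D x).
  apply: (@L1_le _ _ (fun x => \1_D x)); last exact: L1_indic_itv.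
    apply: measurable_funM; first exact: (measurable_funX 2 (measurable_compress t)).
    exact: L1_measurable (L1_indic_itv a b b0 b1).
  move=> x; rewrite indicE; case: (_ \in _); rewrite ?mulr0 ?normr0// mulr1.
  by rewrite ger0_norm ?sqr_ge0// expr_le1// ?compress_ge0// compress_le1.
have := L1_on mD l1; apply: eq_integrable => // x xD /=.
by rewrite indicE xD mulr1.
Qed.

(** The Jacobian is positive near xi, by continuity of V away from 0. *)
Lemma flow_strict xi b : xi != 0 -> 0 < p xi -> xi < b -> flow t xi < flow t b.
Proof.
move=> xi0 pxi xib.
have /cvgrPdist_lt/(_ _ (divr_gt0 pxi (ltr0n R 2))) := compress_cont xi0.
move=> /nbhs_ballP[e /= e0 he].
pose c := Num.min b (xi + e / 2).
have xic : xi < c by rewrite lt_min xib ltrDl divr_gt0.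
have cb : c <= b by rewrite ge_min lexx.
apply: (lt_le_trans _ (flow_homo cb)).
rewrite -subr_gt0 flow_sub ?ltW//.
have l2 : L1 (fun x => (p xi / 2) ^+ 2 * \1_`[xi, c] x) by apply: L1Z; exact: L1_indic_itv.
have l3 : L1 (fun x => p x ^+ 2 * \1_`[xi, c] x).
  by apply: L1_restrict => //; exact: compress_sq_itv.
rewrite Rint_restrict; apply: (@lt_le_trans _ _ (\int[mu]_x ((p xi / 2) ^+ 2 * \1_`[xi, c] x))).
  rewrite RintegralZl//; last exact: L1_indic_itv.
  by rewrite Rint_indic_itv ?ltW// mulr_gt0 ?subr_gt0// exprn_gt0// divr_gt0.
apply: le_Rintegral => // x _; rewrite indicE mem_setE in_itv/=.
have [/andP[h1 h2]|_] := boolP (xi <= x <= c); last by rewrite !mulr0.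
rewrite !mulr1 lerXn2r// ?nnegrE ?compress_ge0 ?divr_ge0 ?ltW//.
have := he x; rewrite /ball/= => /(_ _).
have xe : `|xi - x| < e.
  rewrite distrC ger0_norm ?subr_ge0//; move: h2; rewrite le_min => /andP[_ h2].
  by have := e0; lra.
by move=> /(_ xe) h; have := ler_norm (p xi - p x); lra.
Qed.

Lemma flowK xi : xi != 0 -> 0 < p xi -> label (flow t xi) = xi.
Proof.
move=> xi0 pxi; apply/eqP; rewrite eq_le -flow_le_label lexx andbT.
rewrite leNgt; apply/negP => h; have := flow_strict xi0 pxi h.
by rewrite labelK ltxx.
Qed.

(** Labels brought together by the flow are broken almost everywhere, and a
broken label carries no flux; this is why the solution is single-valued. *)
Lemma flux_flat a b : a <= b -> flow t a = flow t b ->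
  prim (fun x => V x * p x) a = prim (fun x => V x * p x) b.
Proof.
move=> ab flow_ab; apply/esym/eqP; rewrite -subr_eq0 primBoo//; last exact: L1_flux.
rewrite Rint_restrict; apply/eqP.
transitivity (\int[mu]_x (cst (0:R) x)); last by rewrite Rintegral_cst// mul0r.
apply: Rint_ae_eq => //.
  by apply: L1_measurable; apply: L1_indic => //; exact: L1_flux.
have := ae_and (ae_neq 0) (ae_and (ae_neq a) (ae_neq b)).
apply: ae_imply => x [x0 [xa xb]] _; rewrite indicE mem_setE in_itv/=.
have [/andP[ax bx]|_] := boolP (a <= x <= b); last by rewrite mulr0.
rewrite /= mulr1; have := compress_ge0 t x; rewrite le_eqVlt => /predU1P[<-|px].
  by rewrite mulr0.
have xb' : x < b by rewrite lt_neqAle xb.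
have := flow_strict x0 px xb'; rewrite -flow_ab ltNge flow_homo//.
Qed.

(** The preimage of an interval is an interval of labels, over which the
Jacobian integrates to the increment of the flow. *)
Lemma flow_transport a b : a < b ->
  (\int[mu]_(x in flow t @^-1` `]a, b]) (p x ^+ 2)%:E = (b - a)%:E)%E.
Proof.
move=> ab; have label_le : label a <= label b by apply: label_homo; exact: ltW.
rewrite (_ : flow t @^-1` `]a, b] = `]label a, label b]%classic); last first.
  apply/seteqP; split => x /=; rewrite !in_itv/= flow_le_label => /andP[h1 h2]; rewrite h2 andbT.
    by rewrite ltNge -flow_le_label -ltNge.
  by rewrite ltNge flow_le_label -ltNge.
have lI := compress_sq_itv (label a) (label b) false false.
rewrite -Rint_EFin//; congr (_%:E).
by rewrite Rintegral_itv_obnd_cbnd// -flow_sub// !labelK.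
Qed.

(** Along a surviving characteristic the slope solves the Riccati equation v'
= - v^2 / 2, so that - V has become - V / p at time t. *)
Definition slope (x : R) : R := - (V (label x) / p (label x)).

Lemma measurable_slope : measurable_fun setT slope.
Proof.
apply: measurableT_comp => //; apply: measurable_funM.
  exact: (measurableT_comp mV measurable_label).
rewrite (_ : (fun x => _) = fun x => p (label x) `^ (-1)).
  have m1 := measurableT_comp (measurable_compress t) measurable_label.
  exact: (measurableT_comp (measurable_powR (-1)) m1).
by apply/funext => x; rewrite powR_inv1// compress_ge0.
Qed.

Lemma slope_le0 x : slope x <= 0.
Proof. by rewrite /slope oppr_le0 divr_ge0// compress_ge0. Qed.

Lemma slope_flow xi : xi != 0 -> 0 < p xi -> slope (flow t xi) = - (V xi / p xi).
Proof. by move=> xi0 pxi; rewrite /slope flowK. Qed.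

Lemma flow_change_of_variables (F : R -> R) : measurable_fun setT F -> (forall x, 0 <= F x) ->
  (\int[mu]_x (F x)%:E = \int[mu]_x (F (flow t x) * p x ^+ 2)%:E)%E.
Proof.
move=> mF F0; have mflow : measurable_fun setT (flow t) by apply: continuous_measurable_fun; exact: flow_continuous.
have := @ge0_change_of_variables R (fun x => p x ^+ 2) (flow t) _ _ mflow flow_transport (fun x => (F x)%:E).
apply.
- exact: (measurable_funX 2 (measurable_compress t)).
- by move=> x; exact: sqr_ge0.
- exact: measurable_EFin.
- by move=> x; rewrite lee_fin.
Qed.

Lemma slope_vanishes x : 6 < `|x| -> slope x = 0.
Proof.
move=> x6; rewrite /slope V_supp ?mul0r ?oppr0//.
have := flow_dist (label x); rewrite labelK => h.
have := ler_normB x (x - label x); rewrite (_ : x - (x - label x) = label x); last by ring.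
have := ler_normB (label x) (label x - x); rewrite (_ : label x - (label x - x) = x); last by ring.
by rewrite (distrC (label x) x); lra.
Qed.

Let mabs : measurable_fun setT (fun x => `|slope x|).
Proof. exact: measurable_abs measurable_slope. Qed.

Lemma slope_abs_change_of_variables (F : R -> R) : measurable_fun setT F ->
  (forall x, 0 <= F x) ->
  (\int[mu]_x (`|slope x| * F x)%:E = \int[mu]_x (V x * p x * F (flow t x))%:E)%E.
Proof.
move=> mF F0.
have mflow : measurable_fun setT (flow t) by apply: continuous_measurable_fun; exact: flow_continuous.
rewrite (@flow_change_of_variables (fun x => `|slope x| * F x)); last 2 first.
- exact: measurable_funM.
- by move=> x; rewrite mulr_ge0.
apply: ae_eq_integral => //.
- apply: (@measurable_EFin R (fun x => `|slope (flow t x)| * F (flow t x) * p x ^+ 2)).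
  apply: measurable_funM; last exact: (measurable_funX 2 (measurable_compress t)).
  apply: measurable_funM; first exact: (measurableT_comp mabs mflow).
  exact: (measurableT_comp mF mflow).
- apply: (@measurable_EFin R (fun x => V x * p x * F (flow t x))).
  apply: measurable_funM; first by apply: measurable_funM => //; exact: measurable_compress.
  exact: (measurableT_comp mF mflow).
apply: ae_imply (ae_neq 0) => x x0 _; congr (_%:E).
have := compress_ge0 t x; rewrite le_eqVlt => /predU1P[<-|px].
  by rewrite expr0n/= mulr0 mulr0 mul0r.
rewrite slope_flow// normrN ger0_norm ?divr_ge0// ?ltW//.
by field; rewrite gt_eqF.
Qed.

Lemma slope_abs_int : (\int[mu]_x (`|slope x|)%:E = \int[mu]_x (V x * p x)%:E)%E.
Proof.
have := @slope_abs_change_of_variables (cst 1); rewrite /=.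
under eq_integral do rewrite mulr1; move=> ->//.
by apply: eq_integral => x _; rewrite mulr1.
Qed.

Lemma L1_slope : L1 slope.
Proof.
have h : L1 (fun x => `|slope x|).
  apply: L1_ge0 => //; rewrite slope_abs_int.
  exact: integrable_lty (L1_flux t0).
by apply: (L1_le measurable_slope _ h).
Qed.

Lemma slope_int_le : \int[mu]_x `|slope x| <= \int[mu]_x V x.
Proof.
rewrite /Rintegral slope_abs_int; apply: le_Rintegral => //; first exact: L1_flux.
by move=> x _; rewrite ler_piMr// compress_le1.
Qed.

(** The Jacobian p^2 compensates the square of 1 / p: the energy of surviving
labels is conserved, and that of broken ones is lost. *)
Lemma slope_square_integrable : square_integrable slope.
Proof.
apply: square_integrableP; first exact: measurable_slope.
rewrite (@flow_change_of_variables (fun x => slope x ^+ 2)); last 2 first.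
- exact: (measurable_funX 2 measurable_slope).
- by move=> x; exact: sqr_ge0.
apply: (@le_lt_trans _ _ (\int[mu]_x (V x ^+ 2)%:E)%E); last exact: integrable_lty lV2.
have mflow : measurable_fun setT (flow t) by apply: continuous_measurable_fun; exact: flow_continuous.
apply: ae_ge0_le_integral => //.
- by move=> x _; rewrite lee_fin mulr_ge0 ?sqr_ge0.
- apply: (@measurable_EFin R (fun x => slope (flow t x) ^+ 2 * p x ^+ 2)).
  apply: measurable_funM; last exact: (measurable_funX 2 (measurable_compress t)).
  exact: (measurable_funX 2 (measurableT_comp measurable_slope mflow)).
- by move=> x _; rewrite lee_fin sqr_ge0.
- exact: (@measurable_EFin R _ (measurable_funX 2 mV)).
apply: ae_imply (ae_neq 0) => x x0 _; rewrite lee_fin.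
have := compress_ge0 t x; rewrite le_eqVlt => /predU1P[<-|px].
  by rewrite expr0n/= mulr0 sqr_ge0.
by rewrite slope_flow// sqrrN -exprMn mulfVK// gt_eqF.
Qed.

(** The change of variables x = flow t y turns slope dx into - (V / p) p^2 dy. *)
Lemma prim_slope xi : prim slope (flow t xi) = - prim (fun x => V x * p x) xi.
Proof.
have flow_eq : flow t xi = flow t (label (flow t xi)) by rewrite labelK.
rewrite (@flux_flat xi (label (flow t xi)))//; last by rewrite -flow_le_label.
rewrite !primE -[RHS]mulN1r.
transitivity (- \int[mu]_x (`|slope x| * \1_`]-oo, flow t xi] x)).
  rewrite -[RHS]mulN1r -RintegralZl//; last by apply: L1_indic => //; exact: L1_abs L1_slope.
  apply: eq_Rintegral => x _; rewrite ler0_norm ?slope_le0//; ring.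
rewrite mulN1r; congr (- _).
rewrite /Rintegral slope_abs_change_of_variables//.
congr fine; apply: eq_integral => x _; congr (_ * _)%:E.
by rewrite !indicE !mem_setE !in_itv/= flow_le_label.
Qed.

End fixed_time.

Lemma solution_prim u t x : dissipative_solution datum u -> 0 <= t ->
  u t x = prim (slope t) x.
Proof.
move=> hu t0; have [xi <-] := flow_surj t0 x.
have := hu t xi t0; rewrite characteristicE// => ->.
by rewrite solution_valueE// prim_slope.
Qed.

Lemma solution_exists : exists u, dissipative_solution datum u.
Proof.
exists (fun t => prim (slope t)) => t xi t0.
by rewrite characteristicE// prim_slope// solution_valueE.
Qed.

(** The label interval [a, b] is contracted by e^2, with e = 1 - t h / 2,
while its slope is divided by e; the L^2 norm is kept. *)
Lemma slope_plateau t a b h : 0 <= t -> 0 < a -> a < b ->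
  (forall x, a <= x <= b -> V x = h) -> 0 < 1 - t * h / 2 ->
  exists x0, forall x, `|x - x0| < (1 - t * h / 2) ^+ 2 * (b - a) / 2 ->
    slope t x = - (h / (1 - t * h / 2)).
Proof.
move=> t0 a0 ab hV; set e := 1 - t * h / 2 => e0.
have pe x : a <= x <= b -> compress t x = e.
  by move=> /hV Vx; rewrite /compress Vx (max_idPr _)// ltW.
have dflow : flow t b - flow t a = e ^+ 2 * (b - a).
  rewrite (flow_sub t0 (ltW ab)) Rint_restrict -(@Rint_indic_itv R a b true false (ltW ab)).
  rewrite -RintegralZl//; last exact: L1_indic_itv.
  apply: eq_Rintegral => x _; rewrite indicE mem_setE in_itv/=.
  by have [/pe ->//|_] := boolP (a <= x <= b); rewrite !mulr0.
exists ((flow t a + flow t b) / 2) => x; rewrite ltr_distlC => /andP[x1 x2].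
have flowx := labelK t0 x.
have labelx : a <= label t x <= b.
  apply/andP; split; rewrite leNgt; apply/negP => /ltW/(flow_homo t0); rewrite flowx; lra.
by rewrite /slope hV// pe.
Qed.

End dissipative.

(** * Sums over geometric scales *)

Section sums.
Context {R : realType}.
Notation mu := (@lebesgue_measure R).

Lemma weighted_cauchy_schwarz (b m : nat -> R) n : (forall k, 0 <= m k) ->
  (\sum_(k < n) b k * m k) ^+ 2 <= (\sum_(k < n) b k ^+ 2 * m k) * (\sum_(k < n) m k).
Proof.
move=> m0; elim: n => [|n IH]; first by rewrite !big_ord0 expr0n mul0r.
rewrite !big_ord_recr/=.
have A0 : 0 <= \sum_(k < n) b k ^+ 2 * m k by apply: sumr_ge0 => k _; rewrite mulr_ge0// sqr_ge0.
have B0 : 0 <= \sum_(k < n) m k by apply: sumr_ge0 => k _.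
move: IH A0 B0; set S := \sum_(k < n) b k * m k; set A := \sum_(k < n) b k ^+ 2 * m k.
set B := \sum_(k < n) m k => IH A0 B0.
have mn := m0 n; set y := b n; set w := m n in mn *.
have key : 2 * S * y <= A + y ^+ 2 * B.
  have [B00|Bpos] := eqVneq B 0.
    have S0 : S = 0 by apply/eqP; rewrite -sqrf_eq0 eq_le sqr_ge0 andbT (le_trans IH)// B00 mulr0.
    by rewrite S0 B00 !mulr0 mul0r addr0.
  have Bgt : 0 < B by rewrite lt_def Bpos.
  rewrite -(ler_pM2r Bgt).
  have := sqr_ge0 (S - y * B); nra.
have : 2 * S * y * w <= (A + y ^+ 2 * B) * w by rewrite ler_wpM2r.
nra.
Qed.

Lemma sum_inv_sq n : \sum_(k < n.+1) (k.+1%:R : R)^-1 ^+ 2 <= 2 - n.+1%:R^-1.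
Proof.
elim: n => [|n IH]; first by rewrite big_ord_recr big_ord0 /= invr1 expr1n; lra.
rewrite big_ord_recr/=; apply: (@le_trans _ _ (2 - n.+1%:R^-1 + n.+2%:R^-1 ^+ 2)); first by rewrite lerD2r.
have n0 : 0 < n.+1%:R :> R by rewrite ltr0n.
have n1 : n.+2%:R = n.+1%:R + 1 :> R by rewrite -natr1.
rewrite n1; move: (n.+1%:R : R) n0 => m m0.
have m1 : 0 < m + 1 by lra.
rewrite -subr_ge0 (_ : _ - _ = (m * (m + 1) ^+ 2)^-1).
  by rewrite invr_ge0 mulr_ge0 ?exprn_ge0// ltW.
by field; rewrite !gt_eqF.
Qed.

(** The right-hand side telescopes along the scales y, y / 4, y / 16, and so
on. With the factor 8 / 3 the difference of the two sides has numerator y (4 -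
5 y + 7 y^2), which is nonnegative. *)
Lemma telescope_lorentzian (y : R) : 0 <= y ->
  y / (1 + y ^+ 2) <= 8 / 3 * (y / (1 + y) - (y / 4) / (1 + y / 4)).
Proof.
move=> y0.
have h1 : 0 < 1 + y ^+ 2 by have := sqr_ge0 y; lra.
have h2 : 0 < 1 + y by lra.
have h3 : 0 < 4 + y by lra.
rewrite -subr_ge0.
have -> : 8 / 3 * (y / (1 + y) - y / 4 / (1 + y / 4)) - y / (1 + y ^+ 2) =
  y * (4 - 5 * y + 7 * y ^+ 2) / ((1 + y ^+ 2) * (1 + y) * (4 + y)).
  field; rewrite !gt_eqF//.
apply: divr_ge0; last by rewrite !mulr_ge0// ltW.
apply: mulr_ge0 => //; have := sqr_ge0 (y - 5/14); nra.
Qed.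

(** The terms decay geometrically on both sides of the scale where 4^-k x is
about 1, whatever the frequency x. *)
Lemma geometric_lorentzian_sum (x : R) n : 0 <= x ->
  \sum_(k < n) (4^-1 ^+ k * x) / (1 + (4^-1 ^+ k * x) ^+ 2) <= 8 / 3.
Proof.
move=> x0.
pose g (y : R) := y / (1 + y).
suff h : \sum_(k < n) (4^-1 ^+ k * x) / (1 + (4^-1 ^+ k * x) ^+ 2)
    <= 8 / 3 * (g x - g (4^-1 ^+ n * x)).
  apply: (le_trans h); rewrite -[leRHS]mulr1 ler_wpM2l//.
  have y0 : 0 <= 4^-1 ^+ n * x by rewrite mulr_ge0// exprn_ge0.
  have g0 : 0 <= g (4^-1 ^+ n * x) by rewrite /g divr_ge0//; lra.
  have g1 : g x <= 1 by rewrite /g ler_pdivrMr; lra.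
  lra.
elim: n => [|n IH]; first by rewrite big_ord0 expr0 mul1r subrr mulr0.
rewrite big_ord_recr/=; have y0 : 0 <= 4^-1 ^+ n * x by rewrite mulr_ge0// exprn_ge0.
have := telescope_lorentzian y0; rewrite -/(g _) (_ : 4^-1 ^+ n.+1 * x = 4^-1 ^+ n * x / 4); last first.
  by rewrite exprS; ring.
by rewrite /g in IH *; lra.
Qed.

End sums.

(** * Fourier integrals of trapezoids *)

Section trapezoid.
Context {R : realType}.
Notation mu := (@lebesgue_measure R).

Definition tri (c x : R) : R := Num.max 0 (1 - `|x| / c).

Lemma tri_ge0 c x : 0 <= tri c x. Proof. by rewrite /tri le_max lexx. Qed.

Lemma tri_le1 c x : 0 < c -> tri c x <= 1.
Proof. by move=> c0; rewrite /tri ge_max ler01 gerBl divr_ge0// ltW. Qed.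

Lemma tri_in c x : 0 < c -> `|x| <= c -> tri c x = 1 - `|x| / c.
Proof. by move=> c0 xc; rewrite /tri (max_idPr _)// subr_ge0 ler_pdivrMr// mul1r. Qed.

Lemma tri_out c x : 0 < c -> c <= `|x| -> tri c x = 0.
Proof. by move=> c0 xc; rewrite /tri (max_idPl _)// subr_le0 ler_pdivlMr// mul1r. Qed.

Lemma tri_continuous c : continuous (tri c).
Proof.
move=> x; apply: (continuous_max (f := cst 0) (g := fun x => 1 - `|x| / c)).
  exact: cvg_cst.
apply: cvgB; first exact: cvg_cst.
by apply: cvgM; [exact: norm_continuous|exact: cvg_cst].
Qed.

Lemma tri_le_indic c x : 0 < c -> tri c x <= \1_`[-c, c] x.
Proof.
move=> c0; rewrite indicE mem_setE in_itv/= -ler_norml.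
by have [_|/ltW h] := leP `|x| c; [exact: tri_le1|rewrite tri_out].
Qed.

Lemma L1_tri c : 0 < c -> L1 (tri c).
Proof.
move=> c0; apply: (@L1_le _ _ (fun x => \1_`[-c, c] x)); last exact: L1_indic_itv.
  by apply: continuous_measurable_fun; exact: tri_continuous.
by move=> x; rewrite ger0_norm ?tri_ge0// tri_le_indic.
Qed.

(** A phase al serves both transforms: al = 0 gives the cosine integral and al
= - pi / 2 the sine integral. *)
Lemma tri_phase c xi al : 0 < c -> xi != 0 ->
  \int[mu]_x (tri c x * cos (x * xi + al)) =
  cos al * (2 * (1 - cos (c * xi)) / (c * xi ^+ 2)).
Proof.
move=> c0 xi0; have cN0 : c != 0 by rewrite gt_eqF.
have dy (x : R) : is_derive x 1 (fun x : R => x * xi + al) xi.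
  by apply: is_derive_eq; rewrite /GRing.scale/=; ring.
have cy : continuous (fun x : R => cos (x * xi + al)).
  move=> x; apply: (@continuous_comp R R R (fun x : R => x * xi + al) cos); last exact: continuous_cos.
  by apply: cvgD; [apply: cvgM; [exact: cvg_id|exact: cvg_cst]|exact: cvg_cst].
have ds (x : R) := @is_derive1_comp R sin (fun x : R => x * xi + al) x _ _ (is_derive_sin (x * xi + al)) (dy x).
have dc (x : R) := @is_derive1_comp R cos (fun x : R => x * xi + al) x _ _ (is_derive_cos (x * xi + al)) (dy x).
pose G (e : R) (x : R) := (1 - e * (x / c)) * sin (x * xi + al) / xi - e * (cos (x * xi + al) / (c * xi ^+ 2)).
have dG (e x : R) : is_derive x 1 (G e) ((1 - e * (x / c)) * cos (x * xi + al)).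
  have dl : is_derive x 1 (fun x : R => 1 - e * (x / c)) (- (e / c)).
    by apply: is_derive_eq; rewrite /GRing.scale/=; ring.
  have ds' := ds x; have dc' := dc x.
  rewrite /G; apply: is_derive_eq.
  by rewrite /GRing.scale/=; field; rewrite cN0 xi0.
have cG (e : R) : continuous (fun x : R => (1 - e * (x / c)) * cos (x * xi + al)).
  move=> x; apply: cvgM; last exact: cy.
  apply: cvgB; first exact: cvg_cst.
  apply: cvgM; first exact: cvg_cst.
  by apply: cvgM; [exact: cvg_id|exact: cvg_cst].
pose f (e : R) (x : R) := (1 - e * (x / c)) * cos (x * xi + al).
have nc : - c <= 0 by lra.
have l1 : L1 (fun x => f (-1) x * \1_`[-c, 0] x).
  exact: (L1_restrict (measurable_itv _) (@L1_itv R (f (-1)) (-c) 0 (cG (-1)))).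
have l2 : L1 (fun x => f 1 x * \1_`[0, c] x).
  exact: (L1_restrict (measurable_itv _) (@L1_itv R (f 1) 0 c (cG 1))).
transitivity (\int[mu]_x (f (-1) x * \1_`[-c, 0] x + f 1 x * \1_`[0, c] x)).
  apply: Rint_ae_eq => //.
  - by apply: continuous_measurable_fun => x; apply: cvgM; [exact: tri_continuous|exact: cy].
  - exact: L1_measurable (L1D l1 l2).
  apply: ae_imply (ae_neq 0) => x x0 _; rewrite /f !indicE !mem_setE !in_itv/=.
  have [xlt|xgt|/eqP] := ltgtP x 0; last by rewrite (negPf x0).
    have ax : `|x| = - x by rewrite ltr0_norm.
    rewrite [_ && (x <= c)]andFb mulr0 addr0 andbT; have [xc|xc] := leP (- c) x.
      by rewrite tri_in// ax ?mulr1; [ring|lra].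
    by rewrite tri_out// ?ax ?mulr0 ?mul0r//; lra.
  have ax : `|x| = x by rewrite gtr0_norm.
  rewrite andbF mulr0 add0r /=; have [xc|xc] := leP x c.
    by rewrite tri_in// ax ?mulr1//; ring.
  by rewrite tri_out// ?ax ?mulr0 ?mul0r//; lra.
rewrite RintegralD// -!Rint_restrict.
rewrite (Rint_FTC2 nc (dG (-1)) (cG (-1))) (Rint_FTC2 (ltW c0) (dG 1) (cG 1)).
rewrite /G (_ : - c * xi + al = al - c * xi); last by ring.
rewrite (_ : 0 * xi + al = al); last by rewrite mul0r add0r.
rewrite (cosD (c * xi)) (cosB al).
by field; rewrite cN0 xi0.
Qed.

(** The size, up to a constant, of the Fourier transform of a piecewise linear
bump of width l: about l up to frequency 1 / l, with quadratic decay beyond. *)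
Definition lorentzian (l xi : R) : R := l / (1 + (l * xi) ^+ 2).

Lemma lorentzian_den (l xi : R) : 0 < 1 + (l * xi) ^+ 2.
Proof. by have := sqr_ge0 (l * xi); lra. Qed.

Lemma lorentzian_ge0 l xi : 0 < l -> 0 <= lorentzian l xi.
Proof. by move=> l0; rewrite /lorentzian divr_ge0 ?ltW// lorentzian_den. Qed.

Lemma cosT_tri c xi : 0 < c -> `|cosT (tri c) xi| <= 6 * lorentzian c xi.
Proof.
move=> c0; rewrite /lorentzian mulrA ler_pdivlMr ?lorentzian_den// mulrDr mulr1.
have h1 : `|cosT (tri c) xi| <= 2 * c.
  apply: (le_trans (Rint_le_abs (L1_cos _ (L1_tri c0)))).
  rewrite (_ : 2 * c = c - (- c)); last by ring.
  rewrite -(@Rint_indic_itv R (-c) c true false); last by lra.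
  apply: le_Rintegral => //; first exact: L1_abs (L1_cos _ (L1_tri c0)).
    exact: L1_indic_itv.
  move=> x _; rewrite normrM; apply: (le_trans _ (tri_le_indic x c0)).
  by rewrite ger0_norm ?tri_ge0// ler_piMr ?tri_ge0// abs_cos_le1.
have [xi0|xi0] := eqVneq xi 0.
  have -> : (c * xi) ^+ 2 = 0 by rewrite xi0 mulr0 expr0n.
  by rewrite mulr0; lra.
suff h2 : `|cosT (tri c) xi| * (c * xi) ^+ 2 <= 4 * c by lra.
have -> : cosT (tri c) xi = 2 * (1 - cos (c * xi)) / (c * xi ^+ 2).
  transitivity (\int[mu]_x (tri c x * cos (x * xi + 0))).
    by apply: eq_Rintegral => x _; rewrite addr0.
  by rewrite tri_phase// cos0 mul1r.
have xi2 : 0 < xi ^+ 2 by rewrite lt_def sqr_ge0 sqrf_eq0 xi0.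
have k1 := cos_le1 (c * xi); have k2 := cos_geN1 (c * xi).
rewrite ger0_norm; last first.
  by apply: divr_ge0; apply: mulr_ge0; rewrite ?(ltW c0) ?(ltW xi2)//; lra.
have -> : 2 * (1 - cos (c * xi)) / (c * xi ^+ 2) * (c * xi) ^+ 2 =
    2 * (1 - cos (c * xi)) * c by field; rewrite xi0 gt_eqF.
by apply: ler_wpM2r; [exact: ltW|lra].
Qed.

Lemma sinT_tri c xi : 0 < c -> sinT (tri c) xi = 0.
Proof.
move=> c0; have [->|xi0] := eqVneq xi 0.
  rewrite /sinT (_ : (fun x => _) = cst 0) ?Rintegral_cst ?mul0r//.
  by apply/funext => x; rewrite mulr0 sin0 mulr0.
transitivity (\int[mu]_x (tri c x * cos (x * xi + (- (pi / 2))))).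
  by apply: eq_Rintegral => x _; rewrite cosBpihalf.
by rewrite tri_phase// cosN cos_pihalf mul0r.
Qed.

(** Equal to 1 on [-l, l] and to 0 outside [-2 l, 2 l]. As a combination of
triangles, it inherits their explicit transform. *)
Definition trap (l x : R) : R := 2 * tri (2 * l) x - tri l x.

Lemma trap_in l x : 0 < l -> `|x| <= l -> trap l x = 1.
Proof.
move=> l0 xl; rewrite /trap !tri_in//; [|lra|lra].
by field; rewrite gt_eqF.
Qed.

Lemma trap_out l x : 0 < l -> 2 * l <= `|x| -> trap l x = 0.
Proof. by move=> l0 xl; rewrite /trap !tri_out//; lra. Qed.

Lemma trap_bound l x : 0 < l -> 0 <= trap l x <= 1.
Proof.
move=> l0; have [xl|/ltW lx] := leP `|x| l; first by rewrite trap_in// ler01 lexx.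
have [xl|/ltW l2x] := leP `|x| (2 * l); last by rewrite trap_out// lexx ler01.
rewrite /trap (tri_out l0 lx) tri_in//; last by lra.
have l2 : 0 < 2 * l by lra.
have : `|x| / (2 * l) <= 1 by rewrite ler_pdivrMr// mul1r.
have : 1 / 2 <= `|x| / (2 * l) by rewrite ler_pdivlMr// mulrA divfK//; lra.
by move=> h1 h2; apply/andP; split; lra.
Qed.

Lemma trap_le_indic l x : 0 < l -> trap l x <= \1_`[-(2 * l), 2 * l] x.
Proof.
move=> l0; rewrite indicE mem_setE in_itv/= -ler_norml.
have [_|/ltW h] := leP `|x| (2 * l); last by rewrite trap_out.
by have /andP[] := trap_bound x l0.
Qed.

Lemma trap_continuous l : continuous (trap l).
Proof.
move=> x; apply: cvgB; last exact: tri_continuous.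
by apply: cvgM; [exact: cvg_cst|exact: tri_continuous].
Qed.

Lemma L1_trap l : 0 < l -> L1 (trap l).
Proof. by move=> l0; apply: L1B; [apply/L1Z/L1_tri; lra|exact: L1_tri]. Qed.

Lemma cosT_lin (f g : R -> R) (a b xi : R) : L1 f -> L1 g ->
  cosT (fun x => a * f x - b * g x) xi = a * cosT f xi - b * cosT g xi.
Proof.
move=> lf lg; rewrite /cosT -!RintegralZl//; try exact: L1_cos.
rewrite -RintegralB//; [|exact: L1Z (L1_cos _ lf)|exact: L1Z (L1_cos _ lg)].
by apply: eq_Rintegral => x _; ring.
Qed.

Lemma sinT_lin (f g : R -> R) (a b xi : R) : L1 f -> L1 g ->
  sinT (fun x => a * f x - b * g x) xi = a * sinT f xi - b * sinT g xi.
Proof.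
move=> lf lg; rewrite /sinT -!RintegralZl//; try exact: L1_sin.
rewrite -RintegralB//; [|exact: L1Z (L1_sin _ lf)|exact: L1Z (L1_sin _ lg)].
by apply: eq_Rintegral => x _; ring.
Qed.

Lemma cosT_trap l xi : 0 < l -> `|cosT (trap l) xi| <= 30 * lorentzian l xi.
Proof.
move=> l0; have l2 : 0 < 2 * l by lra.
have -> : cosT (trap l) xi = 2 * cosT (tri (2 * l)) xi - 1 * cosT (tri l) xi.
  rewrite -cosT_lin; [|exact: L1_tri|exact: L1_tri].
  by congr (cosT _ _); apply/funext => x; rewrite /trap mul1r.
have h1 := cosT_tri xi l2; have h2 := cosT_tri xi l0.
have h3 : lorentzian (2 * l) xi <= 2 * lorentzian l xi.
  rewrite /lorentzian mulrA ler_pM2l// lef_pV2 ?posrE ?lorentzian_den//.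
  rewrite (_ : (2 * l * xi) ^+ 2 = 4 * (l * xi) ^+ 2); last by ring.
  by have := sqr_ge0 (l * xi); lra.
apply: (le_trans (ler_normB _ _)); rewrite mul1r normrM ger0_norm//; lra.
Qed.

Lemma sinT_trap l xi : 0 < l -> sinT (trap l) xi = 0.
Proof.
move=> l0; have l2 : 0 < 2 * l by lra.
have -> : sinT (trap l) xi = 2 * sinT (tri (2 * l)) xi - 1 * sinT (tri l) xi.
  rewrite -sinT_lin; [|exact: L1_tri|exact: L1_tri].
  by congr (sinT _ _); apply/funext => x; rewrite /trap mul1r.
by rewrite !sinT_tri// !mulr0 subrr.
Qed.

Lemma lorentzian_continuous l : continuous (lorentzian l).
Proof.
move=> x; apply: cvgM; first exact: cvg_cst.
apply: cvgV; first by rewrite gt_eqF// lorentzian_den.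
apply: cvgD; first exact: cvg_cst.
apply: (@continuous_comp R R R (fun x => l * x) (fun y => y ^+ 2)); last exact: exprn_continuous.
by apply: cvgM; [exact: cvg_cst|exact: cvg_id].
Qed.

Lemma lorentzian_int l : 0 < l -> (\int[mu]_xi (lorentzian l xi)%:E <= 4%:E)%E.
Proof.
move=> l0.
have ck : continuous (lorentzian l) by exact: lorentzian_continuous.
have dF (x : R) : is_derive x 1 (fun x : R => atan (l * x)) (lorentzian l x).
  have dl : is_derive x 1 (fun x : R => l * x) l.
    by apply: is_derive_eq; rewrite /GRing.scale/=; ring.
  have := @is_derive1_comp R atan (fun x : R => l * x) x _ _ (is_derive1_atan (l * x)) dl.
  by rewrite mulrC.
apply: (@fatou_bound _ (fun n x => lorentzian l x * \1_`[(- n%:R : R), n%:R] x)).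
- by move=> n; apply: measurable_funM => //; exact: continuous_measurable_fun.
- by move=> n x; rewrite mulr_ge0 ?lorentzian_ge0// indicE ler0n.
- move=> x; apply: cvg_near_cst; near=> n.
  rewrite indicE mem_setE in_itv/= -ler_norml.
  rewrite (_ : `|x| <= n%:R) ?mulr1//.
  apply: (@le_trans _ _ (Num.truncn `|x|).+1%:R); first by rewrite ltW// truncnS_gt.
  by rewrite ler_nat; near: n; exact: nbhs_infty_ge.
- move=> n; have nn : - n%:R <= n%:R :> R by have := @ler0n R n; lra.
  have lk : L1 (fun x => lorentzian l x * \1_`[(- n%:R : R), n%:R] x).
    exact: (L1_restrict (measurable_itv _) (@L1_itv R _ _ _ ck)).
  rewrite -(Rint_EFin measurableT lk) -Rint_restrict (Rint_FTC2 nn dF ck) lee_fin.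
  have := @atan_ltpi2 R (l * n%:R); have := @atan_gtNpi2 R (l * - n%:R).
  have := @pihalf_lt2 R; lra.
Unshelve. all: by end_near. Qed.

End trapezoid.

(** * A profile with a logarithmic singularity *)

Section profile.
Context {R : realType}.
Notation mu := (@lebesgue_measure R).

Definition scale (k : nat) : R := 4^-1 ^+ k.

(** The sum of these weights diverges, which makes the profile unbounded; the
sum of their squares converges, which bounds its H^(1/2) seminorm. *)
Definition weight (k : nat) : R := k.+1%:R^-1.

Lemma scale_gt0 k : 0 < scale k.
Proof. by rewrite exprn_gt0// invr_gt0. Qed.

Lemma scale_le1 k : scale k <= 1.
Proof. by rewrite exprn_ile1// ?invr_ge0// invf_le1//; lra. Qed.

Lemma scaleS k : scale k.+1 = scale k / 4.
Proof. by rewrite /scale exprS mulrC. Qed.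

Lemma scale_anti j k : (j <= k)%N -> scale k <= scale j.
Proof. by move=> jk; apply: ler_wiXn2l => //; lra. Qed.

Lemma scale_lt_inv k : scale k * k.+1%:R <= 1.
Proof.
elim: k => [|k IH]; first by rewrite /scale expr0 mulr1.
have s1 := scale_le1 k; rewrite scaleS -(natr1 k.+1).
by move: IH s1; move: (k.+1%:R : R) (scale k) => m t; lra.
Qed.

Lemma weight_gt0 k : 0 < weight k. Proof. by rewrite invr_gt0 ltr0n. Qed.
Lemma weight_le1 k : weight k <= 1.
Proof. by rewrite invf_le1 ?ltr0n// ler1n. Qed.

Definition partial_profile (n : nat) (x : R) : R := \sum_(k < n) weight k * trap (scale k) x.

(** A number of terms after which every bump vanishes at x. *)
Definition nterms (x : R) : nat := (Num.truncn (2 / `|x|)).+1.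

(** The series of bumps, whose terms eventually vanish at each x <> 0; the
value at the origin, where it diverges, is conventional. *)
Definition profile (x : R) : R := if x == 0 then 0 else partial_profile (nterms x) x.

Lemma trap_scale_out k x : x != 0 -> (nterms x <= k)%N -> trap (scale k) x = 0.
Proof.
move=> x0 nk; apply: trap_out; first exact: scale_gt0.
have xp : 0 < `|x| by rewrite normr_gt0.
have h1 : 2 / `|x| < k.+1%:R.
  by apply: (lt_le_trans (truncnS_gt _)); rewrite ler_nat (leq_trans nk).
have h2 := scale_lt_inv k; have h3 := scale_gt0 k.
move: h1; rewrite ltr_pdivrMr// => h1.
have : 2 * scale k <= k.+1%:R * `|x| * scale k by rewrite ler_wpM2r// ltW.
move=> h4; apply: (le_trans h4).
by rewrite mulrAC ler_piMl// mulrC.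
Qed.

Lemma partial_stable n x : x != 0 -> (nterms x <= n)%N -> partial_profile n x = profile x.
Proof.
move=> x0 nn; rewrite /profile (negPf x0) /partial_profile.
rewrite -(subnKC nn) big_split_ord/= [X in _ + X]big1 ?addr0// => i _.
by rewrite trap_scale_out ?mulr0// leq_addr.
Qed.

Lemma partial_ge0 n x : 0 <= partial_profile n x.
Proof.
apply: sumr_ge0 => k _; apply: mulr_ge0; first exact: ltW (weight_gt0 _).
by have /andP[] := trap_bound x (scale_gt0 k).
Qed.

Lemma partial_homo m n x : (m <= n)%N -> partial_profile m x <= partial_profile n x.
Proof.
move=> mn; rewrite /partial_profile -(subnKC mn) big_split_ord/= lerDl.
apply: sumr_ge0 => k _; apply: mulr_ge0; first exact: ltW (weight_gt0 _).
by have /andP[] := trap_bound x (scale_gt0 (m + k)).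
Qed.

Lemma partial_le n x : x != 0 -> partial_profile n x <= profile x.
Proof.
move=> x0; rewrite -(@partial_stable (maxn n (nterms x)))// ?leq_maxr//.
by apply: partial_homo; exact: leq_maxl.
Qed.

Lemma profile_ge0 x : 0 <= profile x.
Proof. by rewrite /profile; case: ifP => // _; exact: partial_ge0. Qed.

Lemma partial_out n x : 2 < `|x| -> partial_profile n x = 0.
Proof.
move=> x2; apply: big1 => k _; rewrite trap_out ?mulr0//; first exact: scale_gt0.
by have := scale_le1 k; lra.
Qed.

Lemma profile_supp x : 2 < `|x| -> profile x = 0.
Proof. by move=> x2; rewrite /profile; case: ifP => // _; exact: partial_out. Qed.

Lemma partial_continuous n : continuous (partial_profile n).
Proof.
move=> x; apply: cvg_big; [exact: add_continuous|].
move=> k _; apply: cvgM; [exact: cvg_cst|exact: trap_continuous].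
Qed.

Lemma profile_cont x : x != 0 -> {for x, continuous profile}.
Proof.
move=> x0; have xp : 0 < `|x| by rewrite normr_gt0.
pose n := nterms (x / 2).
have E y : `|x| / 2 < `|y| -> partial_profile n y = profile y.
  move=> xy; have y0 : y != 0 by rewrite -normr_gt0; apply: lt_trans xy; rewrite divr_gt0.
  apply: partial_stable => //; rewrite ltnS; apply: le_truncn.
  have yp : 0 < `|y| by rewrite normr_gt0.
  rewrite ler_pM2l// lef_pV2 ?posrE// ?normr_gt0 ?mulf_neq0 ?invr_neq0//.
  by rewrite normrM [X in _ * X]ger0_norm ?ltW// invr_gt0.
have Ex : partial_profile n x = profile x by apply: E; lra.
red; red; rewrite -Ex.
apply: (@cvg_trans _ (partial_profile n @ x)); last exact: partial_continuous.
apply: near_eq_cvg.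
near=> y; apply: E; near: y.
have : (fun z : R => `|z|) @ x --> `|x| by exact: norm_continuous.
move=> /(cvgr_gt `|x|); apply; lra.
Unshelve. all: by end_near. Qed.

(** The partial sums, set to 0 at the origin so that they converge to the
profile everywhere and stay below it. *)
Definition profile_approx (n : nat) (x : R) : R := partial_profile n x * (x != 0)%:R.

Lemma profile_approx_cvg x : profile_approx n x @[n --> \oo] --> profile x.
Proof.
apply: cvg_near_cst; near=> n; rewrite /profile_approx.
have [->|x0] := eqVneq x 0; first by rewrite mulr0 /profile eqxx.
by rewrite mulr1 partial_stable//; near: n; exact: nbhs_infty_ge.
Unshelve. all: by end_near. Qed.

Lemma measurable_profile_approx n : measurable_fun setT (profile_approx n).
Proof.
apply: (measurable_except (g := partial_profile n) (c := 0)).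
  by apply: continuous_measurable_fun; exact: partial_continuous.
by move=> x x0; rewrite /profile_approx x0 mulr1.
Qed.

Lemma measurable_profile : measurable_fun setT profile.
Proof.
apply: (@measurable_fun_cvg _ _ _ _ profile_approx).
  by move=> n; exact: measurable_profile_approx.
by move=> x _; exact: profile_approx_cvg.
Qed.

Lemma profile_approx_ge0 n x : 0 <= profile_approx n x.
Proof. by rewrite /profile_approx mulr_ge0// partial_ge0. Qed.

Lemma profile_approx_le n x : profile_approx n x <= profile x.
Proof.
rewrite /profile_approx; have [->|x0] := eqVneq x 0; first by rewrite mulr0 profile_ge0.
by rewrite mulr1 partial_le.
Qed.

Lemma sum_geo n : \sum_(k < n) (2^-1 : R) ^+ k <= 2 - 2 * 2^-1 ^+ n.
Proof.
elim: n => [|n IH]; first by rewrite big_ord0 expr0; lra.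
by rewrite big_ord_recr/= exprS; lra.
Qed.

(** Cauchy-Schwarz with the weights 2^-k: the factor 2^k left on the k-th
square is beaten by the width 4^-k of the bump. *)
Lemma partial_sq n x :
  partial_profile n x ^+ 2 <= 2 * \sum_(k < n) 2 ^+ k * \1_`[-(2 * scale k), 2 * scale k] x.
Proof.
have -> : partial_profile n x = \sum_(k < n) (weight k * trap (scale k) x * 2 ^+ k) * (2^-1) ^+ k.
  apply: eq_bigr => k _; rewrite -mulrA -exprMn mulfV ?expr1n ?mulr1//.
apply: (le_trans (@weighted_cauchy_schwarz R (fun k => weight k * trap (scale k) x * 2 ^+ k)
  (fun k => 2^-1 ^+ k) n _)).
  by move=> k; rewrite exprn_ge0.
rewrite mulrC; apply: ler_pM.
- by apply: sumr_ge0 => k _; rewrite exprn_ge0.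
- by apply: sumr_ge0 => k _; rewrite mulr_ge0 ?sqr_ge0 ?exprn_ge0.
- by apply: (le_trans (sum_geo n)); have : 0 <= (2^-1 : R) ^+ n by [rewrite exprn_ge0]; lra.
apply: ler_sum => k _.
have -> : (weight k * trap (scale k) x * 2 ^+ k) ^+ 2 * 2^-1 ^+ k =
   2 ^+ k * (weight k * trap (scale k) x) ^+ 2 * (2 * 2^-1) ^+ k.
  by rewrite !exprMn; ring.
rewrite mulfV// expr1n mulr1 ler_wpM2l ?exprn_ge0//.
have /andP[t0 t1] := trap_bound x (scale_gt0 k).
have w0 := weight_gt0 k; have w1 := weight_le1 k.
apply: le_trans (trap_le_indic x (scale_gt0 k)).
rewrite exprMn -[leRHS]mul1r; apply: ler_pM; rewrite ?sqr_ge0//.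
  by rewrite expr_le1// ltW.
by rewrite expr2 ler_piMl.
Qed.

Lemma profile_sq_int : (\int[mu]_x (profile x ^+ 2)%:E <= 16%:E)%E.
Proof.
apply: (@fatou_bound _ (fun n x => profile_approx n x ^+ 2)).
- by move=> n; exact: (measurable_funX 2 (measurable_profile_approx n)).
- by move=> n x; exact: sqr_ge0.
- move=> x; rewrite expr2; under eq_fun do rewrite expr2.
  by apply: cvgM; exact: profile_approx_cvg.
move=> n.
pose h k (x : R) : R := 2 ^+ k * \1_`[-(2 * scale k), 2 * scale k] x.
have lh k : L1 (h k) by apply: L1Z; exact: L1_indic_itv.
have lS := L1Z 2 (L1_sum n lh).
have la : L1 (fun x => profile_approx n x ^+ 2).
  apply: (L1_le _ _ lS); first exact: (measurable_funX 2 (measurable_profile_approx n)).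
  move=> x; rewrite ger0_norm ?sqr_ge0//; apply: le_trans (partial_sq n x).
  rewrite /profile_approx; case: eqP => _; last by rewrite mulr1.
  by rewrite mulr0 expr0n sqr_ge0.
rewrite -(Rint_EFin measurableT la) lee_fin.
apply: (@le_trans _ _ (\int[mu]_x (2 * \sum_(k < n) h k x))).
  apply: le_Rintegral => //.
  move=> x _; apply: le_trans (partial_sq n x).
  rewrite /profile_approx; case: eqP => _; last by rewrite mulr1.
  by rewrite mulr0 expr0n sqr_ge0.
rewrite RintegralZl//; last exact: L1_sum.
rewrite Rint_sum//.
rewrite (eq_bigr (fun k : 'I_n => 4 * 2^-1 ^+ k)) => [|k _]; last first.
  rewrite /h RintegralZl//; last exact: L1_indic_itv.
  rewrite Rint_indic_itv; last by have := scale_gt0 k; lra.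
  have -> : 2 * scale k - - (2 * scale k) = 4 * scale k by ring.
  rewrite mulrCA; congr (_ * _); rewrite /scale -exprMn.
  by congr (_ ^+ _); field.
by rewrite -mulr_sumr; have := sum_geo n; have : 0 <= (2^-1 : R) ^+ n; [rewrite exprn_ge0//|lra].
Qed.

Lemma L1_profile_sq : L1 (fun x => profile x ^+ 2).
Proof.
apply: L1_ge0; first exact: (measurable_funX 2 measurable_profile).
  by move=> x; exact: sqr_ge0.
by apply: le_lt_trans profile_sq_int _; exact: ltry.
Qed.

Lemma L1_profile : L1 profile.
Proof.
apply: (@L1_le _ _ (fun x => profile x ^+ 2 + \1_`[-2, 2] x)).
- exact: measurable_profile.
- move=> x; rewrite ger0_norm ?profile_ge0// indicE mem_setE in_itv/= -ler_norml.
  have [_|/profile_supp ->] := leP `|x| 2; last by rewrite expr0n addr0.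
  by rewrite /=; have := sqr_ge0 (profile x - 1); have := profile_ge0 x; nra.
- by apply: L1D; [exact: L1_profile_sq|exact: L1_indic_itv].
Qed.

Definition height n : R := \sum_(k < n.+1) weight k.

Lemma height_gt0 n : 0 < height n.
Proof.
rewrite /height big_ord_recl ltr_pwDl ?weight_gt0// sumr_ge0// => k _.
exact: ltW (weight_gt0 _).
Qed.

Lemma height_unbounded (M : R) : exists n, M < height n.
Proof.
have h := @dvg_harmonic R; apply: contrapT => /forallNP hM; apply: h.
apply: nondecreasing_is_cvgn.
  apply/nondecreasing_seqP => n; rewrite seriesS lerDr.
  by rewrite /harmonic invr_ge0 ler0n.
exists M => _ [n _ <-]; case: n => [|n].
  rewrite /series/= big_geq//; apply: le_trans (ltW (height_gt0 0)) _.
  by rewrite leNgt; apply/negP/hM.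
by rewrite /series/= big_mkord leNgt; apply/negP/hM.
Qed.

(** The bumps of index at most n are equal to 1 there, and the next ones
vanish beyond 2 * 4^-(n + 1) = 4^-n / 2. *)
Lemma profile_plateau n x : scale n / 2 <= x <= scale n -> profile x = height n.
Proof.
move=> /andP[x1 x2]; have sn := scale_gt0 n; have xp : 0 < x by lra.
have x0 : x != 0 by rewrite gt_eqF.
rewrite -(@partial_stable (maxn n.+1 (nterms x)))// ?leq_maxr//.
rewrite /partial_profile -(subnKC (leq_maxl n.+1 (nterms x))) big_split_ord/=.
rewrite [X in _ + X]big1 ?addr0 => [|k _].
  apply: eq_bigr => k _; rewrite trap_in ?mulr1//; first exact: scale_gt0.
  rewrite ger0_norm ?(ltW xp)//; apply: (le_trans x2); apply: scale_anti.
  by rewrite -ltnS.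
rewrite trap_out ?mulr0//; first exact: scale_gt0.
rewrite ger0_norm ?(ltW xp)//; apply: le_trans x1.
have : scale (n.+1 + k) <= scale n.+1 by apply: scale_anti; exact: leq_addr.
by rewrite scaleS; lra.
Qed.

Lemma cosT_approx n xi :
  cosT (profile_approx n) xi = \sum_(k < n) weight k * cosT (trap (scale k)) xi.
Proof.
rewrite /cosT; transitivity (\int[mu]_x \sum_(k < n) weight k * (trap (scale k) x * cos (x * xi))).
  apply: (@Rint_except _ _ _ 0).
    apply: L1_measurable; apply: (@L1_sum R (fun k x => weight k * (trap (scale k) x * cos (x * xi)))) => k.
    by apply/L1Z/L1_cos/L1_trap/scale_gt0.
  move=> x x0; rewrite /profile_approx x0 mulr1 /partial_profile mulr_suml.
  by apply: eq_bigr => k _; rewrite mulrA.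
rewrite (@Rint_sum R (fun k x => weight k * (trap (scale k) x * cos (x * xi)))); last first.
  by move=> k; apply/L1Z/L1_cos/L1_trap/scale_gt0.
by apply: eq_bigr => k _; rewrite RintegralZl//; apply/L1_cos/L1_trap/scale_gt0.
Qed.

Lemma sinT_approx n xi : sinT (profile_approx n) xi = 0.
Proof.
rewrite /sinT; transitivity (\int[mu]_x \sum_(k < n) weight k * (trap (scale k) x * sin (x * xi))).
  apply: (@Rint_except _ _ _ 0).
    apply: L1_measurable; apply: (@L1_sum R (fun k x => weight k * (trap (scale k) x * sin (x * xi)))) => k.
    by apply/L1Z/L1_sin/L1_trap/scale_gt0.
  move=> x x0; rewrite /profile_approx x0 mulr1 /partial_profile mulr_suml.
  by apply: eq_bigr => k _; rewrite mulrA.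
rewrite (@Rint_sum R (fun k x => weight k * (trap (scale k) x * sin (x * xi)))); last first.
  by move=> k; apply/L1Z/L1_sin/L1_trap/scale_gt0.
apply: big1 => k _; rewrite RintegralZl//; last by apply/L1_sin/L1_trap/scale_gt0.
by have := sinT_trap xi (scale_gt0 k); rewrite /sinT => ->; rewrite mulr0.
Qed.

Lemma cosT_approx_cvg xi : cosT (profile_approx n) xi @[n --> \oo] --> cosT profile xi.
Proof.
apply: (@Rint_dct _ (fun n x => profile_approx n x * cos (x * xi)) _ profile _ _ _ L1_profile _).2.
- move=> n; apply: measurable_funM; first exact: measurable_profile_approx.
  exact: measurable_cos_mul.
- exact: L1_measurable (L1_cos _ L1_profile).
- by apply: aeW => x; apply: cvgM; [exact: profile_approx_cvg|exact: cvg_cst].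
- move=> n x; rewrite normrM ger0_norm ?profile_approx_ge0//.
  apply: le_trans (profile_approx_le n x).
  by rewrite -[leRHS]mulr1 ler_wpM2l ?profile_approx_ge0// abs_cos_le1.
Qed.

Lemma sinT_profile xi : sinT profile xi = 0.
Proof.
have h : sinT (profile_approx n) xi @[n --> \oo] --> sinT profile xi.
  apply: (@Rint_dct _ (fun n x => profile_approx n x * sin (x * xi)) _ profile _ _ _ L1_profile _).2.
  - move=> n; apply: measurable_funM; first exact: measurable_profile_approx.
    exact: measurable_sin_mul.
  - exact: L1_measurable (L1_sin _ L1_profile).
  - by apply: aeW => x; apply: cvgM; [exact: profile_approx_cvg|exact: cvg_cst].
  - move=> n x; rewrite normrM ger0_norm ?profile_approx_ge0//.
    apply: le_trans (profile_approx_le n x).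
    by rewrite -[leRHS]mulr1 ler_wpM2l ?profile_approx_ge0// abs_sin_le1.
have h0 : sinT (profile_approx n) xi @[n --> \oo] --> (0 : R).
  by under eq_cvg do rewrite sinT_approx; exact: cvg_cst.
exact: (cvg_unique _ h h0).
Qed.

(** Cauchy-Schwarz with the lorentzians as weights. The factor |xi| is
absorbed by the sum of the lorentzians, uniformly in n by
[geometric_lorentzian_sum]; what remains has squared weights, and is
integrable uniformly in n because all lorentzians have the same integral. *)
Lemma cosT_approx_le n xi : `|xi| * cosT (profile_approx n) xi ^+ 2 <=
  2400 * \sum_(k < n) weight k ^+ 2 * lorentzian (scale k) xi.
Proof.
set S := \sum_(k < n) weight k ^+ 2 * lorentzian (scale k) xi.
have S0 : 0 <= S.
  by apply: sumr_ge0 => k _; rewrite mulr_ge0 ?sqr_ge0 ?lorentzian_ge0 ?scale_gt0.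
have h1 : `|cosT (profile_approx n) xi| <= 30 * \sum_(k < n) weight k * lorentzian (scale k) xi.
  rewrite cosT_approx; apply: (le_trans (ler_norm_sum _ _ _)); rewrite mulr_sumr.
  apply: ler_sum => k _; rewrite normrM (ger0_norm (ltW (weight_gt0 k))) mulrCA.
  by rewrite ler_wpM2l ?(ltW (weight_gt0 k))// cosT_trap// scale_gt0.
have h2 : (\sum_(k < n) weight k * lorentzian (scale k) xi) ^+ 2 <=
    S * \sum_(k < n) lorentzian (scale k) xi.
  apply: (@weighted_cauchy_schwarz R weight (fun k => lorentzian (scale k) xi)) => k.
  by rewrite lorentzian_ge0// scale_gt0.
have h3 : `|xi| * \sum_(k < n) lorentzian (scale k) xi <= 8 / 3.
  apply: le_trans (geometric_lorentzian_sum n (normr_ge0 xi)).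
  rewrite mulr_sumr; apply: ler_sum => k _; rewrite /lorentzian /scale.
  by rewrite [X in _ <= _ / (1 + X)]exprMn real_normK ?num_real// -exprMn mulrA [`|xi| * _]mulrC.
have h4 : cosT (profile_approx n) xi ^+ 2 <= 900 * (\sum_(k < n) weight k * lorentzian (scale k) xi) ^+ 2.
  rewrite -real_normK ?num_real// (_ : 900 = 30 ^+ 2); last by ring.
  by rewrite -exprMn ler_sqr ?nnegrE// (le_trans _ h1).
have h5 := ler_wpM2l (normr_ge0 xi) (le_trans h4 (ler_wpM2l (ler0n R 900) h2)).
apply: (le_trans h5); have := ler_wpM2l S0 h3.
by move: (\sum_(k < n) lorentzian (scale k) xi) => K; lra.
Qed.

Lemma L1_lorentzian (l : R) : 0 < l -> L1 (lorentzian l).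
Proof.
move=> l0; apply: L1_ge0; last by apply: le_lt_trans (lorentzian_int l0) _; exact: ltry.
- exact: continuous_measurable_fun (@lorentzian_continuous R l).
- by move=> x; exact: lorentzian_ge0.
Qed.

Lemma profile_fourier_int :
  (\int[mu]_xi (`|xi| * cosT profile xi ^+ 2)%:E <= 19200%:E)%E.
Proof.
have mc (f : R -> R) : L1 f -> measurable_fun setT (fun xi : R => `|xi| * cosT f xi ^+ 2).
  move=> lf; apply: measurable_funM; first exact: measurable_abs (@measurable_id _ _ setT).
  exact: (measurable_funX 2 (continuous_measurable_fun (cosT_continuous lf))).
have la n : L1 (profile_approx n).
  apply: (L1_le _ _ L1_profile); first exact: measurable_profile_approx.
  by move=> x; rewrite ger0_norm ?profile_approx_ge0// profile_approx_le.
apply: (@fatou_bound _ (fun n xi => `|xi| * cosT (profile_approx n) xi ^+ 2)).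
- by move=> n; exact: mc.
- by move=> n x; rewrite mulr_ge0 ?sqr_ge0.
- move=> xi; apply: cvgM; first exact: cvg_cst.
  by rewrite expr2; under eq_fun do rewrite expr2; apply: cvgM; exact: cosT_approx_cvg.
move=> n; pose h k xi : R := weight k ^+ 2 * lorentzian (scale k) xi.
have lh k : L1 (h k) by apply/L1Z/L1_lorentzian/scale_gt0.
have lS := L1Z 2400 (L1_sum n lh).
have lc : L1 (fun xi => `|xi| * cosT (profile_approx n) xi ^+ 2).
  apply: (L1_le _ _ lS); first exact: mc.
  by move=> xi; rewrite ger0_norm ?cosT_approx_le// mulr_ge0// sqr_ge0.
rewrite -(Rint_EFin measurableT lc) lee_fin.
apply: (@le_trans _ _ (\int[mu]_x (2400 * \sum_(k < n) h k x))).
  by apply: le_Rintegral => // xi _; exact: cosT_approx_le.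
rewrite RintegralZl//; last exact: L1_sum.
rewrite Rint_sum//.
have h1 : \sum_(k < n) \int[mu]_xi h k xi <= 4 * \sum_(k < n) weight k ^+ 2.
  rewrite mulr_sumr; apply: ler_sum => k _; rewrite /h RintegralZl//; last first.
    by apply/L1_lorentzian/scale_gt0.
  rewrite mulrC ler_wpM2r ?sqr_ge0// -lee_fin Rint_EFin//; last first.
    by apply/L1_lorentzian/scale_gt0.
  by apply/lorentzian_int/scale_gt0.
have h2 : \sum_(k < n) weight k ^+ 2 <= 2.
  case: n {lS lc h1} => [|n]; first by rewrite big_ord0.
  apply: (le_trans (sum_inv_sq n)); rewrite gerBl invr_ge0; exact: ler0n.
lra.
Qed.

(** This is where r <= 1 / 2, that is s <= 3 / 2, enters. *)
Lemma powR_sq_le (r : R) xi : 0 < r <= 2^-1 -> (`|xi| `^ r) ^+ 2 <= \1_`[-1, 1] xi + `|xi|.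
Proof.
move=> /andP[r0 r1]; rewrite indicE mem_setE in_itv/= -ler_norml -powR_mulrn ?powR_ge0// -powRrM.
have [xi1|/ltW xi1] := leP `|xi| 1.
  by apply: (@le_trans _ _ 1); [rewrite -[leRHS](congr1 (@^~ (r * 2)) (@powR1 R)); apply: ge0_ler_powR; rewrite ?nnegrE//; lra|rewrite lerDl].
rewrite add0r -[leRHS]powRr1//; apply: ler_powR => //.
by lra.
Qed.

Lemma profile_weighted_fourier (r : R) : 0 < r <= 2^-1 ->
  (\int[mu]_xi (weighted_fourier r (fun x => - profile x) xi ^+ 2)%:E < +oo)%E.
Proof.
move=> hr; pose M : R := \int[mu]_x `|profile x|.
have lc : L1 (fun xi => `|xi| * cosT profile xi ^+ 2).
  apply: L1_ge0; last by apply: le_lt_trans profile_fourier_int _; exact: ltry.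
    apply: measurable_funM; first exact: measurable_abs (@measurable_id _ _ setT).
    exact: (measurable_funX 2 (continuous_measurable_fun (cosT_continuous L1_profile))).
  by move=> xi; rewrite mulr_ge0// sqr_ge0.
have cN xi : cosT (fun x => - profile x) xi = - cosT profile xi.
  rewrite -[RHS]add0r -[X in X - _](mul0r (cosT profile xi)) -[X in _ - X]mul1r.
  rewrite -cosT_lin//; [|exact: L1_profile|exact: L1_profile].
  by congr cosT; apply/funext => x; rewrite mul0r mul1r sub0r.
have sN xi : sinT (fun x => - profile x) xi = - sinT profile xi.
  rewrite -[RHS]add0r -[X in X - _](mul0r (sinT profile xi)) -[X in _ - X]mul1r.
  rewrite -sinT_lin//; [|exact: L1_profile|exact: L1_profile].
  by congr sinT; apply/funext => x; rewrite mul0r mul1r sub0r.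
have cM xi : cosT profile xi ^+ 2 <= M ^+ 2.
  have h : `|cosT profile xi| <= M.
    apply: (le_trans (Rint_le_abs (L1_cos _ L1_profile))).
    apply: le_Rintegral => //; [exact/L1_abs/L1_cos/L1_profile|exact/L1_abs/L1_profile|].
    by move=> x _; rewrite normrM ler_piMr// abs_cos_le1.
  by rewrite -real_normK ?num_real// ler_sqr ?nnegrE// (le_trans _ h).
have lg : L1 (fun xi => M ^+ 2 * \1_`[-1, 1] xi + `|xi| * cosT profile xi ^+ 2).
  by apply: L1D => //; apply: L1Z; exact: L1_indic_itv.
have lw : L1 (fun xi => weighted_fourier r (fun x => - profile x) xi ^+ 2).
  apply: (L1_le _ _ lg).
    exact: (measurable_funX 2 (measurable_weighted_fourier r (L1N L1_profile))).
  move=> xi; rewrite ger0_norm ?sqr_ge0// weighted_fourier_sq cN sN sinT_profile.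
  rewrite oppr0 expr0n addr0 sqrrN.
  apply: (le_trans (ler_wpM2r (sqr_ge0 _) (powR_sq_le xi hr))).
  by rewrite mulrDl lerD2r mulrC ler_wpM2r// indicE ler0n.
by rewrite -(Rint_EFin measurableT lw) ltry.
Qed.

End profile.

(** * Blow-up of the seminorm *)

Section blowup.
Context {R : realType}.
Notation mu := (@lebesgue_measure R).
Notation V := (@profile R).

Let V0 := @profile_ge0 R.
Let mV : measurable_fun setT V. Proof. exact: measurable_profile. Qed.
Let lV := @L1_profile R.
Let lV2 := @L1_profile_sq R.
Let V_supp := @profile_supp R.
Let V_cont x : x != 0 -> {for x, continuous V}. Proof. exact: profile_cont. Qed.

Lemma L2norm_le (f : R -> R) (K : R) : 0 <= K -> (L2norm f <= K%:E)%E ->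
  (\int[mu]_x (f x ^+ 2)%:E <= (K ^+ 2)%:E)%E.
Proof.
move=> K0 fK; rewrite -L2norm_sq -powR_mulrn// -poweR_EFin.
by apply: gt0_ler_poweR => //; rewrite in_itv/= leey andbT ?lee_fin ?L2norm_ge0.
Qed.

Lemma slope_outside (t : R) : 0 <= t -> vanishes_outside 6 (slope V t).
Proof. by move=> t0; apply: aeW => x; exact: slope_vanishes. Qed.

Lemma datum_prim x : datum V x = 0 + prim (fun y => - V y) x.
Proof.
rewrite add0r /datum (_ : (fun y => - V y) = fun y => -1 * V y).
  by rewrite primZ// mulN1r.
by apply/funext => y; rewrite mulN1r.
Qed.

Lemma datum_weak_derivative : weak_derivative (datum V) (fun y => - V y).
Proof. exact: (prim_weak_derivative (L1N lV) datum_prim). Qed.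

Lemma datum_square_integrable : square_integrable (fun y => - V y).
Proof.
apply: square_integrableP; first exact: L1_measurable (L1N lV).
under eq_integral do rewrite sqrrN.
by apply: le_lt_trans profile_sq_int _; exact: ltry.
Qed.

Lemma datum_Linfty_Hdot1 : Linfty_Hdot1 (datum V).
Proof.
split.
- exists (\int[mu]_y `|V y|); split; first exact: num_real.
  by move=> M /ltW hM x _ /=; rewrite /datum normrN; exact: le_trans (prim_abs x lV) hM.
- by move=> x; apply: cvgN; exact: prim_continuous.
- by exists (fun y => - V y); [exact: datum_weak_derivative|exact: datum_square_integrable].
Qed.

Lemma datum_seminorm (s : R) : 1 < s <= 3 / 2 -> (Hdot_seminorm s (datum V) < +oo)%E.
Proof.
move=> /andP[s1 s2].
rewrite (@Hdot_seminormE R s _ (fun y => - V y) 2 datum_weak_derivative (L1N lV) datum_square_integrable).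
  by apply/L2norm_lty/profile_weighted_fourier; apply/andP; split; lra.
by apply: aeW => x /V_supp ->; rewrite oppr0.
Qed.

Lemma solution_seminorm (s : R) u t : dissipative_solution (datum V) u -> 0 <= t ->
  Hdot_seminorm s (u t) = L2norm (weighted_fourier (s - 1) (slope V t)).
Proof.
move=> hu t0; have ls := L1_slope V0 mV lV V_supp V_cont t0.
apply: (Hdot_seminormE s _ ls _ (slope_outside t0)).
  apply: (@prim_weak_derivative _ _ _ 0 ls) => x.
  by rewrite add0r (solution_prim V0 mV lV lV2 V_supp V_cont x hu).
exact: slope_square_integrable.
Qed.

(** At time t put e = 1 - t h / 2, which tends to 0 as t increases to 2 / h.
If the integral were at most N2, [concentration_bound] for the transported
plateau, multiplied by e l where l^2 is the width of the original plateau,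
would read q <= e B + q / 2 with q > 0 and B independent of t. *)
Lemma slope_fourier_blowup (r N2 : R) n : 0 < r -> 0 <= N2 ->
  exists2 d, 0 < d & forall t, 0 <= t -> 2 / height n - d < t < 2 / height n ->
  (N2%:E < \int[mu]_xi (weighted_fourier r (slope V t) xi ^+ 2)%:E)%E.
Proof.
move=> r0 N20; have h0 := @height_gt0 R n; set h := height n in h0 *.
have s0 := @scale_gt0 R n; set b := scale n in s0 *.
have cos1 : 0 < cos (1 : R) by exact: cos1_gt0.
move: (cos 1) cos1 (@concentration_bound R) => k k0 bound.
pose l := Num.sqrt (b / 2).
have l0 : 0 < l by rewrite sqrtr_gt0 divr_gt0.
pose C := \int[mu]_x V x.
have C0 : 0 <= C by apply: Rintegral_ge0 => x _; exact: V0.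
pose q := h * l * k / 2.
have q0 : 0 < q by rewrite divr_gt0// !mulr_gt0.
(* this value of A makes the high-frequency term equal to q / 2 *)
pose A := ((N2 + 1) / q) `^ r^-1.
have N1 : 0 < N2 + 1 by lra.
have A0 : 0 < A by rewrite powR_gt0// divr_gt0.
have Ar : A `^ (- r) = q / (N2 + 1).
  rewrite /A -powRrM mulrN mulVf ?gt_eqF// powRN powRr1; first by rewrite invf_div.
  by apply: divr_ge0; exact: ltW.
pose B := A * C * l.
have B0 : 0 <= B by rewrite !mulr_ge0// ltW.
have B1 : 0 < 2 * (B + 1) by lra.
have d0 : 0 < 2 / h * (q / (2 * (B + 1))) by apply: mulr_gt0; apply: divr_gt0.
exists (2 / h * (q / (2 * (B + 1)))); first exact: d0.
move=> t t0 /andP[t1 t2]; rewrite ltNge; apply/negP => hN2.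
pose e := 1 - t * h / 2.
have e0 : 0 < e by move: t2; rewrite ltr_pdivlMr// /e; lra.
have e1 : e * (2 * (B + 1)) < q.
  rewrite -ltr_pdivlMr; last by lra.
  have : (2 / h - t) * (h / 2) < 2 / h * (q / (2 * (B + 1))) * (h / 2).
    by rewrite ltr_pM2r ?divr_gt0//; lra.
  have -> : (2 / h - t) * (h / 2) = e by rewrite /e; field; rewrite gt_eqF.
  have -> // : 2 / h * (q / (2 * (B + 1))) * (h / 2) = q / (2 * (B + 1)).
  by field; rewrite !gt_eqF//; lra.
have ls := L1_slope V0 mV lV V_supp V_cont t0.
have b2 : b / 2 < b by lra.
have b20 : 0 < b / 2 by lra.
have pl x : b / 2 <= x <= b -> V x = h by exact: profile_plateau.
have [x0 hx0] := slope_plateau V0 mV V_supp t0 b20 b2 pl e0.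
have el0 : 0 < e ^+ 2 * (b / 2) by rewrite mulr_gt0// exprn_gt0.
have c0 : 0 < (e ^+ 2 * (b / 2))^-1 by rewrite invr_gt0.
have he0 : 0 <= h / e by apply: divr_ge0; exact: ltW.
have {}bound := bound (slope V t) x0 _ A r (h / e) N2 ls
  (slope_le0 V0 t) c0 A0 r0 he0 _ hN2.
have sqE : Num.sqrt (e ^+ 2 * (b / 2))^-1 = (e * l)^-1.
  rewrite sqrtrV; last exact: ltW.
  by rewrite sqrtrM ?sqr_ge0// sqrtr_sqr (ger0_norm (ltW e0)).
have {}bound : h / e * k / 2 <= A * C + q / (N2 + 1) * (e * l)^-1 * (N2 + 1) / 2.
  apply: le_trans (bound _) _ => [x|].
    rewrite invfM invrK => hx; rewrite hx0//; move: hx; rewrite -/e.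
      by (have -> : b - b / 2 = b / 2 by field); rewrite [2^-1 * _]mulrC.
  rewrite Ar sqE lerD2r; apply: ler_wpM2l; [exact: ltW|exact: slope_int_le].
have : (h / e * k / 2) * (e * l) <= (A * C + q / (N2 + 1) * (e * l)^-1 * (N2 + 1) / 2) * (e * l).
  by rewrite ler_wpM2r// mulr_ge0 ?ltW.
have -> : h / e * k / 2 * (e * l) = q by rewrite /q; field; rewrite gt_eqF.
have -> : (A * C + q / (N2 + 1) * (e * l)^-1 * (N2 + 1) / 2) * (e * l) = e * B + q / 2.
  by rewrite /B; field; rewrite !gt_eqF.
by move: e1; rewrite mulrDr; lra.
Qed.

Lemma solution_diff_seminorm (s : R) u t t' : dissipative_solution (datum V) u ->
  0 <= t -> 0 <= t' ->
  Hdot_seminorm s (u t \- u t') =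
  L2norm (weighted_fourier (s - 1) (fun x => slope V t x - slope V t' x)).
Proof.
move=> hu t0 t'0; have ls := L1_slope V0 mV lV V_supp V_cont t0.
have ls' := L1_slope V0 mV lV V_supp V_cont t'0.
have sq tau : 0 <= tau -> L1 (fun x => slope V tau x ^+ 2).
  move=> tau0; apply: L1_ge0.
  - exact: (measurable_funX 2 (L1_measurable (L1_slope V0 mV lV V_supp V_cont tau0))).
  - by move=> x; exact: sqr_ge0.
  - apply/L2norm_lty; have := slope_square_integrable V0 mV lV2 V_supp V_cont tau0.
    by rewrite /square_integrable inE => /andP[_]; rewrite inE.
have ld := L1B ls ls'.
apply: (@Hdot_seminormE _ _ _ _ 6) => //.
- apply: (@prim_weak_derivative _ _ _ 0 ld) => x.
  rewrite add0r primB_fun//=.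
  rewrite (solution_prim V0 mV lV lV2 V_supp V_cont x hu t0).
  by rewrite (solution_prim V0 mV lV lV2 V_supp V_cont x hu t'0).
- apply: square_integrableP; first exact: L1_measurable ld.
  have lS := L1Z 2 (L1D (sq _ t0) (sq _ t'0)).
  have l2 : L1 (fun x => (slope V t x - slope V t' x) ^+ 2).
    apply: (L1_le _ _ lS); first exact: (measurable_funX 2 (L1_measurable ld)).
    move=> x; rewrite ger0_norm ?sqr_ge0//.
    by have := sqr_ge0 (slope V t x + slope V t' x); move: (slope V t x) (slope V t' x) => p q; lra.
  by rewrite -(Rint_EFin measurableT l2) ltry.
- by apply: aeW => x hx; rewrite !(slope_vanishes V0 mV V_supp)// subrr.
Qed.

(** The inequality |z|^2 <= 2 (|w|^2 + |z - w|^2), by linearity of the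
transforms. *)
Lemma weighted_fourier_triangle (r : R) (f g : R -> R) xi : L1 f -> L1 g ->
  weighted_fourier r f xi ^+ 2 <=
  2 * (weighted_fourier r g xi ^+ 2 + weighted_fourier r (fun x => f x - g x) xi ^+ 2).
Proof.
move=> lf lg; rewrite !weighted_fourier_sq -mulrDr mulrCA.
apply: ler_wpM2l; first exact: sqr_ge0.
have -> : (fun x => f x - g x) = fun x => 1 * f x - 1 * g x.
  by apply/funext => x; rewrite !mul1r.
rewrite cosT_lin// sinT_lin// !mul1r.
move: (cosT f xi) (cosT g xi) (sinT f xi) (sinT g xi) => a b c d.
by have := sqr_ge0 (2 * b - a); have := sqr_ge0 (2 * d - c); lra.
Qed.

Lemma weighted_fourier_sq_L1 (r K : R) (f : R -> R) : L1 f ->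
  (\int[mu]_xi (weighted_fourier r f xi ^+ 2)%:E <= K%:E)%E ->
  L1 (fun xi => weighted_fourier r f xi ^+ 2).
Proof.
move=> lf h; apply: L1_ge0; last by apply: le_lt_trans h _; exact: ltry.
  exact: (measurable_funX 2 (measurable_weighted_fourier r lf)).
by move=> x; exact: sqr_ge0.
Qed.

Lemma weighted_fourier_int_triangle (r a b : R) (f g : R -> R) : L1 f -> L1 g ->
  (\int[mu]_xi (weighted_fourier r g xi ^+ 2)%:E <= a%:E)%E ->
  (\int[mu]_xi (weighted_fourier r (fun x => f x - g x) xi ^+ 2)%:E <= b%:E)%E ->
  (\int[mu]_xi (weighted_fourier r f xi ^+ 2)%:E <= (2 * (a + b))%:E)%E.
Proof.
move=> lf lg ga db; have tri xi := @weighted_fourier_triangle r f g xi lf lg.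
have lG := weighted_fourier_sq_L1 lg ga.
have lD := weighted_fourier_sq_L1 (L1B lf lg) db.
have mF := measurable_funX 2 (measurable_weighted_fourier r lf).
move: ga db lG lD tri mF.
move: (weighted_fourier r g) (weighted_fourier r f)
  (weighted_fourier r (fun x => f x - g x)) => G F D ga db lG lD tri mF.
have lS := L1Z 2 (L1D lG lD).
have lF : L1 (fun xi => F xi ^+ 2).
  by apply: (L1_le _ _ lS) => // xi; rewrite ger0_norm ?sqr_ge0.
rewrite -(Rint_EFin measurableT lF) lee_fin.
apply: (@le_trans _ _ (\int[mu]_xi (2 * (G xi ^+ 2 + D xi ^+ 2)))).
  by apply: le_Rintegral => // xi _; exact: tri.
rewrite RintegralZl//; last exact: (L1D lG lD).
rewrite (RintegralD measurableT lG lD).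
by rewrite ler_pM2l// lerD// -lee_fin ?(Rint_EFin measurableT lG) ?(Rint_EFin measurableT lD).
Qed.

(** At t0 = 2 / [height n] the seminorm would be finite, and continuity at t0
would bound the seminorm of [u t - u t0] by 1 for t close to t0. The triangle
inequality then contradicts [slope_fourier_blowup] for some t < t0. *)
Lemma not_continuous_at_plateau (s : R) u n T : 1 < s -> dissipative_solution (datum V) u ->
  2 / height n < T -> ~ continuous_in_Hdot s T u.
Proof.
move=> s1 hu; have h0 := @height_gt0 R n; set t0 := 2 / height n => t0T [fin cont].
have t00 : 0 < t0 by rewrite divr_gt0.
have t0in : t0 \in `[0, T] by rewrite in_itv/= !ltW.
have l0 := L1_slope V0 mV lV V_supp V_cont (ltW t00).
have := fin _ t0in; rewrite (solution_seminorm _ hu (ltW t00)) => fin0.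
pose K := fine (L2norm (weighted_fourier (s - 1) (slope V t0))).
have KE : L2norm (weighted_fourier (s - 1) (slope V t0)) = K%:E.
  by rewrite fineK// ge0_fin_numE// L2norm_ge0.
have K0 : 0 <= K by rewrite fine_ge0// L2norm_ge0.
have b0 := @L2norm_le _ _ K0 (eq_ind_r (fun x => x <= K%:E)%E (lexx _) KE).
have r0 : 0 < s - 1 by lra.
have N20 : 0 <= 2 * (K ^+ 2 + 1) by have := sqr_ge0 K; lra.
have [d d0 hd] := slope_fourier_blowup n r0 N20.
have c0 := cont _ t0in.
have n1 : nbhs (0 : \bar R)%E [set y | (y < 1%:E)%E].
  by apply: open_nbhs_nbhs; split; [exact: open_ereal_lt_ereal|rewrite /= lte01].
have /nbhs_ballP[e /= e0 he] := c0 _ n1.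
pose m := Num.min (Num.min d e) t0.
have m0 : 0 < m by rewrite !lt_min d0 e0.
have [md [me mt]] : m <= d /\ m <= e /\ m <= t0.
  by split; [|split]; rewrite /m !ge_min lexx ?orbT.
pose t := t0 - m / 2.
have tp : 0 <= t by rewrite /t; lra.
have lt := L1_slope V0 mV lV V_supp V_cont tp.
have /he : ball t0 e t by rewrite /ball/= /t opprB addrC subrK ger0_norm; lra.
have -> /= : t \in `[0, T] by rewrite in_itv/= tp/= /t; lra.
move=> /(_ isT)/ltW.
rewrite (solution_diff_seminorm _ hu tp (ltW t00)) => /(L2norm_le ler01).
rewrite expr1n => b1.
have : 2 / height n - d < t < 2 / height n by rewrite -/t0 /t; apply/andP; split; lra.
move=> /(hd t tp); apply/negP; rewrite -leNgt.
exact: weighted_fourier_int_triangle b0 b1.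
Qed.

Lemma seminorm_sup (s : R) u n T : 1 < s -> dissipative_solution (datum V) u ->
  2 / height n < T -> ereal_sup [set Hdot_seminorm s (u t) | t in `]0, T[] = +oo%E.
Proof.
move=> s1 hu; have h0 := @height_gt0 R n; set t0 := 2 / height n => t0T.
have t00 : 0 < t0 by rewrite divr_gt0.
apply/eqyP => K K0.
have r0 : 0 < s - 1 by lra.
have [d d0 hd] := slope_fourier_blowup n r0 (sqr_ge0 K).
pose m := Num.min d t0.
have m0 : 0 < m by rewrite lt_min d0.
have [md mt] : m <= d /\ m <= t0 by split; rewrite /m ge_min lexx ?orbT.
pose t := t0 - m / 2.
have tp : 0 < t by rewrite /t; lra.
have : 2 / height n - d < t < 2 / height n by rewrite -/t0 /t; apply/andP; split; lra.
move=> /(hd t (ltW tp)) big.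
apply: (@le_trans _ _ (Hdot_seminorm s (u t))).
  rewrite (solution_seminorm _ hu (ltW tp)) leNgt; apply/negP => /ltW/(L2norm_le (ltW K0)).
  by apply/negP; rewrite -ltNge.
apply: ereal_sup_ubound; exists t => //=; rewrite in_itv/= tp/=.
by rewrite /t; lra.
Qed.

End blowup.

Theorem theorem1p1 (R : realType) (s : R) (hs : 1 < s <= 3 / 2) :
  exists u0 : R -> R,
    [/\ Linfty_Hdot1 u0,
        (Hdot_seminorm s u0 < +oo)%E,
        (exists u : R -> R -> R, dissipative_solution u0 u) &
        forall u : R -> R -> R, dissipative_solution u0 u ->
          forall T : R, 0 < T ->
            ereal_sup [set Hdot_seminorm s (u t) | t in `]0, T[] = +oo%E
            /\ ~ continuous_in_Hdot s T u].
Proof.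
exists (datum profile); split.
- exact: datum_Linfty_Hdot1.
- exact: datum_seminorm.
- apply: solution_exists.
  + exact: profile_ge0.
  + exact: measurable_profile.
  + exact: L1_profile.
  + exact: L1_profile_sq.
  + exact: profile_supp.
  + by move=> x; exact: profile_cont.
move=> u hu T T0; have /andP[s1 _] := hs.
have [n hn] := height_unbounded (2 / T).
have nT : 2 / height n < T.
  by rewrite ltr_pdivrMr ?height_gt0// mulrC -ltr_pdivrMr.
by split; [exact: seminorm_sup hu nT|exact: not_continuous_at_plateau hu nT].
Qed.
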